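(* Let $\epsilon>0$ and let $T_n^{\mathrm{tor}}$ be the torus first-passage time with mean-$1$ exponential weights (as defined in the context). Suppose the curvature assumption in direction $\mathbf{e}_1$ holds: there are constants $\epsilon_0,c_0>0$ such that $g(\mathbf{e}_1+\beta\mathbf{e}_2)-g(\mathbf{e}_1)\ge c_0\beta^2$ for all $\beta\in(-\epsilon_0,\epsilon_0)$, where $g$ is the limiting norm. Then there exists $c>0$ such that for all integers $n\ge1$ and all real $k>0$, $$\mathbf{E}\left|T_n^{\mathrm{tor}}-\mathbf{E}T_n^{\mathrm{tor}}\right|^k\ \ge\ c\,n^{\left(\frac18-\epsilon\right)k-\frac32}.$$
   Context: $\mathbf{e}_1,\mathbf{e}_2$ are the coordinate vectors of $\mathbf{R}^2$ and $|\cdot|$ is the Euclidean norm. Paths are nearest-neighbor lattice paths. Torus. $B(n)=\mathbb{Z}^2\cap[0,n]^2$, $E(n)=\{\{x,y\}:x,y\in B(n),|x-y|=1\}$, and $E(n)^o$ is the set of $\{x,y\}\in E(n)$ with at least one of $x,y$ in $B(n-1)$. Let $(t^{(n)}_e)_{e\in E(n)^o}$ be i.i.d. exponential with mean $1$, extended to all nearest-neighbor edges of $\mathbb{Z}^2$ periodically by $t^{(n)}_{e+nz}=t^{(n)}_e$ for $z\in\mathbb{Z}^2$. For a path $\Gamma$ put $T^{(n)}(\Gamma)=\sum_{e\in\Gamma}t_e^{(n)}$, and for $x,y\in\mathbb{Z}^2$ let $T^{(n)}(x,y)$ be the minimum of $T^{(n)}(\Gamma)$ over all paths in $\mathbb{Z}^2$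 from $x$ to $y$. Then $T_n^{\mathrm{tor}}=\inf_{x\in\mathbb{Z}^2:\,x\cdot\mathbf{e}_1=0}T^{(n)}(x,x+n\mathbf{e}_1)$. Norm $g$. Let $(t_e)$ be i.i.d. exponential random variables with mean $1$ indexed by all nearest-neighbor edges of $\mathbb{Z}^2$, $T(\Gamma)=\sum_{e\in\Gamma}t_e$, and $T(x,y)=\min_\Gamma T(\Gamma)$ over self-avoiding paths in $\mathbb{Z}^2$ from $x$ to $y$. It is known that there is a norm $g:\mathbf{R}^2\to\mathbf{R}_+$ such that a.s. $g(x)=\lim_{n\to\infty}T(0,nx)/n$ for all $x\in\mathbb{Z}^2$. *)

(* Defs.v *)
From mathcomp Require Import all_boot all_order all_algebra finmap.
From mathcomp Require Import all_classical all_reals all_analysis.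
Import Order.TTheory GRing.Theory Num.Theory numFieldNormedType.Exports.

Set Implicit Arguments.
Unset Strict Implicit.
Unset Printing Implicit Defensive.

Local Open Scope classical_set_scope.
Local Open Scope ring_scope.

Definition Z2 := 'rV[int]_2.

Definition e1 {K : pzRingType} : 'rV[K]_2 := delta_mx 0 0.
Definition e2 {K : pzRingType} : 'rV[K]_2 := delta_mx 0 1.

Definition toR2 (R : realType) (x : Z2) : 'rV[R]_2 := map_mx intr x.

(** [|x - y| = 1] for the Euclidean norm; it is squared to stay in [int]. *)
Definition adjacent (x y : Z2) : bool :=
  \sum_(j < 2) (x 0 j - y 0 j) ^+ 2 == 1.

(** The edge [{x, y}] is the finite set [[fset x; y]], hence unoriented. *)
Definition edges : set {fset Z2} :=
  [set e | exists x y : Z2, adjacent x y /\ e = [fset x; y]%fset].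

Definition shift_edge (z : Z2) (e : {fset Z2}) : {fset Z2} :=
  [fset (x + z)%R | x in e]%fset.

(** The parameter of [box] is an integer so that [box (n%:Z - 1)] is literally
    B(n - 1). *)
Definition box (m : int) : set Z2 := [set x | forall j, 0 <= x 0 j <= m].

Definition box_edges (n : nat) : set {fset Z2} :=
  [set e | exists x y : Z2, [/\ box n%:Z x, box n%:Z y,
    adjacent x y & e = [fset x; y]%fset]].

Definition torus_edges (n : nat) : set {fset Z2} :=
  [set e | exists x y : Z2, [/\ box_edges n e, e = [fset x; y]%fset
    & box (n%:Z - 1) x \/ box (n%:Z - 1) y]].

Section passage_times.
Context {R : realType}.
Implicit Types (w : {fset Z2} -> R) (x y : Z2) (p : seq Z2).

(** A path is given by its starting point [x] and the sequence [p] of the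
    vertices that it visits afterwards; an edge counts each time it is
    crossed. *)
Definition path_time w x p : R :=
  \sum_(e <- pairmap (fun a b => [fset a; b]%fset) x p) w e.

Definition paths x y : set (seq Z2) :=
  [set p | path adjacent x p /\ last x p = y].

Definition saw_paths x y : set (seq Z2) :=
  [set p | [/\ path adjacent x p, last x p = y & uniq (x :: p)]].

(** For i.i.d. exponential weights (on all edges, respectively extended
    periodically) the two infima below are almost surely minima. *)
Definition passage_time w x y : R := inf [set path_time w x p | p in paths x y].

Definition saw_passage_time w x y : R :=
  inf [set path_time w x p | p in saw_paths x y].

Definition torus_time (n : nat) w : R :=
  inf [set passage_time w x (x + e1 *+ n) | x in [set x : Z2 | x 0 0 = 0]].

Definition is_norm (g : 'rV[R]_2 -> R) : Prop :=
  [/\ forall u, 0 <= g u,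
      forall u, g u = 0 -> u = 0,
      forall (a : R) u, g (a *: u) = `|a| * g u
    & forall u v, g (u + v) <= g u + g v].

Definition curvature_e1 (g : 'rV[R]_2 -> R) : Prop :=
  exists eps0 c0 : R, [/\ 0 < eps0, 0 < c0 &
    forall b : R, - eps0 < b < eps0 -> c0 * b ^+ 2 <= g (e1 + b *: e2) - g e1].

End passage_times.

Section probability.
Context {R : realType} {d : measure_display} {Omega : measurableType d}.
Variable P : probability Omega R.

Definition mutually_independent (I : choiceType) (D : set I)
    (X : I -> {RV P >-> R}) : Prop :=
  forall (J : {fset I}) (A : I -> set R),
    [set` J] `<=` D -> (forall i, measurable (A i)) ->
    P (\bigcap_(i in [set` J]) X i @^-1` A i) =
    (\prod_(i <- J) P (X i @^-1` A i))%E.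

Definition iid_exp1 (I : choiceType) (D : set I) (X : I -> {RV P >-> R}) : Prop :=
  mutually_independent D X /\
  forall i, D i -> forall A : set R, measurable A ->
    distribution P (X i) A = exponential_prob (1 : R) A.

(** Weights are indexed by all finite subsets of Z^2; only their values on
    [edges] matter. *)
Definition periodic (n : nat) (t : {fset Z2} -> {RV P >-> R}) : Prop :=
  forall (z : Z2) (e : {fset Z2}), edges e ->
    forall w, t (shift_edge (z *+ n) e) w = t e w.

Definition torus_weights (n : nat) (t : {fset Z2} -> {RV P >-> R}) : Prop :=
  iid_exp1 (torus_edges n) t /\ periodic n t.

Definition limit_norm (t : {fset Z2} -> {RV P >-> R}) (g : 'rV[R]_2 -> R) : Prop :=
  is_norm g /\
  {ae P, forall w, forall x : Z2,
     (fun m : nat => saw_passage_time (fun e => t e w) 0 (x *+ m) / m%:R)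
       @ \oo --> g (toR2 R x)}.

Definition T_tor (n : nat) (t : {fset Z2} -> {RV P >-> R}) : Omega -> R :=
  fun w => torus_time n (fun e => t e w).

(** Meant for integrable [X], such as [T_tor]: [fine] sends an infinite mean to 0. *)
Definition central_moment (X : Omega -> R) (k : R) : \bar R :=
  'E_P[fun w => `|X w - fine 'E_P[X]| `^ k].

End probability.

(* Main.v *)
(** If the weights of the edges of a set of size N are all scaled by 1 - delta
    with delta ~ N^{-1/2}, then the law of the weights changes by a bounded
    factor in L^2, so that an event of probability p is sent to an event of
    probability at least p^2 / 2. This is applied to the edges of a horizontal
    strip of the torus of height H that contains a near-optimal path with
    probability of order H / n: since the torus time is linear in n, the
    scaling lowers it by about delta n ~ (n / H)^{1/2}, and whichever value m
    is taken, |T - m| exceeds this order with probability at least c n^{-3/2}.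

    The admissible heights are H ~ n^{3/4 + a/2}: a path that wanders at height
    H costs c H^2 / n more than the straight one, by curvature, while passage
    times are controlled up to n^{1/2 + a}. For the lower bounds, each passage
    time X satisfies E e^{-th X} <= exp(- th / (1 + th) E X). For the upper
    bounds, the smallest expected passage time l(n) to the column x = n
    satisfies l(2n) >= 2 l(n) - C n^{1/2 + a} by the same inequality, so that
    l(n) <= n g(e_1) + C' n^{1/2 + a}; reflecting in this column then bounds
    the expected time to (2n, 0) by 2 l(n). *)
From HB Require Import structures.
From mathcomp Require Import all_boot all_order all_algebra finmap.
From mathcomp Require Import all_classical all_reals all_analysis.
From mathcomp Require Import measurable_realfun.
Require Import Defs.
From mathcomp Require Import ring lra zify.
Import Order.TTheory GRing.Theory Num.Theory numFieldNormedType.Exports.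

Set Implicit Arguments.
Unset Strict Implicit.
Unset Printing Implicit Defensive.

Local Open Scope classical_set_scope.
Local Open Scope ring_scope.

(** The obstacle is that torus weights are periodic: a long path may meet the same weight several
    times, so bounds for the plane do not apply to it. In a window of radius [r] with [2 r < n] the
    weights are i.i.d., and a walk is cut whenever it leaves a window of radius about [n / 4]. A
    relative loss [2 n^(a - 1/2)] pays for every complete piece, so only the last piece adds an
    error [n^(1/2 + a)], however many pieces there are.

    The Laplace bound is proved one weight at a time. As a function of one weight, a minimum over
    self-avoiding paths is [min (A + s, B)]; for such functions the weight scaled by [1 + th] is
    compared with the unscaled one, and averaging over another weight preserves the comparison.

    A strip has order [n H] edges, hence [delta] of order [n^(-7/8 - a/4)], and [delta n] exceeds
    [n^(1/8 - a)] by a power of [n] that absorbs all constants. The event found does not depend on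
    [k], so one [c] serves every moment. The finitely many small [n] are treated apart: there the
    torus time is arbitrarily large with positive probability. *)

Section ge0_expectation.
Context d (T : measurableType d) (R : realType) (P : probability T R).
Implicit Types f g : T -> R.

(** * Expectations of nonnegative functions and Jensen's inequality *)

Definition Ex f : \bar R := (\int[P]_x (f x)%:E)%E.

Lemma le_Ex f g : measurable_fun setT f -> measurable_fun setT g ->
  (forall x, 0 <= f x) -> (forall x, f x <= g x) -> (Ex f <= Ex g)%E.
Proof.
move=> mf mg f0 fg; apply: ge0_le_integral => //;
  first [exact/measurable_EFinP | by move=> x _; rewrite lee_fin].
Qed.

Lemma ExD f g : measurable_fun setT f -> measurable_fun setT g ->
  (forall x, 0 <= f x) -> (forall x, 0 <= g x) ->
  Ex (fun x => f x + g x) = (Ex f + Ex g)%E.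
Proof.
move=> mf mg f0 g0; rewrite /Ex; under eq_integral do rewrite EFinD.
rewrite ge0_integralD//; first [exact/measurable_EFinP | by move=> x _; rewrite lee_fin].
Qed.

Lemma ExZl k f : measurable_fun setT f -> 0 <= k -> (forall x, 0 <= f x) ->
  Ex (fun x => k * f x) = (k%:E * Ex f)%E.
Proof.
move=> mf k0 f0; rewrite /Ex; under eq_integral do rewrite EFinM.
rewrite ge0_integralZl//; first [exact/measurable_EFinP | by move=> x _; rewrite lee_fin].
Qed.

Lemma Ex_cst k : Ex (fun=> k) = k%:E.
Proof. by rewrite /Ex integral_cst// [X in (_ * X)%E]probability_setT mule1. Qed.

Lemma Ex_indic (A : set T) : measurable A -> Ex (\1_A) = P A.
Proof. by move=> mA; rewrite /Ex integral_indic// setIT. Qed.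

Lemma Ex_ge0 f : (forall x, 0 <= f x) -> (0 <= Ex f)%E.
Proof. by move=> f0; apply: integral_ge0 => x _; rewrite lee_fin. Qed.

Lemma Ex_fin f k : measurable_fun setT f -> (forall x, 0 <= f x <= k) ->
  Ex f \is a fin_num.
Proof.
move=> mf f0k; have f0 x : 0 <= f x by case/andP: (f0k x).
rewrite fin_numE gt_eqF ?(lt_le_trans _ (Ex_ge0 f0))//.
rewrite lt_eqF// (@le_lt_trans _ _ k%:E)// ?ltry// -Ex_cst.
by apply: le_Ex => // x; case/andP: (f0k x).
Qed.

Lemma fineP (A : set T) : measurable A -> P A = (fine (P A))%:E.
Proof. by move=> mA; rewrite fineK//; exact: fin_num_measure. Qed.

Lemma measurable_expRM (c : R) f : measurable_fun setT f ->
  measurable_fun setT (fun x => expR (c * f x)).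
Proof.
move=> mf; have mcf : measurable_fun setT (fun x => c * f x) by exact: measurable_funM.
exact: (measurableT_comp (@measurable_expR R) mcf).
Qed.

Definition bounded_mf (K : R) f := measurable_fun setT f /\ forall x, 0 <= f x <= K.

Definition E f : R := fine (Ex f).

Lemma EK K f : bounded_mf K f -> Ex f = (E f)%:E.
Proof. by move=> [mf f0K]; rewrite fineK//; exact: Ex_fin mf f0K. Qed.

Lemma E_bound K f : bounded_mf K f -> 0 <= E f <= K.
Proof.
move=> bf; have [mf f0K] := bf.
have f0 x : 0 <= f x by case/andP: (f0K x).
rewrite -!lee_fin -(EK bf) Ex_ge0//= -Ex_cst; apply: le_Ex => // x.
by case/andP: (f0K x).
Qed.

Lemma le_E K L f g : bounded_mf K f -> bounded_mf L g -> (forall x, f x <= g x) -> E f <= E g.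
Proof.
move=> bf bg fg; rewrite -lee_fin -(EK bf) -(EK bg); apply: le_Ex => //.
- by case: bf.
- by case: bg.
- by move=> x; case: bf => _ /(_ x) /andP[].
Qed.

(** Integrates the tangent of the exponential at the mean. The negative terms of the tangent are
    moved across, so that both sides are expectations of nonnegative functions. *)
Lemma jensen_expR (K lam : R) f g : 0 <= lam -> bounded_mf K f -> bounded_mf K g ->
  ((expR (lam * (E g - E f)))%:E <= Ex (fun x => expR (lam * (g x - f x))%R))%E.
Proof.
move=> lam0 bf bg; have [[mf f0K] [mg g0K]] := (bf, bg).
have f0 x : 0 <= f x by case/andP: (f0K x).
have g0 x : 0 <= g x by case/andP: (g0K x).
have [/andP[Ef0 _] /andP[Eg0 _]] := (E_bound bf, E_bound bg).
set m := lam * (E g - E f).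
have mX : measurable_fun setT (fun x => expR (lam * (g x - f x))).
  apply: measurableT_comp => //; apply: measurable_funM => //.
  exact: measurable_funB.
have mgl : measurable_fun setT (fun x => lam * g x) by exact: measurable_funM.
have mfl : measurable_fun setT (fun x => lam * f x) by exact: measurable_funM.
have e0 := expR_ge0 m.
have H : (Ex (fun x => expR m * (lam * g x + (1 + lam * E f)))%R <=
    Ex (fun x => expR (lam * (g x - f x)) + expR m * (lam * f x + lam * E g))%R)%E.
  apply: le_Ex.
  - by apply: measurable_funM => //; exact: measurable_funD.
  - by apply: measurable_funD => //; apply: measurable_funM => //; exact: measurable_funD.
  - by move=> x; rewrite mulr_ge0// addr_ge0 ?mulr_ge0// addr_ge0// mulr_ge0.
  - move=> x; have := expR_ge1Dx (lam * (g x - f x) - m).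
    rewrite -(ler_pM2l (expR_gt0 m)) -expRD.
    rewrite (_ : m + (lam * (g x - f x) - m) = lam * (g x - f x)); last by ring.
    move=> h; rewrite -lerBlDr; apply: le_trans h.
    by rewrite le_eqVlt; apply/orP; left; apply/eqP; rewrite /m; ring.
move: H; rewrite ExZl//; last 2 first.
- exact: measurable_funD.
- by move=> x; rewrite addr_ge0 ?mulr_ge0// addr_ge0// mulr_ge0.
rewrite (ExD mX); last 3 first.
- by apply: measurable_funM => //; exact: measurable_funD.
- by move=> x; exact: expR_ge0.
- by move=> x; rewrite mulr_ge0// addr_ge0 ?mulr_ge0.
rewrite (ExZl _ e0); last 2 first.
- exact: measurable_funD.
- by move=> x; rewrite addr_ge0 ?mulr_ge0.
rewrite !ExD//; last 4 first.
- by move=> x; rewrite mulr_ge0.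
- by move=> x; rewrite mulr_ge0.
- by move=> x; rewrite mulr_ge0.
- by move=> x; rewrite addr_ge0// mulr_ge0.
rewrite !ExZl// !Ex_cst (EK bf) (EK bg) => H.
have {}H : ((expR m * (lam * E g + (1 + lam * E f)))%:E <=
    Ex (fun x => expR (lam * (g x - f x))%R) + (expR m * (lam * E f + lam * E g))%:E)%E.
  exact: H.
rewrite -(leeD2rE (x := (expR m * (lam * E f + lam * E g))%:E))//.
apply: le_trans H; rewrite -EFinD lee_fin le_eqVlt; apply/orP; left; apply/eqP.
ring.
by move=> x; rewrite mulr_ge0.
Qed.

End ge0_expectation.

(** * Integration against a measure with a density *)

Section density.
Local Open Scope ereal_scope.
Context d (T : measurableType d) (R : realType).
Variables (mu nu : {measure set T -> \bar R}) (h : T -> R).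
Hypotheses (mh : measurable_fun setT h) (h0 : forall x, (0 <= h x)%R).
Hypothesis nuE : forall A, measurable A -> nu A = \int[mu]_(x in A) (h x)%:E.
Import HBNNSimple.

(** True for indicators by hypothesis, for simple functions by linearity, and for [f] by monotone
    convergence on both sides. *)
Lemma ge0_integral_density (f : T -> \bar R) :
  measurable_fun setT f -> (forall x, 0 <= f x) ->
  \int[nu]_x f x = \int[mu]_x (f x * (h x)%:E).
Proof.
move=> mf f0; pose g := nnsfun_approx measurableT mf.
have mhE : measurable_fun setT (EFin \o h) by exact/measurable_EFinP.
have hE0 x : 0 <= (h x)%:E by rewrite lee_fin.
have indic (A : set T) : measurable A ->
    \int[nu]_x (\1_A x)%:E = \int[mu]_x ((\1_A x)%:E * (h x)%:E).
  move=> mA; rewrite integral_indic// setIT nuE// [LHS]integral_mkcond.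
  apply: eq_integral => x _; rewrite patchE indicE.
  by case: (x \in A); rewrite ?mul1e ?mul0e.
have simple n : \int[nu]_x (g n x)%:E = \int[mu]_x ((g n x)%:E * (h x)%:E).
  under eq_integral do rewrite fimfunE -fsumEFin//.
  rewrite ge0_integral_fsum//; last 2 first.
  - by move=> r; exact/measurable_EFinP/measurableT_comp.
  - by move=> r x _; rewrite EFinM nnfun_muleindic_ge0.
  under [RHS]eq_integral.
    move=> x _; rewrite fimfunE -fsumEFin// ge0_mule_fsuml; last first.
      by move=> r; rewrite EFinM nnfun_muleindic_ge0.
    over.
  rewrite ge0_integral_fsum//; last 2 first.
  - move=> r; apply: emeasurable_funM => //.
    by apply/measurable_EFinP/measurableT_comp.
  - by move=> r x _; rewrite mule_ge0// EFinM nnfun_muleindic_ge0.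
  apply: eq_fsbigr => r rg.
  have r0 : (0 <= r)%R by move: rg; rewrite inE => -[x _ <-].
  under eq_integral do rewrite EFinM.
  rewrite ge0_integralZl//; last first.
    by apply/measurable_EFinP.
  rewrite indic//.
  under [RHS]eq_integral do rewrite EFinM -muleA.
  rewrite ge0_integralZl//.
    by apply: emeasurable_funM => //; exact/measurable_EFinP.
  by move=> x _; rewrite mule_ge0.
have gf x : (g n x)%:E @[n --> \oo] --> f x by exact: cvg_nnsfun_approx.
have ndg x : {homo (fun n => (g n x)%:E) : m n / (m <= n)%N >-> m <= n}.
  by move=> m n mn; rewrite lee_fin; exact/lefP/nd_nnsfun_approx.
have mg n : measurable_fun setT (fun x => (g n x)%:E) by exact/measurable_EFinP.
transitivity (\int[nu]_x limn (fun n => (g n x)%:E)).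
  by apply: eq_integral => x _; apply/esym/cvg_lim.
rewrite monotone_convergence//; last first.
  by move=> n x _; rewrite lee_fin.
under eq_fun do rewrite simple.
rewrite -monotone_convergence//; last 2 first.
  by move=> n x _; rewrite mule_ge0// lee_fin.
  by move=> x _ m n mn; rewrite lee_wpmul2r//; exact: ndg.
apply: eq_integral => x _; apply/cvg_lim => //.
exact: cvgeZr.
by move=> n; exact: emeasurable_funM.
Qed.

End density.

(** * The exponential law of mean 1 *)

Section exponential.
Variable R : realType.
Implicit Types (a c x M lam : R).
Notation mu := lebesgue_measure.

Definition exp1 : probability (measurableTypeR R) R :=
  exponential_distribution_exponential_prob__canonical__probability_measure_Probability
    (ltr01 : (0 : R) < 1).

Lemma exponential_prob_itvcy c x : 0 < c ->
  exponential_prob c `[x, +oo[ = (expR (- c * Num.max x 0))%:E.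
Proof.
move=> c0.
have cexp : continuous (fun z : R => expR (- c * z)).
  move=> z; apply: continuous_comp; last exact: continuous_expR.
  exact: mulrl_continuous.
have H (y : R) : 0 <= y -> exponential_prob c `[y, +oo[ = (expR (- c * y))%:E.
  move=> y0; rewrite /exponential_prob.
  rewrite (@ge0_continuous_FTC2y _ _ (fun x => - expR (- c * x)) y 0)//.
  - by rewrite sub0e EFinN oppeK.
  - by move=> z _; apply: exponential_pdf_ge0; exact: ltW.
  - apply: (@continuous_subspaceW R^o _ _ [set` `[0, +oo[%R]).
      by apply: subset_itvr; rewrite bnd_simp.
    exact: within_continuous_exponential_pdf.
  - rewrite -[0]oppr0; apply: cvgN.
    rewrite (_ : (fun x => expR (- c * x)) =
               (fun z => expR (- z)) \o (fun z => c * z)); last first.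
      by apply: eq_fun => z; rewrite mulNr.
    apply: (@cvg_comp _ _ _ _ _ _ (pinfty_nbhs R)); last exact: cvgr_expR.
    exact: gt0_cvgMry.
  - by apply: cvgN; apply/cvg_at_right_filter; exact: cexp.
  - move=> z; rewrite in_itv/= andbT => yz; apply: derive1_exponential_pdf.
    by rewrite in_itv/= andbT (le_lt_trans y0).
have [x0|x0] := leP 0 x; first by rewrite H.
rewrite -H//.
rewrite /exponential_prob [LHS]integral_mkcond [RHS]integral_mkcond.
apply: eq_integral => z _; rewrite !patchE !mem_setE /= !in_itv /= !andbT.
have [z0|z0] := leP 0 z; first by rewrite (le_trans (ltW x0) z0).
by case: ifP => // _; rewrite lt0_exponential_pdf.
Qed.

(** The half-lines [[x, +oo[] are stable under intersection and generate the Borel sets. *)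
Lemma probability_unique_itvcy (P Q : probability (measurableTypeR R) R) :
  (forall x : R, P `[x, +oo[%classic = Q `[x, +oo[%classic) ->
  forall A, measurable A -> P A = Q A.
Proof.
move=> PQ A mA.
apply: (@measure_unique _ _ (measurableTypeR R) (@RGenCInfty.G R)
   (fun n => `[- n%:R, +oo[%classic) _ _ _ _ P Q) => //.
- exact: RGenCInfty.measurableE.
- move=> _ _ [x ->] [y ->]; exists (Num.max x y).
  apply/seteqP; split => z /=; rewrite !in_itv/= !andbT ge_max; first by move=> [-> ->].
  by move=> /andP[].
- by move=> n; exists (- n%:R).
- apply/seteqP; split => // x _.
  exists (Num.truncn `|x|).+1 => //=; rewrite in_itv/= andbT.
  rewrite lerNl; apply: (le_trans (ler_norm _)); rewrite normrN.
  exact: (ltW (truncnS_gt _)).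
- by move=> _ [x ->]; exact: PQ.
- move=> n; apply: (le_lt_trans (@probability_le1 _ _ _ P _ _)); last exact: ltry.
  exact: measurable_itv.
Qed.

(** The factor [c * expR ((1 - c) * x)] is the likelihood ratio of rate [c] to rate 1; its product
    over edges is [scale_density] below. *)
Lemma expR_pdfE c x : 0 < c -> exponential_pdf 1 x * (c * expR ((1 - c) * x)) =
  exponential_pdf c x.
Proof.
move=> c0; have [x0|x0] := leP 0 x; last by rewrite !lt0_exponential_pdf ?mul0r.
rewrite !exponential_pdfE// mul1r mulrCA -expRD.
by congr (_ * expR _); ring.
Qed.

Lemma measurable_maxr0 : @measurable_fun _ _ (measurableTypeR R) (measurableTypeR R) setT
  (fun s => Num.max s 0).
Proof. exact: measurable_maxr. Qed.

Lemma integral_exp1 (f : R -> \bar R) :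
  measurable_fun setT f -> (forall x, 0 <= f x)%E ->
  (\int[exp1]_s f s = \int[mu]_s (f s * (exponential_pdf 1 s)%:E))%E.
Proof.
move=> mf f0.
apply: (@ge0_integral_density _ (measurableTypeR R) R mu exp1) => //.
- exact: measurable_exponential_pdf.
- by move=> x; exact: exponential_pdf_ge0.
Qed.

(** Justifies replacing weights by their positive parts throughout, which makes them nonnegative at
    every point and not only almost surely. *)
Lemma integral_exp1_max0 (f : R -> \bar R) :
  measurable_fun setT f -> (forall x, 0 <= f x)%E ->
  (\int[exp1]_s f s = \int[exp1]_s f (Num.max s 0%R))%E.
Proof.
move=> mf f0.
rewrite !integral_exp1//; last exact: (measurableT_comp mf measurable_maxr0).
apply: eq_integral => x _; have [//|x0] := leP 0 x.
by rewrite lt0_exponential_pdf// !mule0.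
Qed.

Lemma exp1_max0 (A : set R) : measurable A ->
  exp1 [set s | A (Num.max s 0)] = exp1 A.
Proof.
move=> mA.
have mA' : measurable [set s : measurableTypeR R | A (Num.max s 0)].
  by rewrite -[X in measurable X]setTI; exact: measurable_maxr0.
have I (B : set R) : measurable B -> (\int[exp1]_s (\1_B s)%:E = exp1 B)%E.
  by move=> mB; rewrite integral_indic// setIT.
rewrite -(I A)// -I//.
have mI : measurable_fun setT (EFin \o (\1_A : R -> R)).
  by apply/measurable_EFinP; exact: measurable_indic.
by rewrite (integral_exp1_max0 mI)// => x; rewrite /= lee_fin.
Qed.

(** If [s] has rate [c] then [c * s] has rate 1; rewriting the rate [c] law by its density with
    respect to [exp1] gives the extra factor. *)
Lemma integral_exp1_scale c (f : R -> \bar R) : 0 < c ->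
  measurable_fun setT f -> (forall x, 0 <= f x)%E ->
  (\int[exp1]_s f s = \int[exp1]_s (f (c * s)%R * (c * expR ((1 - c) * s))%:E))%E.
Proof.
move=> c0 mf f0.
pose expc : probability (measurableTypeR R) R :=
  exponential_distribution_exponential_prob__canonical__probability_measure_Probability c0.
have mc : @measurable_fun _ _ (measurableTypeR R) (measurableTypeR R) setT (fun s => c * s).
  exact: measurable_funM.
pose Q : probability (measurableTypeR R) R := distribution expc (@mfun_Sub _ _ (measurableTypeR R) (measurableTypeR R) _ (mem_set mc)).
have E : forall A, measurable A -> exp1 A = Q A.
  apply: probability_unique_itvcy => x.
  transitivity (expc `[x / c, +oo[%classic).
    transitivity (exponential_prob (1 : R) `[x, +oo[); first by [].
    transitivity (exponential_prob c `[x / c, +oo[); last by [].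
    rewrite !exponential_prob_itvcy//; congr (expR _)%:E.
    rewrite !mulNr mul1r; congr (- _).
    by rewrite maxr_pMr ?(ltW c0)// mulr0 mulrCA divff ?mulr1// gt_eqF.
  transitivity (expc ((fun s => c * s) @^-1` `[x, +oo[%classic)); last by [].
  congr (expc _); apply/seteqP; split => z; rewrite /= !in_itv/= !andbT.
    by rewrite ler_pdivrMr// mulrC.
  by rewrite ler_pdivrMr// mulrC.
transitivity (\int[Q]_s f s)%E.
  by apply: eq_measure_integral => A mA _; exact: E.
transitivity (\int[expc]_s f (c * s)%R)%E.
  have fin : {in [set: measurableTypeR R], forall y, (0 <= f y)%E} by move=> y _.
  exact: (@ge0_integral_pushforward _ _ (measurableTypeR R) (measurableTypeR R) R _ mc expc setT f measurableT mf fin).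
have mfc : measurable_fun setT (f \o (fun s => c * s)).
  exact: (@measurableT_comp _ _ _ _ _ _ _ _ _ mf mc).
have me : measurable_fun setT (fun x => (c * expR ((1 - c) * x))%:E).
  apply/measurable_EFinP; apply: measurable_funM => //.
  by apply: measurableT_comp => //; exact: measurable_funM.
have e0 x : (0 <= (c * expR ((1 - c) * x))%:E)%E.
  by rewrite lee_fin mulr_ge0 ?expR_ge0// ltW.
rewrite integral_exp1//; last 2 first.
- exact: emeasurable_funM.
- by move=> x; rewrite mule_ge0.
transitivity (\int[mu]_s (f (c * s)%R * (exponential_pdf c s)%:E))%E; last first.
  by apply: eq_integral => x _; rewrite -muleA -EFinM [(_ * exponential_pdf 1 x)%R]mulrC expR_pdfE.
have p0 x : 0 <= exponential_pdf c x by apply: exponential_pdf_ge0; exact: ltW.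
exact: (@ge0_integral_density _ (measurableTypeR R) R mu expc (exponential_pdf c)
  (measurable_exponential_pdf c) p0 (fun A _ => erefl) _ mfc (fun x => f0 _)).
Qed.

Lemma exponential_prob_itvco c a : 0 < c -> 0 <= a ->
  exponential_prob c `[0%R, a[ = (1 - expR (- c * a))%:E.
Proof.
move=> c0 a0.
pose expc : probability (measurableTypeR R) R :=
  exponential_distribution_exponential_prob__canonical__probability_measure_Probability c0.
have E : (expc `[0%R, a[%classic + expc `[a, +oo[%classic = expc `[0%R, +oo[%classic)%E.
  rewrite -measureU//; last first.
    apply/seteqP; split=> // x [] /=; rewrite !in_itv/= => /andP[_ h1] /andP[h2 _].
    by move: (le_lt_trans h2 h1); rewrite ltxx.
  congr (expc _); apply/seteqP; split => x /=; rewrite !in_itv/= ?andbT.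
    by move=> [/andP[]//|/(le_trans a0)].
  by move=> x0; have [xa|xa] := ltP x a; [left|right]; rewrite ?x0.
have E1 : expc `[a, +oo[%classic = (expR (- c * a))%:E.
  by have := exponential_prob_itvcy a c0; rewrite (max_idPl a0).
have E0 : expc `[0%R, +oo[%classic = 1%:E.
  by have := exponential_prob_itvcy 0 c0; rewrite maxxx mulr0 expR0.
move: E; rewrite E1 E0 EFinB => <-.
by rewrite addeK.
Qed.

Lemma exp1_itvoy x : 0 <= x -> exp1 `]x, +oo[%classic = (expR (- x))%:E.
Proof.
move=> x0; have := exponential_prob_itvcy x (@ltr01 R).
rewrite (max_idPl x0) mulN1r => <-.
apply: (integral_itv_obnd_cbnd (f := fun x => (exponential_pdf 1 x)%:E)).
by apply/measurable_EFinP; apply: measurable_funTS; exact: measurable_exponential_pdf.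
Qed.

(** The tail of the truncated variable is [expR (- r)] for [r < M] and 0 beyond, that is, the rate 1
    density on [[0, M[], so the layer-cake integral is itself an exponential probability. *)
Lemma exp1_mean_min M : 0 <= M ->
  (\int[exp1]_s (Num.min (Num.max s 0) M)%:E = (1 - expR (- M))%:E)%E.
Proof.
move=> M0.
have mX : @measurable_fun _ _ (measurableTypeR R) R setT
   (fun s : R => Num.min (Num.max s 0) M).
  by apply: measurable_minr => //; exact: measurable_maxr.
pose X : {RV exp1 >-> R} := @mfun_Sub _ _ (measurableTypeR R) R _ (mem_set mX).
transitivity ('E_exp1[X])%E; first by rewrite expectation_def.
rewrite ge0_expectation_ccdf; last first.
  by move=> s; rewrite /X /= le_min M0 le_max lexx orbT.
transitivity (\int[mu]_(r in `[0%R, +oo[) ((fun r => (exponential_pdf 1 r)%:E) \_ `[0%R, M[) r)%E.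
  apply: eq_integral => r; rewrite inE/= in_itv/= andbT => r0.
  rewrite patchE mem_setE in_itv/= r0/=; case: ltP => rM.
    rewrite exponential_pdfE// mul1r mulN1r -exp1_itvoy//; congr (exp1 _).
    apply/seteqP; split => s; rewrite /= !in_itv/= !andbT lt_min rM andbT lt_max.
      by rewrite (ltNge r 0) r0 orbF.
    by move=> ->.
  rewrite -[RHS](measure0 exp1); congr (exp1 _).
  apply/seteqP; split => // s; rewrite /= !in_itv/= !andbT lt_min.
  by rewrite (ltNge r M) rM andbF.
rewrite -integral_mkcondr setIidr; last first.
  by move=> x /=; rewrite !in_itv/= => /andP[->].
by have := exponential_prob_itvco (@ltr01 R) M0; rewrite mulN1r.
Qed.

(** With [b = 1 / (1 - lam)] one has [lam * b + 1 = b]: below [a = M / b] the integrand times the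
    density is [1 / b] times the rate [b] density, and above [a] it is a constant times the rate 1
    density. Both integrals are explicit. *)
Lemma exp1_laplace_min lam M : 0 < lam < 1 -> 0 <= M ->
  (\int[exp1]_s (expR (- lam * Num.min ((1 - lam)^-1 * Num.max s 0%R) M))%:E =
   (1 - lam * (1 - expR (- M)))%:E)%E.
Proof.
move=> /andP[lam0 lam1] M0.
have l1 : 0 < 1 - lam by rewrite subr_gt0.
pose b := (1 - lam)^-1; have b0 : 0 < b by rewrite invr_gt0.
have bE : lam * b + 1 = b by rewrite /b; field; rewrite gt_eqF.
pose a := M * (1 - lam); have a0 : 0 <= a by rewrite mulr_ge0// ltW.
have ba : b * a = M by rewrite /a mulrCA mulVf ?mulr1// gt_eqF.
have mf : measurable_fun setT
    (fun s : R => (expR (- lam * Num.min ((1 - lam)^-1 * Num.max s 0%R) M))%:E).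
  apply/measurable_EFinP; apply: measurableT_comp => //.
  apply: measurable_funM => //; apply: measurable_minr => //.
  by apply: measurable_funM => //; exact: measurable_maxr.
rewrite integral_exp1//.
pose f1 (x : R) := ((b^-1)%:E * ((fun x => (exponential_pdf b x)%:E) \_ `[0%R, a[) x)%E.
pose f2 (x : R) := ((expR (- lam * M))%:E *
  ((fun x => (exponential_pdf 1 x)%:E) \_ `[a, +oo[) x)%E.
have mpdf (c : R) : measurable_fun setT (fun x => (exponential_pdf c x)%:E).
  by apply/measurable_EFinP; exact: measurable_exponential_pdf.
have pdf0 (c : R) (D : set R) x : 0 < c -> (0 <= ((fun x => (exponential_pdf c x)%:E) \_ D) x)%E.
  move=> c0; rewrite patchE; case: ifP => // _.
  by rewrite lee_fin; apply: exponential_pdf_ge0; exact: ltW.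
have mpatch (c : R) (D : set R) : measurable D ->
    measurable_fun setT ((fun x => (exponential_pdf c x)%:E) \_ D).
  by move=> mD; apply/(measurable_restrictT _ mD); exact: measurable_funTS.
transitivity (\int[mu]_x (f1 x + f2 x))%E.
  apply: eq_integral => x _; rewrite /f1 /f2 !patchE !mem_setE /= !in_itv/= andbT.
  have [x0|x0] /= := leP 0 x; last first.
    rewrite lt0_exponential_pdf// !mule0 (leNgt a) (lt_le_trans x0 a0)/=.
    by rewrite mule0 adde0.
  rewrite -/b ltNge; case: leP => /= ax.
    rewrite mule0 add0e (min_idPr _) ?EFinM//.
    by rewrite -ba ler_pM2l.
  rewrite mule0 adde0 (min_idPl _); last by rewrite -ba ler_pM2l// ltW.
  rewrite -!EFinM !exponential_pdfE//; congr EFin.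
  rewrite mul1r -expRD [RHS]mulrA mulVf ?gt_eqF// mul1r; congr expR.
  by rewrite -[in RHS]bE; ring.
have bV0 : (0 <= (b^-1)%:E)%E by rewrite lee_fin invr_ge0 (ltW b0).
have eM0 : (0 <= (expR (- lam * M))%:E)%E by rewrite lee_fin expR_ge0.
rewrite ge0_integralD//.
- rewrite /f1 /f2 !ge0_integralZl//.
  + rewrite -!integral_mkcond.
    transitivity ((b^-1)%:E * (1 - expR (- b * a))%:E
       + (expR (- lam * M))%:E * (expR (- 1 * a))%:E)%E.
      congr (_ * _ + _ * _)%E; first exact: exponential_prob_itvco.
      by have := exponential_prob_itvcy a (@ltr01 R); rewrite (max_idPl a0).
    rewrite -!EFinM -EFinD; congr EFin; rewrite -expRD.
    rewrite (_ : - lam * M + -1 * a = - M) ?mulNr ?ba; last first.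
      by rewrite /a; ring.
    by rewrite /b invrK; ring.
all: try exact: mpatch.
all: try by move=> x _; exact: pdf0.
all: try by [].
all: try by apply: measurable_funeM; exact: mpatch.
all: by move=> x _; apply: mule_ge0; [|exact: pdf0].
Qed.

(* The two exact values agree to first order: with [b = 1 / (1 - lam)], the left
   side is [1 - lam * m] where [m] is the mean of [min(s, M)]. *)
Lemma exp1_laplace_le lam A B : 0 < lam < 1 ->
  (\int[exp1]_s (expR (- lam * Num.min (A + (1 - lam)^-1 * Num.max s 0%R) B))%:E <=
   (expR (- lam * \int[exp1]_s Num.min (A + Num.max s 0%R) B))%:E)%E.
Proof.
move=> lam01; have [/andP[lam0 lam1]] := (lam01, lam01).
have l1 : 0 < 1 - lam by rewrite subr_gt0.
have p1 : exp1 setT = 1%E := probability_setT exp1.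
(* If [B <= A] the minimum is constantly [B], and both sides equal [expR (- lam * B)]. *)
have [BA|AB] := leP B A.
  have E (s x : R) : 0 <= x -> Num.min (A + x * Num.max s 0) B = B.
    move=> x0; apply/min_idPr; rewrite (le_trans BA)// lerDl mulr_ge0//.
    by rewrite le_max lexx orbT.
  under eq_integral => s _ do rewrite E ?invr_ge0 ?(ltW l1)//.
  rewrite (_ : (\int[exp1]_s _)%R = B); last first.
    under eq_Rintegral => s _ do rewrite -[Num.max _ _]mul1r E//.
    by rewrite Rintegral_cst// [X in fine X]p1 mulr1.
  by rewrite integral_cst// [X in (_ * X)%E]p1 mule1.
pose M := B - A; have M0 : 0 <= M by rewrite subr_ge0 ltW.
have E (y : R) : Num.min (A + y) B = A + Num.min y M.
  by rewrite addr_minr /M addrCA subrr addr0.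
rewrite (_ : (\int[exp1]_s _)%R = A + (1 - expR (- M))); last first.
  rewrite /Rintegral.
  transitivity (fine (\int[exp1]_s (A%:E + (Num.min (Num.max s 0%R) M)%:E)%E)%E).
    by congr fine; apply: eq_integral => s _; rewrite E EFinD.
  rewrite integralD//=.
  - by rewrite integral_cst// [X in (_ * X)%E]p1 mule1 exp1_mean_min.
  - by apply: finite_measure_integrable_cst.
  - apply/integrableP; split.
      by apply/measurable_EFinP; apply: measurable_minr => //; exact: measurable_maxr.
    under eq_integral => s _.
      rewrite gee0_abs ?lee_fin ?le_min ?le_max ?lexx ?orbT//; over.
    by rewrite exp1_mean_min// ltry.
under eq_integral => s _.
  rewrite E mulrDr expRD EFinM; over.
rewrite ge0_integralZl//=; last first.
- apply/measurable_EFinP; apply: measurableT_comp => //.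
  apply: measurable_funM => //; apply: measurable_minr => //.
  by apply: measurable_funM => //; exact: measurable_maxr.
rewrite exp1_laplace_min// [in leRHS]mulrDr expRD -EFinM lee_fin ler_pM2l ?expR_gt0//.
by have := expR_ge1Dx (- lam * (1 - expR (- M))); rewrite !mulNr.
Qed.

End exponential.

(** * The space of weight configurations *)

Section weight_space.
Variables (R : realType) (I : choiceType).

(** Cylinders over finite index sets are stable under intersection, so a law on the sigma-algebra
    they generate is determined by its finite joint distributions. *)
Definition cylinders : set (set (I -> R)) :=
  [set C | exists (J : {fset I}) (A : I -> set R), (forall i, measurable (A i)) /\
     C = [set w | forall i, i \in J -> A i (w i)]].

Definition weights : Type := g_sigma_algebraType cylinders.
HB.instance Definition _ := Measurable.copy weights (g_sigma_algebraType cylinders).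

Lemma cylinders_setI_closed : setI_closed cylinders.
Proof.
move=> _ _ [J [A [mA ->]]] [K [B [mB ->]]].
exists (J `|` K)%fset, (fun i => (if i \in J then A i else setT) `&`
                         (if i \in K then B i else setT)); split.
  by move=> i; apply: measurableI; case: ifP.
apply/seteqP; split => w /=.
  by move=> [hJ hK] i; rewrite inE => iJK; split; case: ifP => // h; [exact: hJ|exact: hK].
move=> h; split=> i iJ; have := h i; rewrite inE iJ ?orbT => /(_ isT) [].
  by [].
by [].
Qed.

Lemma measurable_coord (i : I) : measurable_fun [set: weights] (fun w : weights => w i : R).
Proof.
move=> _ B mB; rewrite setTI; apply: sub_sigma_algebra.
exists [fset i]%fset, (fun=> B); split => //.
by apply/seteqP; split => w /= => [h j|]; [rewrite inE => /eqP ->|apply; rewrite inE].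
Qed.

Lemma measurable_weights d (T : measurableType d) (Y : T -> weights) :
  (forall i, measurable_fun setT (fun o => Y o i)) -> measurable_fun setT Y.
Proof.
move=> mY; have := @measurability _ _ T weights setT Y cylinders erefl.
apply.
move=> _ [_ [J [A [mA ->]] <-]]; rewrite setTI.
rewrite (_ : _ @^-1` _ = \bigcap_(i in [set` J]) ((fun o => Y o i) @^-1` A i)); last first.
  by apply/seteqP; split => o /=; apply.
apply: fin_bigcap_measurable; first exact: finite_fset.
by move=> i _; rewrite -[X in measurable X]setTI; exact: mY.
Qed.

End weight_space.

(** * Families that are i.i.d. on a set of indices *)

Section iid.
Variables (R : realType) (I : choiceType).

(** Independence and the exponential law are merged into one product formula. Off [F] coordinates
    may be dependent or repeat, as the periodic weights do. *)
Definition iid d (Omega : measurableType d) (P : probability Omega R)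
    (F : set I) (Y : Omega -> weights R I) : Prop :=
  [/\ measurable_fun setT Y, forall o i, 0 <= Y o i &
   forall (J : {fset I}) (A : I -> set R), [set` J] `<=` F ->
     (forall i, measurable (A i)) ->
     P [set o | forall i, i \in J -> A i (Y o i)] = (\prod_(i <- J) @exp1 R (A i))%E].

Definition depends_on T (F : set I) (f : weights R I -> T) :=
  forall w w' : weights R I, (forall i, F i -> w i = w' i) -> f w = f w'.

Lemma measurable_restrict_weights (F : set I) :
  measurable_fun [set: weights R I]
    (fun w : weights R I => (fun i => if i \in F then w i else 0) : weights R I).
Proof.
apply: measurable_weights => i /=; case: (i \in F) => //; exact: measurable_coord.
Qed.

Lemma prod_fset_all (J : {fset I}) (G : set I) (A : I -> set R) :
  (forall i, i \in J -> i \notin G -> A i 0) -> forall w : weights R I,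
  (forall i, i \in J -> A i (if i \in G then w i else 0)) <->
  (forall i, i \in [fset i in J | i \in G]%fset -> A i (w i)).
Proof.
move=> h w; split=> H i.
  by rewrite !inE /= => /andP[iJ iG]; have := H i iJ; rewrite iG.
move=> iJ; case: ifPn => iG; last exact: h.
by apply: H; rewrite !inE /= iJ.
Qed.

(** Setting the coordinates off [F] to 0 does not change [f] and gives two laws that agree on
    cylinders, hence are equal. *)
Lemma iid_transfer d d' (O1 : measurableType d) (O2 : measurableType d')
  (P1 : probability O1 R) (P2 : probability O2 R) (F : set I)
  (Y1 : O1 -> weights R I) (Y2 : O2 -> weights R I) (f : weights R I -> \bar R) :
  iid P1 F Y1 -> iid P2 F Y2 -> measurable_fun setT f -> (forall w, 0 <= f w)%E ->
  depends_on F f ->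
  (\int[P1]_o f (Y1 o) = \int[P2]_o f (Y2 o))%E.
Proof.
move=> [m1 _ i1] [m2 _ i2] mf f0 fF.
pose r (w : weights R I) : weights R I := fun i => if i \in F then w i else 0.
have mr : measurable_fun setT r by exact: measurable_restrict_weights.
have fr w : f (r w) = f w by apply: fF => i Fi; rewrite /r mem_set.
have mrY d0 (O : measurableType d0) (Y : O -> weights R I) :
    measurable_fun setT Y -> measurable_fun setT (r \o Y) by move=> mY; exact: measurableT_comp.
have M1 := mrY _ _ _ m1; have M2 := mrY _ _ _ m2.
pose Q1 : probability (weights R I) R := distribution P1 (mfun_Sub (mem_set M1)).
pose Q2 : probability (weights R I) R := distribution P2 (mfun_Sub (mem_set M2)).
have E : forall A, measurable A -> Q1 A = Q2 A.
  move=> A mA; apply: (@measure_unique _ _ (weights R I) (@cylinders R I) (fun=> setT) _ _ _ _ Q1 Q2) => //.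
  - exact: cylinders_setI_closed.
  - move=> _; exists fset0, (fun=> setT); split => //.
    by apply/seteqP; split.
  - by apply/seteqP; split=> // w _; exists 0.
  - move=> _ [J [B [mB ->]]].
    transitivity (P1 [set o | forall i, i \in J -> B i (r (Y1 o) i)]); first by [].
    transitivity (P2 [set o | forall i, i \in J -> B i (r (Y2 o) i)]); last by [].
    have [h|h] := pselect (forall i, i \in J -> i \notin F -> B i 0).
      pose K := [fset i in J | i \in F]%fset.
      have KF : [set` K] `<=` F by move=> i; rewrite /= !inE /= => /andP[_]; rewrite inE.
      transitivity (P1 [set o | forall i, i \in K -> B i (Y1 o i)]).
        by congr (P1 _); apply/seteqP; split => o /= /(prod_fset_all h).
      rewrite i1// -i2//.
      by congr (P2 _); apply/seteqP; split => o /= /(prod_fset_all h).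
    transitivity (0 : \bar R)%E.
      rewrite -[RHS](measure0 P1); congr (P1 _).
      apply/seteqP; split => // o /= H; apply: h => i iJ iF; have := H i iJ.
      by rewrite /r (negPf iF).
    rewrite -[LHS](measure0 P2); congr (P2 _).
    apply/seteqP; split => // o /= H; exfalso; apply: h => i iJ iF; have := H i iJ.
    by rewrite /r (negPf iF).
  - by move=> _; apply: (le_lt_trans (@probability_le1 _ _ _ Q1 setT measurableT)); rewrite ltry.
transitivity (\int[Q1]_w f w)%E.
  rewrite ge0_integral_pushforward//=.
  by apply: eq_integral => o _; rewrite /= fr.
transitivity (\int[Q2]_w f w)%E.
  by apply: eq_measure_integral => A mA _; exact: E.
rewrite ge0_integral_pushforward//=.
by apply: eq_integral => o _; rewrite /= fr.
Qed.

End iid.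

(** * Reindexing and resampling *)

Section iid_constructions.
Variables (R : realType).

Definition upd (I : choiceType) (w : weights R I) (e : I) (s : R) : weights R I :=
  fun i => if i == e then s else w i.

Lemma iid_base (I : choiceType) d (O : measurableType d) (P : probability O R)
    (D : set I) (X : I -> {RV P >-> R}) :
  iid_exp1 D X -> iid P D (fun o i => Num.max (X i o) 0).
Proof.
move=> [ind law]; split.
- apply: measurable_weights => i.
  by apply: measurable_maxr => //; exact: measurable_funPT.
- by move=> o i; rewrite le_max lexx orbT.
- move=> J A JD mA.
  pose A' i : set R := [set s | A i (Num.max s 0)].
  have mA' i : measurable (A' i).
    rewrite -[X in measurable X]setTI; apply: (measurable_maxr _ _ measurableT) => //.
  transitivity (P (\bigcap_(i in [set` J]) X i @^-1` A' i)).
    by congr (P _); apply/seteqP; split.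
  rewrite ind//; apply: eq_big_seq => i iJ.
  transitivity (distribution P (X i) (A' i)); first by [].
  rewrite law//; last exact: JD.
  exact: exp1_max0.
Qed.

(** Serves twice: for lattice isometries acting on edges, and for the map from the edges of a window
    to their representatives on the torus. *)
Lemma iid_comp (I I' : choiceType) d (O : measurableType d) (P : probability O R)
    (F : set I) (F' : set I') (Y : O -> weights R I) (sg : I' -> I) :
  iid P F Y -> (forall i, F' i -> F (sg i)) ->
  (forall i j, F' i -> F' j -> sg i = sg j -> i = j) ->
  iid P F' (fun o i => Y o (sg i) : R).
Proof.
move=> [mY Y0 ind] sF inj; split.
- apply: measurable_weights => i.
  exact: (measurableT_comp (measurable_coord (sg i)) mY).
- by move=> o i; exact: Y0.
- move=> J A JF mA.
  have injJ : {in J &, injective sg} by move=> i j iJ jJ; exact: inj (JF _ iJ) (JF _ jJ).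
  (* Conditions are carried to the image index; by injectivity the intersection at [sg i] has the
     single member [A i]. *)
  pose inv (j : I) : set R :=
    \bigcap_(i in [set i | i \in J /\ sg i = j]) A i.
  have invE i : i \in J -> inv (sg i) = A i.
    move=> iJ; apply/seteqP; split => s; first by apply.
    by move=> As k [kJ] /(injJ _ _ kJ iJ) ->.
  have minv j : measurable (inv j).
    apply: fin_bigcap_measurable => //.
    by apply: (sub_finite_set _ (finite_fset J)) => i [].
  have SF : [set` [fset sg i | i in J]%fset] `<=` F.
    by move=> j /= /imfsetP[i /= iJ ->]; apply: sF; exact: JF.
  transitivity (P [set o | forall j, j \in [fset sg i | i in J]%fset -> inv j (Y o j)]).
    congr (P _); apply/seteqP; split => o /= H.
      by move=> j /imfsetP[i /= iJ ->]; rewrite invE//; exact: H.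
    by move=> i iJ; rewrite -(invE _ iJ); apply: H; apply/imfsetP; exists i.
  rewrite ind// big_imfset//=; apply: eq_big_seq => i iJ.
  by rewrite invE.
Qed.

Lemma iid_sub (I : choiceType) d (O : measurableType d) (P : probability O R)
    (F F' : set I) (Y : O -> weights R I) :
  iid P F Y -> F' `<=` F -> iid P F' Y.
Proof.
move=> iY FF; exact: (iid_comp (sg := id) iY).
Qed.

Variables (I : choiceType) (d : measure_display) (O : measurableType d)
  (P : probability O R) (F : set I) (Y : O -> weights R I).
Hypothesis iY : iid P F Y.
Notation S := (measurableTypeR R).

Let mY : measurable_fun setT Y. Proof. by case: iY. Qed.

Lemma measurable_upd e : measurable_fun setT
  (fun so : S * O => upd (Y so.2) e (Num.max so.1 0)).
Proof.
apply: measurable_weights => i; rewrite /upd /=.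
case: (i == e).
  by apply: measurable_maxr => //; exact: measurable_fst.
have mYs : measurable_fun setT (fun so : S * O => Y so.2).
  exact: (measurableT_comp mY measurable_snd).
exact: (measurableT_comp (measurable_coord i) mYs).
Qed.

Lemma measurable_upd_coord (w : weights R I) e : measurable_fun setT
  (fun s : S => upd w e (Num.max s 0)).
Proof.
apply: measurable_weights => i; rewrite /upd /=; case: (i == e) => //.
exact: measurable_maxr.
Qed.

Lemma iid_upd e : F e ->
  iid (exp1 R \x P)%E F (fun so : S * O => upd (Y so.2) e (Num.max so.1 0)).
Proof.
have [_ Y0 ind] := iY => Fe; split.
- exact: measurable_upd.
- by move=> so i; rewrite /upd; case: ifP => // _; rewrite le_max lexx orbT.
- move=> J A JF mA.
  pose K := (J `\ e)%fset.
  have KF : [set` K] `<=` F by move=> i; rewrite /= !inE => /andP[_]; exact: JF.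
  pose B : set S := if e \in J then [set s | A e (Num.max s 0)] else setT.
  pose C : set O := [set o | forall i, i \in K -> A i (Y o i)].
  have mB : measurable B.
    rewrite /B; case: ifP => // _.
    by rewrite -[X in measurable X]setTI; exact: (@measurable_maxr0 R measurableT _ (mA e)).
  have mC : measurable C.
    rewrite (_ : C = \bigcap_(i in [set` K]) ((fun o => Y o i) @^-1` A i)).
      apply: fin_bigcap_measurable; first exact: finite_fset.
      move=> i _; rewrite -[X in measurable X]setTI.
      exact: (measurableT_comp (measurable_coord i) mY).
    by apply/seteqP; split => o /=; apply.
  transitivity ((exp1 R \x P)%E (B `*` C)).
    congr ((exp1 R \x P)%E _); apply/seteqP; split => -[s o] /= H.
      split.
        rewrite /B; case: ifP => // eJ; have := H e eJ.
        by rewrite /= /upd eqxx.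
      move=> i; rewrite !inE => /andP[ie iJ]; have := H i iJ.
      by rewrite /upd (negPf ie).
    move=> i iJ; rewrite /upd; case: eqP => [ie|/eqP ie].
      by case: H => + _; rewrite /B -ie iJ.
    by case: H => _; apply; rewrite !inE ie.
  transitivity (exp1 R B * P C)%E; first exact: product_measure1E.
  have -> : P C = _ := ind K A KF mA.
  rewrite /B; case: ifPn => eJ.
    rewrite [RHS](big_fsetD1 e eJ)/=; congr (_ * _)%E; exact: (exp1_max0 (mA e)).
  rewrite probability_setT mul1e; congr (\big[_/_]_(i <- enum_fset _) _).
  by apply/fsetP => i; rewrite !inE; case: eqP => // ->; rewrite (negPf eJ).
Qed.

(** Replacing one coordinate by a fresh independent copy keeps the family i.i.d., and Fubini
    isolates that coordinate. One-variable facts about [exp1] are lifted to functions of all weights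
    in this way. *)
Lemma iid_resample e (f : weights R I -> \bar R) : F e ->
  measurable_fun setT f -> (forall w, 0 <= f w)%E -> depends_on F f ->
  (\int[P]_o f (Y o) = \int[P]_o \int[exp1 R]_s f (upd (Y o) e (Num.max s 0%R)))%E.
Proof.
move=> Fe mf f0 fF.
rewrite (iid_transfer iY (iid_upd Fe) mf f0 fF).
have mg : measurable_fun setT (fun so : S * O => f (upd (Y so.2) e (Num.max so.1 0%R))).
  by apply: (measurableT_comp mf); exact: measurable_upd.
have g0 (so : S * O) : (0 <= f (upd (Y so.2) e (Num.max so.1 0%R)))%E by [].
transitivity (\int[exp1 R]_s \int[P]_o f (upd (Y o) e (Num.max s 0%R)))%E.
  exact: (fubini_tonelli1 _ mg g0).
exact: (fubini_tonelli _ mg g0).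
Qed.

End iid_constructions.

(** * Change of measure by scaling finitely many weights *)

Section scaling.
Variables (R : realType) (I : choiceType) (d : measure_display) (O : measurableType d)
  (P : probability O R) (F : set I) (Y : O -> weights R I).
Hypothesis iY : iid P F Y.

Definition scale (l : seq I) (c : R) (w : weights R I) : weights R I :=
  fun i => if i \in l then c * w i else w i.

Definition scale_density (l : seq I) (c : R) (w : weights R I) : R :=
  \prod_(e <- l) (c * expR ((1 - c) * w e)).

Lemma measurable_scale l c : measurable_fun setT (scale l c).
Proof.
apply: measurable_weights => i; rewrite /scale; case: (i \in l).
  by apply: measurable_funM => //; exact: measurable_coord.
exact: measurable_coord.
Qed.

Lemma measurable_scale_density l c : measurable_fun setT (scale_density l c).
Proof.
apply: measurable_prod => e _; apply: measurable_funM => //.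
apply: measurableT_comp => //; apply: measurable_funM => //.
exact: measurable_coord.
Qed.

Lemma scale_density_ge0 l c w : 0 <= c -> 0 <= scale_density l c w.
Proof. by move=> c0; apply: prodr_ge0 => e _; rewrite mulr_ge0 ?expR_ge0. Qed.

Lemma scale_cons e l c w : e \notin l -> scale (e :: l) c w = scale l c (scale [:: e] c w).
Proof.
move=> el; apply/funext => i; rewrite /scale !inE.
by case: eqP => [->|_] /=; rewrite ?(negPf el).
Qed.

(** Induction on [l]: the head coordinate is resampled and [integral_exp1_scale] is applied to it,
    the others being fixed. *)
Lemma integral_scale l c (f : weights R I -> \bar R) : 0 < c -> uniq l ->
  {subset l <= F} ->
  measurable_fun setT f -> (forall w, 0 <= f w)%E -> depends_on F f ->
  (\int[P]_o f (Y o) = \int[P]_o (f (scale l c (Y o)) * (scale_density l c (Y o))%:E))%E.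
Proof.
move=> c0 + + mf f0 fF; elim: l => [_ _|e l IH /= /andP[el ul] lF].
  apply: eq_integral => o _; rewrite /scale_density big_nil mule1.
  by congr f; apply/funext.
have Fe : F e by have := lF e (mem_head _ _); rewrite inE.
rewrite IH//; last by move=> i il; apply: lF; rewrite inE il orbT.
pose h (w : weights R I) : \bar R := (f (scale l c w) * (scale_density l c w)%:E)%E.
have mh : measurable_fun setT h.
  apply: emeasurable_funM; first exact: (measurableT_comp mf (measurable_scale l c)).
  by apply/measurable_EFinP; exact: measurable_scale_density.
have h0 w : (0 <= h w)%E.
  by rewrite mule_ge0// lee_fin scale_density_ge0// ltW.
have hF : depends_on F h.
  move=> w w' ww'; rewrite /h; congr (_ * _%:E)%E.
    by apply: fF => i Fi; rewrite /scale ww'.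
  apply: eq_big_seq => i il; rewrite ww'//.
  by have := lF i; rewrite !inE il orbT => /(_ isT).
pose h' (w : weights R I) : \bar R :=
  (h (scale [:: e] c w) * (c * expR ((1 - c) * w e))%:E)%E.
have mh' : measurable_fun setT h'.
  apply: emeasurable_funM; first exact: (measurableT_comp mh (measurable_scale _ c)).
  apply/measurable_EFinP; apply: measurable_funM => //.
  by apply: measurableT_comp => //; apply: measurable_funM => //; exact: measurable_coord.
have h'0 w : (0 <= h' w)%E by rewrite mule_ge0// lee_fin mulr_ge0 ?expR_ge0// ltW.
have h'F : depends_on F h'.
  move=> w w' ww'; rewrite /h' ww'//; congr (_ * _)%E.
  by apply: hF => i Fi; rewrite /scale ww'.
transitivity (\int[P]_o h (Y o))%E; first by [].
rewrite (iid_resample iY Fe mh h0 hF).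
transitivity (\int[P]_o h' (Y o))%E; last first.
  apply: eq_integral => o _; rewrite /h' /h -scale_cons//.
  rewrite -muleA -EFinM; congr (_ * _%:E)%E.
  rewrite [RHS]big_cons mulrC; congr (_ * _); apply: eq_big_seq => i il.
  rewrite /scale inE; case: eqP => // ie.
  by move: el; rewrite -ie il.
rewrite (iid_resample iY Fe mh' h'0 h'F).
apply: eq_integral => o _.
have mu := measurable_upd_coord (Y o) e.
rewrite (integral_exp1_scale c0); last 2 first.
  exact: (measurableT_comp mh mu).
  by move=> x; exact: h0.
rewrite integral_exp1_max0; last 2 first.
  apply: emeasurable_funM.
    have mc : @measurable_fun _ _ (measurableTypeR R) (measurableTypeR R) setT (fun s => c * s).
      exact: measurable_funM.
    exact: (measurableT_comp (measurableT_comp mh mu) mc).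
  apply/measurable_EFinP; apply: measurable_funM => //.
  by apply: measurableT_comp => //; exact: measurable_funM.
  by move=> x; rewrite mule_ge0// lee_fin mulr_ge0 ?expR_ge0// ltW.
apply: eq_integral => s _; rewrite /h' /upd eqxx; congr (h _ * _)%E.
apply/funext => i; rewrite /scale inE; case: eqP => // _.
by apply/max_idPl; rewrite mulr_ge0 ?(ltW c0)// le_max lexx orbT.
Qed.

Lemma integral_scale_density l c : 0 < c -> uniq l -> {subset l <= F} ->
  (\int[P]_o (scale_density l c (Y o))%:E = 1)%E.
Proof.
move=> c0 ul lF.
have := @integral_scale l c (fun=> 1%E) c0 ul lF (measurable_cst _) (fun=> lee01) (fun _ _ _ => erefl).
rewrite integral_cst// mul1e => H.
transitivity (P setT); last exact: probability_setT.
by rewrite H; apply: eq_integral => o _; rewrite mul1e.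
Qed.

(* AM-GM applied to [x * G] and [1 / (x * G)] for the density [G] of the scaled
   weights replaces the Cauchy-Schwarz inequality. *)
Lemma tilt l (del : R) (A : set O) (B : set (weights R I)) :
  0 < del < 1 -> uniq l -> {subset l <= F} -> 2^-1 <= (1 - del ^+ 2) ^+ size l ->
  measurable A -> measurable B -> depends_on F (fun w => w \in B) ->
  (forall o, A o -> B (scale l (1 - del) (Y o))) ->
  fine (P A) ^+ 2 / 2 <= fine (P [set o | B (Y o)]).
Proof.
move=> /andP[d0 d1] ul lF hN mA mB BF AB.
have [mY _ _] := iY.
have c0 : 0 < 1 - del by rewrite subr_gt0.
have c1 : 0 < 1 + del by rewrite addr_gt0.
pose G o := scale_density l (1 - del) (Y o).
pose H o := scale_density l (1 + del) (Y o).
have mG : measurable_fun setT G.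
  exact: (measurableT_comp (measurable_scale_density l _) mY).
have mH : measurable_fun setT H.
  exact: (measurableT_comp (measurable_scale_density l _) mY).
(* [H] stands in for [1 / G]: the exponential factors cancel in the product, while [H] is itself a
   density, of mean 1. *)
have GH o : G o * H o = (1 - del ^+ 2) ^+ size l.
  rewrite /G /H /scale_density -big_split /=.
  rewrite (eq_bigr (fun=> 1 - del ^+ 2)); first by rewrite big_const_seq count_predT iter_mulr_1.
  move=> e _; rewrite mulrACA -expRD.
  rewrite [X in expR X](_ : _ = 0); first by rewrite expR0; ring.
  by ring.
have G0 o : 0 <= G o by apply: scale_density_ge0; exact: ltW.
have H0 o : 0 <= H o by apply: scale_density_ge0; exact: ltW.
have mB' : measurable [set o | B (Y o)].
  by rewrite -[X in measurable X]setTI; exact: mY.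
have m1A : measurable_fun setT (\1_A : O -> R) by exact: measurable_indic.
have mAG : measurable_fun setT (fun o => \1_A o * G o) by exact: measurable_funM.
have AG0 o : 0 <= \1_A o * G o by rewrite mulr_ge0.
(* By the change of variables [P B] is the mean of the indicator of [B] at the scaled weights times
   [G], and on [A] that indicator is 1. *)
have PB : (Ex P (fun o => (\1_A o * G o)%R) <= P [set o | B (Y o)])%E.
  have m1 : measurable_fun setT (fun w : weights R I => (\1_B w : R)%:E).
    by apply/measurable_EFinP; exact: measurable_indic.
  have p1 (w : weights R I) : (0 <= (\1_B w : R)%:E)%E by rewrite lee_fin.
  have f1 : depends_on F (fun w : weights R I => (\1_B w : R)%:E).
    by move=> w w' ww'; rewrite !indicE (BF w w').
  have -> : P [set o | B (Y o)] = Ex P (fun o => \1_B (scale l (1 - del) (Y o)) * G o).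
    rewrite -Ex_indic//; transitivity (\int[P]_o ((\1_B (Y o))%:E))%E; first by [].
    by rewrite (@integral_scale l _ _ c0 ul lF m1 p1 f1).
  apply: le_Ex => //.
  - apply: measurable_funM => //.
    have m1B : measurable_fun setT (\1_B : weights R I -> R) by exact: measurable_indic.
    exact: (measurableT_comp m1B (measurableT_comp (measurable_scale l _) mY)).
  - move=> o; rewrite !indicE; apply: ler_wpM2r => //.
    by have [oA|//] := boolP (o \in A); rewrite (mem_set (AB _ (set_mem oA))).
have [PA0|PA0] := eqVneq (fine (P A)) 0.
  by rewrite PA0 expr0n mul0r fine_ge0.
have PApos : 0 < fine (P A) by rewrite lt_def PA0 fine_ge0.
(* With [p = P A] and [q = P B], the bound [p <= x q / 2 + 1 / x] at [x = 2 / p] reads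
   [p ^ 2 / 2 <= q]. *)
pose x := 2 / fine (P A); have x0 : 0 < x by rewrite divr_gt0.
have xV0 : 0 <= x^-1 by rewrite invr_ge0 ltW.
have x20 : 0 <= x / 2 by rewrite divr_ge0// ltW.
have key : (P A <= (x / 2)%:E * P [set o | B (Y o)] + (x^-1)%:E)%E.
  have H1 : Ex P H = 1%:E by rewrite /Ex integral_scale_density.
  apply: (@le_trans _ _ ((x / 2)%:E * Ex P (fun o => (\1_A o * G o)%R) + (x^-1)%:E * Ex P H))%E; last first.
    by rewrite H1 mule1; apply: leeD2r; apply: lee_wpmul2l.
  rewrite -!ExZl// -ExD//; last 4 first.
  - exact: measurable_funM.
  - exact: measurable_funM.
  - by move=> o; rewrite mulr_ge0.
  - by move=> o; rewrite mulr_ge0.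
  rewrite -Ex_indic//; apply: le_Ex => //.
    by apply: measurable_funD; exact: measurable_funM.
  move=> o; rewrite indicE; have [oA|_] := boolP (o \in A); last first.
    by rewrite mul0r mulr0 add0r mulr_ge0.
  rewrite mul1r.
  have hGH : 2^-1 <= G o * H o by rewrite GH.
  (* [(a / 2 + b) ^ 2 >= 2 a b >= 1], so the two terms together dominate the indicator of [A]. *)
  set a := x * G o; set b := x^-1 * H o.
  have ab : 2^-1 <= a * b by rewrite /a /b mulrACA divff ?mul1r ?gt_eqF.
  have a0 : 0 <= a by rewrite mulr_ge0// ltW.
  have b0 : 0 <= b by rewrite mulr_ge0.
  rewrite (_ : x / 2 * G o = a / 2); last by rewrite /a; field.
  rewrite -(@expr_ge1 _ 2)//; last by rewrite addr_ge0// divr_ge0.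
  have h := sqr_ge0 (a / 2 - b).
  rewrite (_ : (a / 2 + b) ^+ 2 = (a / 2 - b) ^+ 2 + 2 * (a * b)); last by field.
  lra.
rewrite (fineP P mA) (fineP P mB') -EFinM -EFinD lee_fin in key.
move: key; set p := fine (P A); set q := fine (P [set o | B (Y o)]) => key.
have xp : x * p = 2 by rewrite /x -mulrA mulVf// mulr1.
have xV : x^-1 = p / 2 by rewrite /x invfM invrK mulrC.
move: key; rewrite xV /x -/p => key.
have : p * p <= p * (2 / p / 2 * q + p / 2) by rewrite ler_pM2l.
rewrite (_ : p * (2 / p / 2 * q + p / 2) = q + p ^+ 2 / 2); last by field.
rewrite -expr2; lra.
Qed.

End scaling.

(** * Integrating out coordinates one by one *)

Section averaging.
Variables (R : realType) (I : choiceType).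
Notation S := (measurableTypeR R).
Notation W := (weights R I).
Implicit Types (f : W -> R) (e : I) (w : W) (l : seq I).

Lemma measurable_upd_pair e : measurable_fun setT
  (fun sw : S * W => upd sw.2 e (Num.max sw.1 0) : W).
Proof.
apply: measurable_weights => i; rewrite /upd /=; case: (i == e).
  by apply: measurable_maxr => //; exact: measurable_fst.
exact: (measurableT_comp (measurable_coord i) measurable_snd).
Qed.

Definition avg e f w : R := E (exp1 R) (fun s => f (upd w e (Num.max s 0))).

Lemma bounded_section K f e w : bounded_mf K f ->
  bounded_mf K (fun s : S => f (upd w e (Num.max s 0))).
Proof.
move=> [mf fK]; split=> [|s]; last exact: fK.
exact: (measurableT_comp mf (measurable_upd_coord _ _)).
Qed.

Lemma bounded_avg K f e : bounded_mf K f -> bounded_mf K (avg e f).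
Proof.
move=> bf; have [mf fK] := bf; split; last first.
  by move=> w; exact: (E_bound (exp1 R) (bounded_section e w bf)).
have mg : measurable_fun setT (fun sw : S * W => (f (upd sw.2 e (Num.max sw.1 0)))%:E).
  by apply/measurable_EFinP; exact: (measurableT_comp mf (measurable_upd_pair e)).
have g0 (sw : S * W) : (0 <= (f (upd sw.2 e (Num.max sw.1 0)))%:E)%E.
  by rewrite lee_fin; case/andP: (fK (upd sw.2 e (Num.max sw.1 0))).
have mG := @measurable_fun_fubini_tonelli_G _ _ S W R (exp1 R) _ mg g0.
exact: (measurableT_comp (f := @fine R) _ mG).
Qed.

Lemma Ex_avg d (O : measurableType d) (P : probability O R) (F : set I)
    (Y : O -> W) K f e : iid P F Y -> F e -> bounded_mf K f -> depends_on F f ->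
  Ex P (fun o => f (Y o)) = Ex P (fun o => avg e f (Y o)).
Proof.
move=> iY Fe bf fF; have [mf fK] := bf.
have mfE : measurable_fun setT (fun w => (f w)%:E) by exact/measurable_EFinP.
have f0 w : (0 <= (f w)%:E)%E by rewrite lee_fin; case/andP: (fK w).
have fF' : depends_on F (fun w => (f w)%:E) by move=> w w' h; rewrite (fF w w').
rewrite /Ex (iid_resample iY Fe mfE f0 fF').
apply: eq_integral => o _.
exact: (EK (exp1 R) (bounded_section e (Y o) bf)).
Qed.

Fixpoint avgs l f : W -> R := if l is e :: l' then avg e (avgs l' f) else f.

Lemma bounded_avgs K l f : bounded_mf K f -> bounded_mf K (avgs l f).
Proof. by move=> bf; elim: l => //= e l IH; exact: bounded_avg. Qed.

Lemma depends_avgs (G : set I) l f : depends_on G f ->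
  depends_on (G `\` [set` l]) (avgs l f).
Proof.
move=> fG; elim: l => [|e l IH] /= w w' ww'.
  by apply: fG => i Gi; apply: ww'; split.
congr fine; apply: eq_integral => s _; congr EFin; apply: IH => i [Gi il].
rewrite /upd; case: eqP => // /eqP ie; apply: ww'; split=> //=.
by rewrite inE (negPf ie).
Qed.

Lemma Ex_avgs d (O : measurableType d) (P : probability O R) (F : set I)
    (Y : O -> W) K f l : iid P F Y -> {subset l <= F} -> bounded_mf K f ->
  depends_on F f ->
  Ex P (fun o => f (Y o)) = Ex P (fun o => avgs l f (Y o)).
Proof.
move=> iY lF bf fF; elim: l lF => //= e l IH lF.
rewrite IH; last by move=> i il; apply: lF; rewrite inE il orbT.
apply: (Ex_avg (K := K) (F := F)) => //.
- by have := lF e (mem_head _ _); rewrite inE.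
- exact: bounded_avgs.
- move=> w w' h; refine (depends_avgs (l := l) fF _) => i [Fi _]; exact: h.
Qed.

(** Once every coordinate that [f] sees has been averaged out, nothing random is left, and the value
    at any [w] is the expectation. *)
Lemma Ex_avgs_const d (O : measurableType d) (P : probability O R)
    (Y : O -> W) K f l w : iid P [set` l] Y -> bounded_mf K f ->
  depends_on [set` l] f -> Ex P (fun o => f (Y o)) = (avgs l f w)%:E.
Proof.
move=> iY bf fl; rewrite (Ex_avgs (l := l) iY _ bf fl); last by move=> i; rewrite inE.
rewrite -(Ex_cst P); congr Ex; apply/funext => o.
by refine (depends_avgs (l := l) fl _) => i [].
Qed.

Lemma avgs_comm l f (T : W -> W) :
  (forall e w s, e \in l -> T (upd w e s) = upd (T w) e s) ->
  forall w, avgs l (f \o T) w = avgs l f (T w).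
Proof.
elim: l => //= e l IH hT w.
congr fine; apply: eq_integral => s _.
rewrite IH ?hT ?mem_head// => e' w' s' e'l.
by apply: hT; rewrite inE e'l orbT.
Qed.

Lemma upd_comm w e e' s s' : e != e' ->
  upd (upd w e s) e' s' = upd (upd w e' s') e s.
Proof.
move=> ee'; apply/funext => i; rewrite /upd.
by case: (eqVneq i e') => // ->; rewrite eq_sym (negPf ee').
Qed.

End averaging.

Opaque exp1.

(** * The one-variable Laplace inequality and its stability *)

Section laplace_class.
Variables (R : realType) (lam : R).
Hypothesis lam01 : 0 < lam < 1.
Notation S := (measurableTypeR R).
Notation X := (exp1 R).
Let b := (1 - lam)^-1.

Let lam0 : 0 < lam. Proof. by case/andP: lam01. Qed.
Let b0 : 0 < b. Proof. by rewrite invr_gt0 subr_gt0; case/andP: lam01. Qed.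

(** An inequality between [phi] at the weight scaled by [b] and the mean of [phi] at the unscaled
    weight. It is stated for general [phi] because averaging over other weights destroys the form
    [min (A + s) B] but preserves this inequality. *)
Definition laplace_le (phi : R -> R) : Prop :=
  (Ex X (fun s => expR (- lam * phi (b * Num.max s 0)))%R <=
   (expR (- lam * E X (fun s => phi (Num.max s 0))))%:E)%E.

Lemma laplace_le_min (phi : R -> R) A B :
  (forall s, 0 <= s -> phi s = Num.min (A + s) B) -> laplace_le phi.
Proof.
move=> phiE; have p0 (s : R) : 0 <= Num.max s 0 by rewrite le_max lexx orbT.
rewrite /laplace_le /Ex /E /Ex.
under eq_integral do rewrite phiE ?mulr_ge0 ?(ltW b0)//.
under [in leRHS]eq_integral do rewrite phiE//.
exact: exp1_laplace_le.
Qed.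

(** Let [m s'] be the mean of [Phi s']. After division by the right side, Jensen in [s'] moves the
    exponential inside the average; Fubini then integrates over [s] first, where the inequality for
    each [Phi s'] gives at most 1. *)
Lemma laplace_le_avg K (Phi : R -> R -> R) :
  measurable_fun setT (fun ss : S * S => Phi ss.1 ss.2 : R) ->
  (forall s' s, 0 <= Phi s' s <= K) -> (forall s', laplace_le (Phi s')) ->
  laplace_le (fun s => E X (fun s' => Phi s' s)).
Proof.
move=> mPhi PhiK lapPhi.
have mmax : @measurable_fun _ _ S S setT (fun s => Num.max s 0) by exact: measurable_maxr0.
have mbmax : @measurable_fun _ _ S S setT (fun s => b * Num.max s 0).
  by apply: measurable_funM => //; exact: measurable_maxr0.
have joint (g : S -> S) : measurable_fun setT g ->
    measurable_fun setT (fun ss : S * S => Phi ss.1 (g ss.2) : R).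
  move=> mg; have mp : measurable_fun setT (fun ss : S * S => (ss.1, g ss.2)).
    apply/measurable_fun_pairP; split => //=; first exact: measurable_fst.
    exact: (measurableT_comp mg measurable_snd).
  exact: (measurableT_comp mPhi mp).
have sec1 (g : S -> S) s' : measurable_fun setT g ->
    bounded_mf K (fun s : S => Phi s' (g s)).
  move=> mg; split=> // ; have := joint g mg.
  by move=> mj; exact: (measurableT_comp mj (measurable_pair1 s')).
have sec2 s : bounded_mf K (fun s' : S => Phi s' s).
  by split=> //; exact: (measurableT_comp mPhi (measurable_pair2 s)).
pose m s' := E X (fun s => Phi s' (Num.max s 0)).
have mE (g : S -> S) : measurable_fun setT g -> bounded_mf K (fun s' : S => E X (fun s => Phi s' (g s))).
  move=> mg; split; last by move=> s'; exact: (E_bound X (sec1 g s' mg)).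
  have mj : measurable_fun setT (fun ss : S * S => (Phi ss.1 (g ss.2))%:E).
    by apply/measurable_EFinP; exact: joint.
  have j0 (ss : S * S) : (0 <= (Phi ss.1 (g ss.2))%:E)%E.
    by rewrite lee_fin; case/andP: (PhiK ss.1 (g ss.2)).
  have mF := @measurable_fun_fubini_tonelli_F _ _ S S R X _ mj j0.
  exact: (measurableT_comp (f := @fine R) _ mF).
have bm : bounded_mf K m by exact: mE.
have mE2 (g : S -> S) : measurable_fun setT g -> bounded_mf K (fun s : S => E X (fun s' => Phi s' (g s))).
  move=> mg; split; last by move=> s; exact: (E_bound X (sec2 (g s))).
  have mj : measurable_fun setT (fun ss : S * S => (Phi ss.1 (g ss.2))%:E).
    by apply/measurable_EFinP; exact: joint.
  have j0 (ss : S * S) : (0 <= (Phi ss.1 (g ss.2))%:E)%E.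
    by rewrite lee_fin; case/andP: (PhiK ss.1 (g ss.2)).
  have mF := @measurable_fun_fubini_tonelli_G _ _ S S R X _ mj j0.
  exact: (measurableT_comp (f := @fine R) _ mF).
have Em : E X (fun s => E X (fun s' => Phi s' (Num.max s 0))) = E X m.
  have mj : measurable_fun setT (fun ss : S * S => (Phi ss.1 (Num.max ss.2 0))%:E).
    by apply/measurable_EFinP; exact: (joint _ mmax).
  have j0 (ss : S * S) : (0 <= (Phi ss.1 (Num.max ss.2 0))%:E)%E.
    by rewrite lee_fin; case/andP: (PhiK ss.1 (Num.max ss.2 0)).
  have FT := fubini_tonelli (m1 := X) (m2 := X) _ mj j0.
  have L : Ex X (fun s => E X (fun s' => Phi s' (Num.max s 0))) = Ex X m.
    transitivity (\int[X]_s \int[X]_s' (Phi s' (Num.max s 0%R))%:E)%E.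
      by apply: eq_integral => s _; rewrite -(EK X (sec2 _)).
    rewrite -[LHS]FT; apply: eq_integral => s' _.
    by rewrite -(EK X (sec1 _ s' mmax)).
  by rewrite {1}/E L.
rewrite /laplace_le Em.
have key : (Ex X (fun s => expR (lam * (E X m - E X (fun s' => Phi s' (b * Num.max s 0%R)))))%R
     <= 1)%E.
  have mj : measurable_fun setT (fun ss : S * S =>
      (expR (lam * (m ss.1 - Phi ss.1 (b * Num.max ss.2 0))))%:E).
    apply/measurable_EFinP.
    have mm1 : measurable_fun setT (fun ss : S * S => m ss.1).
      by case: bm => mm _; exact: (measurableT_comp mm measurable_fst).
    exact: (measurable_expRM lam (measurable_funB mm1 (joint _ mbmax))).
  have j0 (ss : S * S) :
      (0 <= (expR (lam * (m ss.1 - Phi ss.1 (b * Num.max ss.2 0))))%:E)%E.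
    by rewrite lee_fin expR_ge0.
  have FT := fubini_tonelli (m1 := X) (m2 := X) _ mj j0.
  have mG := @measurable_fun_fubini_tonelli_G _ _ S S R X _ mj j0.
  have mF := @measurable_fun_fubini_tonelli_F _ _ S S R X _ mj j0.
  apply: (@le_trans _ _ (\int[X]_s \int[X]_s'
      (expR (lam * (m s' - Phi s' (b * Num.max s 0%R))))%:E))%E.
    have mL : measurable_fun setT (fun s : S =>
        (expR (lam * (E X m - E X (fun s' => Phi s' (b * Num.max s 0%R)))))%:E).
      apply/measurable_EFinP; have [mm2 _] := mE2 _ mbmax.
      exact: (measurable_expRM lam (measurable_funB (measurable_cst (E X m)) mm2)).
    refine (ge0_le_integral X measurableT _ mL mG _).
      by move=> s _; rewrite lee_fin expR_ge0.
    by move=> s _; exact: (jensen_expR X (ltW lam0) (sec2 _) bm).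
  rewrite -[X in (X <= _)%E]FT.
  apply: (@le_trans _ _ (\int[X]_s' (1:R)%:E)%E); last first.
    by have H1 := Ex_cst X (1:R); rewrite /Ex in H1; rewrite H1.
  refine (ge0_le_integral X measurableT _ mF (measurable_cst _) _).
    by move=> s' _; apply: integral_ge0 => s _; exact: (j0 (s', s)).
  move=> s' _; rewrite /fubini_F /=.
  rewrite [leLHS](_ : _ = Ex X (fun s => (expR (lam * m s') *
       expR (- lam * Phi s' (b * Num.max s 0)))%R)); last first.
    congr (integral _ setT _); apply/funext => s; by rewrite -expRD mulNr mulrBr.
  have [m1 _] := sec1 _ s' mbmax.
  have mE1 := measurable_expRM (- lam) m1.
  rewrite (@ExZl _ _ _ X (expR (lam * m s')) _ mE1 (expR_ge0 _) (fun s => expR_ge0 _)).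
  have h := lapPhi s'; rewrite /laplace_le -/(m s') in h.
  apply: (@le_trans _ _ ((expR (lam * m s'))%:E * (expR (- lam * m s'))%:E)%E).
    by apply: lee_wpmul2l => //; rewrite lee_fin expR_ge0.
  by rewrite -EFinM -expRD mulNr subrr expR0.
rewrite [in leLHS](_ : (fun s => expR (lam * _))%R = (fun s => expR (lam * E X m) *
    expR (- lam * E X (fun s' => Phi s' (b * Num.max s 0))))%R) in key; last first.
  by apply/funext => s; rewrite -expRD mulNr mulrBr.
have [m2 _] := mE2 _ mbmax.
have mE3 := measurable_expRM (- lam) m2.
rewrite (@ExZl _ _ _ X (expR (lam * E X m)) _ mE3 (expR_ge0 _) (fun s => expR_ge0 _)) in key.
by rewrite mulNr expRN -[leRHS]mule1 lee_pdivlMl ?expR_gt0.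
Qed.

End laplace_class.

(** * The Laplace inequality for finite minima of sums *)

Section mgf.
Variables (R : realType) (I : choiceType).
Notation S := (measurableTypeR R).
Notation W := (weights R I).

Section fixed_lambda.
Variable lam : R.
Hypothesis lam01 : 0 < lam < 1.
Let b := (1 - lam)^-1.
Let lam0 : 0 < lam. Proof. by case/andP: lam01. Qed.
Let b0 : 0 < b. Proof. by rewrite invr_gt0 subr_gt0; case/andP: lam01. Qed.

Lemma laplace_le_avg_upd K (f : W -> R) e e' : e != e' -> bounded_mf K f ->
  (forall w, laplace_le lam (fun s => f (upd w e s))) ->
  forall w, laplace_le lam (fun s => avg e' f (upd w e s)).
Proof.
move=> ee' [mf fK] hf w.
apply: (laplace_le_avg lam01 (K := K)
    (Phi := fun s' s => f (upd (upd w e s) e' (Num.max s' 0)))).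
- have mu : measurable_fun setT
      (fun ss : S * S => upd (upd w e ss.2) e' (Num.max ss.1 0) : W).
    apply: measurable_weights => i; rewrite /upd; case: (i == e').
      by apply: measurable_maxr => //; exact: measurable_fst.
    by case: (i == e) => //; exact: measurable_snd.
  exact: (measurableT_comp mf mu).
- by move=> s' s; exact: fK.
- move=> s'; have -> : (fun s => f (upd (upd w e s) e' (Num.max s' 0))) =
      (fun s => f (upd (upd w e' (Num.max s' 0)) e s)).
    by apply/funext => s; rewrite upd_comm.
  exact: hf.
Qed.

Lemma scale1_upd (w : W) e s c : scale [:: e] c (upd w e s) = upd w e (c * s).
Proof. by apply/funext => i; rewrite /scale /upd inE; case: eqP. Qed.

Lemma scale1_upd_neq (w : W) e e' s c : e' != e ->
  scale [:: e] c (upd w e' s) = upd (scale [:: e] c w) e' s.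
Proof.
move=> ee'; apply/funext => i; rewrite /scale /upd inE.
by case: (eqVneq i e') => // ->; rewrite (negPf ee').
Qed.

Lemma bounded_expRM K (f : W -> R) l : bounded_mf K f ->
  bounded_mf 1 (fun w => expR (- lam * f (scale l b w))).
Proof.
move=> [mf fK]; split.
  have mg : measurable_fun setT (fun w => f (scale l b w)).
    exact: (measurableT_comp mf (measurable_scale l b)).
  exact: (measurable_expRM (- lam) mg).
move=> w; rewrite expR_ge0 -expR0 ler_expR mulNr oppr_le0.
by apply: mulr_ge0; [exact: ltW|case/andP: (fK (scale l b w))].
Qed.

(** Induction on the coordinates. The tail [l] is treated by induction for [f] with [e] already
    scaled; the remaining function of [e], built from [avgs l f], is still in the class [laplace_le]
    by [laplace_le_avg_upd], and the one-variable inequality finishes. *)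
Lemma avgs_laplace K l (f : W -> R) : uniq l -> bounded_mf K f ->
  (forall w e, e \in l -> laplace_le lam (fun s => f (upd w e s))) ->
  forall w, avgs l (fun w => expR (- lam * f (scale l b w))) w <=
            expR (- lam * avgs l f w).
Proof.
elim: l f => [|e l IH] f; first by move=> _ _ _ w /=; rewrite (_ : scale [::] b w = w).
move=> /= /andP[el ul] bf hf w.
pose f' := f \o scale [:: e] b.
have bf' : bounded_mf K f'.
  case: bf => mf fK; split; last by move=> ?; exact: fK.
  exact: (measurableT_comp mf (measurable_scale [:: e] b)).
have hf' v e' : e' \in l -> laplace_le lam (fun s => f' (upd v e' s)).
  move=> e'l; have ne : e' != e by apply: contraNneq el => <-.
  have -> : (fun s => f' (upd v e' s)) = (fun s => f (upd (scale [:: e] b v) e' s)).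
    by apply/funext => s; rewrite /f' /= scale1_upd_neq.
  by apply: hf; rewrite inE e'l orbT.
have step1 v : avgs l (fun w => expR (- lam * f (scale (e :: l) b w))) v <=
    expR (- lam * avgs l f (scale [:: e] b v)).
  rewrite -(@avgs_comm _ _ l f (scale [:: e] b)); last first.
    by move=> e' v' s e'l; apply: scale1_upd_neq; apply: contraNneq el => <-.
  apply: le_trans (IH f' ul bf' hf' v).
  rewrite le_eqVlt; apply/orP; left; apply/eqP; congr (avgs l _ v).
  apply/funext => v'; rewrite scale_cons// /f' /=; congr (expR (_ * f _)).
  apply/funext => i; rewrite /scale inE; case: eqP => // ->.
  by rewrite (negPf el).
have lapl : forall v, laplace_le lam (fun s => avgs l f (upd v e s)).
  have : forall v, laplace_le lam (fun s => f (upd v e s)).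
    by move=> v; apply: hf; rewrite mem_head.
  move: bf el => {hf step1 IH ul hf' bf' f' w} bf el hf.
  elim: l el => //= e' l IH; rewrite inE negb_or => /andP[ee' el].
  apply: (laplace_le_avg_upd (K := K)) => //; first exact: bounded_avgs.
  exact: IH.
have bl : bounded_mf K (avgs l f) by exact: bounded_avgs.
have := lapl w; rewrite /laplace_le.
pose h v := expR (- lam * avgs l f (scale [:: e] b v)).
have bh : bounded_mf 1 h by exact: bounded_expRM bl.
have E1 : Ex (exp1 R) (fun s => h (upd w e (Num.max s 0))) =
    Ex (exp1 R) (fun s => expR (- lam * avgs l f (upd w e ((1 - lam)^-1 * Num.max s 0)))%R).
  by congr Ex; apply/funext => s; rewrite /h scale1_upd.
rewrite -E1 (EK (exp1 R) (bounded_section e w bh)) lee_fin; apply: le_trans.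
apply: (@le_E _ _ _ _ 1 1).
- apply: (bounded_section e w (f := avgs l (fun w => expR (- lam * f (scale (e :: l) b w))))).
  exact: bounded_avgs (bounded_expRM _ bf).
- exact: bounded_section.
- by move=> s; exact: step1.
Qed.

End fixed_lambda.

Implicit Types (K : {fset I}) (w : W).

Definition ssum K w : R := \sum_(i <- K) Num.max (w i) 0.

(** A passage time over finitely many paths, capped at [M] so that it is bounded. *)
Definition smin (Pi : seq {fset I}) (M : R) w : R :=
  foldr (fun K acc => Num.min (ssum K w) acc) M Pi.

Lemma ssum_ge0 K w : 0 <= ssum K w.
Proof. by apply: sumr_ge0 => i _; rewrite le_max lexx orbT. Qed.

Lemma measurable_ssum K : measurable_fun setT (ssum K).
Proof.
apply: measurable_sum => i; apply: measurable_maxr => //; exact: measurable_coord.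
Qed.

Lemma bounded_smin Pi M : 0 <= M -> bounded_mf M (smin Pi M).
Proof.
move=> M0; elim: Pi => [|K Pi [mPi PiM]] /=; first by split; [exact: measurable_cst|move=> w; rewrite M0 lexx].
split; first exact: (measurable_minr (measurable_ssum K) mPi).
move=> w; have /andP[h1 h2] := PiM w.
by rewrite le_min ssum_ge0 h1 ge_min h2 orbT.
Qed.

Lemma smin_ge Pi M w x : x <= M -> (forall K, K \in Pi -> x <= ssum K w) ->
  x <= smin Pi M w.
Proof.
move=> xM; elim: Pi => //= K Pi IH h; rewrite le_min h ?mem_head//=.
by apply: IH => K' K'Pi; apply: h; rewrite inE K'Pi orbT.
Qed.

(** An edge set contains [e] at most once, so each sum is constant or of slope 1 in the weight of
    [e]. Here the restriction to self-avoiding paths enters. *)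
Lemma smin_section Pi M w e : exists A B : R, forall s, 0 <= s ->
  smin Pi M (upd w e s) = Num.min (A + s) B.
Proof.
elim: Pi => [|K Pi [A [B IH]]] /=.
  by exists M, M => s s0; rewrite (min_idPr _)// lerDl.
have [eK|eK] := boolP (e \in K).
  pose c := \sum_(i <- (K `\ e)%fset) Num.max (w i) 0.
  exists (Num.min c A), B => s s0; rewrite IH//.
  have -> : ssum K (upd w e s) = c + s.
    rewrite /ssum (big_fsetD1 e)//= /upd eqxx (max_idPl s0) addrC; congr (_ + _).
    apply: eq_big_seq => i; rewrite !inE => /andP[ie _].
    by rewrite (negPf ie).
  by rewrite minA -addr_minl.
exists A, (Num.min (ssum K w) B) => s s0; rewrite IH//.
have -> : ssum K (upd w e s) = ssum K w.
  apply: eq_big_seq => i iK; rewrite /upd; case: eqP => // ie.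
  by move: eK; rewrite -ie iK.
by rewrite minCA.
Qed.

(** [l] collects all edges of the family, so averaging over [l] computes both expectations
    exactly. *)
Lemma mgf_finite d (O : measurableType d) (P : probability O R) (F : set I)
    (Y : O -> W) lam Pi M (b := (1 - lam)^-1) : 0 < lam < 1 -> 0 <= M -> iid P F Y ->
  (forall K, K \in Pi -> [set` K] `<=` F) ->
  exists l, [/\ uniq l, forall K, K \in Pi -> {subset K <= l} &
  (Ex P (fun o => expR (- lam * smin Pi M (scale l b (Y o))))%R <=
    (expR (- lam * E P (fun o => smin Pi M (Y o))))%:E)%E].
Proof.
move=> lam01 M0 iY PiF.
pose l := undup (flatten [seq enum_fset K | K <- Pi]).
have lE i : i \in l -> exists2 K, K \in Pi & i \in K.
  by rewrite mem_undup => /flattenP[_ /mapP[K KPi ->] iK]; exists K.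
have Kl K : K \in Pi -> {subset K <= l}.
  move=> KPi i iK; rewrite mem_undup; apply/flattenP; exists (enum_fset K) => //.
  by apply/mapP; exists K.
exists l; split => //; first exact: undup_uniq.
have iYl : iid P [set` l] Y.
  by apply: (iid_sub iY) => i /lE [K KPi]; exact: PiF.
have bM := bounded_smin Pi M0.
have bS := bounded_expRM lam01 l bM.
have dep (w w' : W) : (forall i, [set` l] i -> w i = w' i) -> smin Pi M w = smin Pi M w'.
  move=> ww'; rewrite /smin; elim: Pi {iYl lE bM bS PiF} l Kl ww' => //= K Pi IH l Kl ww'.
  congr Num.min.
    apply: eq_big_seq => i iK; rewrite ww'//=; apply: Kl iK; exact: mem_head.
  apply: (IH l) => // K' K'Pi; apply: Kl; by rewrite inE K'Pi orbT.
have depS : depends_on [set` l] (fun w => expR (- lam * smin Pi M (scale l b w))).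
  by move=> w w' ww'; congr (expR (_ * _)); apply: dep => i il; rewrite /scale ww'.
pose w0 : W := fun=> 0.
rewrite (Ex_avgs_const w0 iYl bS depS) /E (Ex_avgs_const w0 iYl bM dep) /= lee_fin.
apply: (avgs_laplace lam01 (undup_uniq _) bM).
move=> w e _; have [A [B AB]] := smin_section Pi M w e.
exact: (laplace_le_min lam01 AB).
Qed.

End mgf.

Transparent exp1.

(** * The Laplace inequality for infima, and the lower tail *)

Section mgf_inf.
Variables (R : realType) (I : choiceType).
Notation W := (weights R I).
Implicit Types (Pi : seq {fset I}) (M b : R) (l : seq I) (w : W) (K : {fset I}).

Lemma ler_expR_eps (c z C : R) : 0 <= c -> z <= 1 ->
  (forall e, 0 < e -> expR (- c * e) * z <= C) -> z <= C.
Proof.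
move=> c0 z1 h; have [z0|z0] := ltP z 0.
  apply: le_trans (h 1 ltr01); rewrite mulr1 -{1}[z]mul1r ler_wnM2r ?(ltW z0)//.
  by rewrite -expR0 ler_expR oppr_le0.
apply/ler_addgt0Pr => e e0.
pose e' := e / (c + 1).
have c1 : 0 < c + 1 by rewrite ltr_wpDl.
have e'0 : 0 < e' by rewrite divr_gt0.
have ce : c * e' <= e.
  rewrite /e' mulrCA ger_pMr// ler_pdivrMr// mul1r lerDl//.
have := h _ e'0; have := expR_ge1Dx (- c * e') => h1 h2.
have : (1 + - c * e') * z <= C by apply: le_trans h2; rewrite ler_wpM2r.
rewrite mulrDl mul1r mulNr mulNr => h3.
have : c * e' * z <= e by apply: le_trans ce; rewrite ler_piMr// mulr_ge0// ltW.
move: h3; lra.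
Qed.

(** What [smin] becomes when the weights are scaled by [b]: the sums are multiplied, the cap is not.
    Unlike [scale l b], it does not involve the list [l], so growing families can be compared. *)
Definition sminb (b : R) (Pi : seq {fset I}) (M : R) (w : W) : R :=
  foldr (fun K acc => Num.min (b * ssum K w) acc) M Pi.

Lemma sminb_scale Pi M l b w : 0 <= b -> (forall i, 0 <= w i) ->
  (forall K, K \in Pi -> {subset K <= l}) -> smin Pi M (scale l b w) = sminb b Pi M w.
Proof.
move=> b0 w0; elim: Pi => //= K Pi IH Kl; congr Num.min; last first.
  by apply: IH => K' K'Pi; apply: Kl; rewrite inE K'Pi orbT.
rewrite /ssum mulr_sumr; apply: eq_big_seq => i iK.
by rewrite /scale (Kl K (mem_head _ _)) ?iK// !(max_idPl _)// mulr_ge0.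
Qed.

Lemma sminb_le b Pi M w K : K \in Pi -> sminb b Pi M w <= b * ssum K w.
Proof.
elim: Pi => //= K' Pi IH; rewrite inE ge_min => /orP[/eqP ->|/IH ->].
  by rewrite lexx.
by rewrite orbT.
Qed.

Lemma sminb_subset b Pi Pi' M w : {subset Pi <= Pi'} ->
  sminb b Pi' M w <= sminb b Pi M w.
Proof.
elim: Pi => [_|K Pi IH sub] /=.
  by elim: Pi' => //= K Pi IH; rewrite ge_min IH orbT.
rewrite le_min sminb_le ?sub ?mem_head//=.
by apply: IH => K' K'Pi; apply: sub; rewrite inE K'Pi orbT.
Qed.

Lemma measurable_sminb b Pi M : measurable_fun setT (sminb b Pi M).
Proof.
elim: Pi => [|K Pi IH] /=; first exact: measurable_cst.
apply: measurable_minr => //; apply: measurable_funM => //; exact: measurable_ssum.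
Qed.

Variables (d : measure_display) (O : measurableType d) (P : probability O R)
  (F : set I) (Y : O -> W) (T : O -> R) (Ks : nat -> {fset I}).
Hypotheses (iY : iid P F Y) (KF : forall k, [set` Ks k] `<=` F)
  (mT : measurable_fun setT T) (T0 : forall o, 0 <= T o)
  (TKs : forall o k, T o <= \sum_(i <- Ks k) Y o i)
  (TKs_eps : forall o e, 0 < e -> exists k, \sum_(i <- Ks k) Y o i <= T o + e).

Let Y0 o i : 0 <= Y o i. Proof. by case: iY. Qed.
Let mY : measurable_fun setT Y. Proof. by case: iY. Qed.

Let ssumE k o : ssum (Ks k) (Y o) = \sum_(i <- Ks k) Y o i.
Proof. by apply: eq_bigr => i _; rewrite (max_idPl _). Qed.

Lemma bounded_minT (M : R) : 0 <= M -> bounded_mf M (fun o => Num.min (T o) M).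
Proof.
move=> M0; split; first exact: measurable_minr.
by move=> o; rewrite le_min T0 M0 ge_min lexx orbT.
Qed.

Lemma bounded_expT c : 0 <= c -> bounded_mf 1 (fun o => expR (- c * T o)).
Proof.
move=> c0; split; first exact: measurable_expRM.
move=> o; rewrite expR_ge0 -expR0 ler_expR mulNr oppr_le0.
by apply: mulr_ge0.
Qed.

(** For [lam = th / (1 + th)] the scaling factor is [b = 1 + th] and [lam * b = th], so [lam] times
    the scaled minimum is at most [th] times any path sum of the family. The minimum over the first
    [k] sets decreases in [k], and monotone convergence reaches the infimum. *)
Lemma mgf_truncated th (lam := th / (1 + th)) (M : R) : 0 < th -> 0 <= M ->
  E P (fun o => expR (- th * T o)) <=
  expR (- lam * E P (fun o => Num.min (T o) M)).
Proof.
move=> th0 M0; set C := expR _.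
have th1 : 0 < 1 + th by rewrite addr_gt0.
have lam0 : 0 < lam by rewrite divr_gt0.
have lam01 : 0 < lam < 1 by rewrite lam0 /lam ltr_pdivrMr// mul1r ltrDr ltr01.
have bE : (1 - lam)^-1 = 1 + th.
  rewrite /lam; field; rewrite gt_eqF//= ?addrK ?oner_eq0//.
have lb : lam * (1 + th) = th by rewrite /lam mulfVK// gt_eqF.
pose g k o := expR (- lam * sminb (1 + th) (mkseq Ks k) M (Y o)).
have mg k : measurable_fun setT (g k).
  exact: (measurable_expRM _ (measurableT_comp (measurable_sminb _ _ _) mY)).
have gC k : (Ex P (g k) <= C%:E)%E.
  have KPi K : K \in mkseq Ks k -> [set` K] `<=` F by move=> /mapP[j _ ->]; exact: KF.
  have [l [ul Kl]] := mgf_finite lam01 M0 iY KPi.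
  rewrite bE (_ : (fun o => _) = g k); last first.
    apply/funext => o; rewrite /g sminb_scale//; first exact: ltW.
  move/le_trans; apply; rewrite lee_fin ler_expR !mulNr lerN2 ler_pM2l//.
  apply: (@le_E _ _ _ _ M M); first exact: bounded_minT.
    have [mS SM] := bounded_smin (mkseq Ks k) M0; split; last by move=> o; exact: SM.
    exact: (measurableT_comp mS mY).
  move=> o; apply: smin_ge; first by rewrite ge_min lexx orbT.
  move=> K /mapP[j _ ->]; rewrite ssumE ge_min TKs//.
have nd o : {homo (fun k => (g k o)%:E) : n m / (n <= m)%N >-> (n <= m)%E}.
  move=> n m nm; rewrite lee_fin ler_expR !mulNr lerN2 ler_pM2l//.
  apply: sminb_subset => K /mapP[j]; rewrite mem_iota add0n => /andP[_ jn] ->.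
  by apply/mapP; exists j => //; rewrite mem_iota /= add0n (leq_trans jn).
have mgE k : measurable_fun setT (fun o => (g k o)%:E) by exact/measurable_EFinP.
have g0 k o : (0 <= (g k o)%:E)%E by rewrite lee_fin expR_ge0.
have MC := @monotone_convergence _ _ _ P setT measurableT (fun k o => (g k o)%:E) mgE
  (fun k o _ => g0 k o) (fun o _ => nd o).
have limC : (\int[P]_o limn (fun k => (g k o)%:E) <= C%:E)%E.
  rewrite MC; apply: lime_le; last by apply: nearW => k; exact: gC.
  apply: ereal_nondecreasing_is_cvgn => n m nm.
  by apply: ge0_le_integral => // o _; exact: nd.
have bT := bounded_expT (ltW th0).
apply: (@ler_expR_eps th) => //; first exact: ltW.
  by case/andP: (E_bound P bT).
move=> e e0.
have bTe : bounded_mf 1 (fun o => expR (- th * e) * expR (- th * T o)).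
  have [mE bE1] := bT; split; first exact: measurable_funM.
  move=> o; rewrite mulr_ge0 ?expR_ge0//= -expRD -expR0 ler_expR -mulrDr mulNr oppr_le0.
  by rewrite mulr_ge0 ?addr_ge0// ltW.
rewrite -lee_fin EFinM -(EK P bT) -ExZl ?expR_ge0//; last by case: bT.
have mlim : measurable_fun setT (fun o => limn (fun k => (g k o)%:E)).
  have cv o : setT o -> (fun k => (g k o)%:E) @ \oo --> limn (fun k => (g k o)%:E).
    by move=> _; exact: (ereal_nondecreasing_is_cvgn (nd o)).
  exact: (@emeasurable_fun_cvg _ _ _ setT (fun k o => (g k o)%:E) _ mgE cv).
have mTe : measurable_fun setT (fun o => (expR (- th * e) * expR (- th * T o))%:E).
  by apply/measurable_EFinP; case: bTe.
apply: le_trans limC; refine (ge0_le_integral P measurableT _ mTe mlim _).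
  by move=> o _; rewrite lee_fin mulr_ge0 ?expR_ge0.
(* Some set comes within [e] of the infimum; the factor [expR (- th * e)] lost here is removed by
   [ler_expR_eps]. *)
move=> o _; have [k hk] := TKs_eps o e0.
apply: (@le_trans _ _ (g k.+1 o)%:E).
  rewrite lee_fin -expRD ler_expR -mulrDr !mulNr lerN2.
  have := @sminb_le (1 + th) (mkseq Ks k.+1) M (Y o) (Ks k).
  rewrite map_f ?mem_iota ?add0n ?leqnn// => /(_ isT); rewrite ssumE => h.
  rewrite [leRHS](_ : _ = lam * ((1 + th) * (T o + e))); last by rewrite mulrA lb addrC.
  by rewrite ler_pM2l//; apply: le_trans h _; rewrite ler_pM2l.
rewrite (cvg_lim _ (ereal_nondecreasing_cvgn (nd o)))//.
by apply: ereal_sup_ubound; exists k.+1.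
Qed.

(** Removes the cap. The mean is replaced by a real lower bound [h], so the statement makes sense
    before the mean is known to be finite. *)
Lemma mgf (th h : R) : 0 < th -> (h%:E <= Ex P T)%E ->
  E P (fun o => expR (- th * T o)) <= expR (- (th / (1 + th)) * h).
Proof.
move=> th0 hT; pose lam := th / (1 + th).
have lam0 : 0 < lam by rewrite divr_gt0// addr_gt0.
have bT := bounded_expT (ltW th0).
apply: (@ler_expR_eps lam); first exact: ltW.
  by case/andP: (E_bound P bT).
move=> e e0.
(* By monotone convergence the capped means approach the mean, so some cap [M] loses at most [e]. *)
have [M M0 hM] : exists2 M, 0 <= M & h - e <= E P (fun o => Num.min (T o) M).
  apply: contrapT => nM.
  have {}nM (k : nat) : (Ex P (fun o => Num.min (T o) k%:R) <= (h - e)%:E)%E.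
    rewrite leNgt; apply/negP => hk; apply: nM; exists k%:R => //.
    by rewrite -lee_fin -(EK P (bounded_minT _))//; exact: ltW.
  have mk k : measurable_fun setT (fun o => (Num.min (T o) k%:R)%:E).
    by apply/measurable_EFinP; exact: measurable_minr.
  have k0 (k : nat) o : (0 <= (Num.min (T o) k%:R)%:E)%E.
    by rewrite lee_fin le_min T0 ler0n.
  have nd o : {homo (fun k => (Num.min (T o) k%:R)%:E) : n m / (n <= m)%N >-> (n <= m)%E}.
    by move=> n m nm; rewrite lee_fin; apply: le_min2 => //; rewrite ler_nat.
  have MC := @monotone_convergence _ _ _ P setT measurableT _ mk
    (fun k o _ => k0 k o) (fun o _ => nd o).
  have limT o : limn (fun k => (Num.min (T o) k%:R)%:E) = (T o)%:E.
    apply: cvg_lim => //; apply: cvg_near_cst; near=> k.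
    by rewrite (min_idPl _)//; near: k; exact: nbhs_infty_ger.
  have : (Ex P T <= (h - e)%:E)%E.
    rewrite /Ex; under eq_integral do rewrite -limT.
    rewrite MC; apply: lime_le; last by apply: nearW => k; exact: nM.
    apply: ereal_nondecreasing_is_cvgn => n m nm.
    by apply: ge0_le_integral => // o _; exact: nd.
  by move/(le_trans hT); rewrite lee_fin lerBrDr gerDl leNgt e0.
have h1 := mgf_truncated th0 M0.
have h2 : E P (fun o => expR (- th * T o)) <= expR (- lam * (h - e)).
  by apply: (le_trans h1); rewrite ler_expR !mulNr lerN2 ler_pM2l.
apply: (@le_trans _ _ (expR (- lam * e) * expR (- lam * (h - e)))).
  by rewrite ler_pM2l ?expR_gt0.
by rewrite -expRD -mulrDr addrC subrK.
Unshelve. all: end_near. Qed.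

(** Chernoff's bound with the Laplace bound [mgf]. *)
Lemma lower_tail (th h y : R) : 0 < th -> (h%:E <= Ex P T)%E ->
  (P [set o | (T o <= y)%R] <= (expR (th * y - th / (1 + th) * h))%:E)%E.
Proof.
move=> th0 hT; have bT := bounded_expT (ltW th0).
have mA : measurable [set o | T o <= y].
  rewrite [X in measurable X](_ : _ = T @^-1` `]-oo, y]).
    by rewrite -[X in measurable X]setTI; exact: mT.
  by apply/seteqP; split => o; rewrite /= in_itv.
rewrite -Ex_indic//.
apply: (@le_trans _ _ (Ex P (fun o => (expR (th * y) * expR (- th * T o))%R))).
  apply: le_Ex => //.
  - by case: bT => mE _; exact: measurable_funM.
  - move=> o; rewrite indicE; case: (boolP (o \in _)) => [|_]; last first.
      by rewrite mulr_ge0 ?expR_ge0.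
    rewrite inE/= => Ty; rewrite -expRD -[leLHS]expR0 ler_expR mulNr -mulrBr.
    by rewrite mulr_ge0 ?(ltW th0)// subr_ge0.
rewrite ExZl ?expR_ge0//; last by case: bT.
rewrite (EK P bT) -EFinM lee_fin expRD ler_pM2l ?expR_gt0// -mulNr.
exact: mgf.
Qed.

End mgf_inf.

(** * Walks and passage times confined to a set *)

Section walks.
Variable R : realType.
Implicit Types (V : set Z2) (w : {fset Z2} -> R) (x y z v : Z2) (p q : seq Z2).

(** Confinement to [V] makes the passage time a function of the edges inside [V], so that a window
    of the torus can be compared with the plane. *)
Definition walks V x y : set (seq Z2) :=
  [set p | [/\ path adjacent x p, last x p = y & forall v, v \in x :: p -> V v]].

Definition ptime V w x y : R := inf [set path_time w x p | p in walks V x y].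

Lemma passage_timeE w x y : passage_time w x y = ptime setT w x y.
Proof.
congr inf; apply/seteqP; split => _ [p h <-]; exists p => //.
  by case: h => h1 h2; split.
by case: h => h1 h2 _; split.
Qed.

Definition path_edges x p := pairmap (fun a b => [fset a; b]%fset : {fset Z2}) x p.

Lemma path_time_cat w x p q :
  path_time w x (p ++ q) = path_time w x p + path_time w (last x p) q.
Proof. by rewrite /path_time pairmap_cat big_cat. Qed.

Lemma path_time_cons w x y p : path_time w x (y :: p) = w [fset x; y]%fset + path_time w y p.
Proof. by rewrite /path_time /= big_cons. Qed.

Lemma path_time_ge0 w x p : (forall e, 0 <= w e) -> 0 <= path_time w x p.
Proof. by move=> w0; apply: sumr_ge0 => e _. Qed.

Lemma ptime_lbound V w x y : (forall e, 0 <= w e) ->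
  has_lbound [set path_time w x p | p in walks V x y].
Proof. by move=> w0; exists 0 => _ [p _ <-]; exact: path_time_ge0. Qed.

Lemma ptime_le V w x y p : (forall e, 0 <= w e) -> walks V x y p ->
  ptime V w x y <= path_time w x p.
Proof. by move=> w0 hp; apply: ge_inf; [exact: ptime_lbound|exists p]. Qed.

Lemma ptime_ge V w x y c : walks V x y !=set0 ->
  (forall p, walks V x y p -> c <= path_time w x p) -> c <= ptime V w x y.
Proof.
move=> [p0 hp0] h; apply: lb_le_inf; first by exists (path_time w x p0), p0.
by move=> _ [p hp <-]; exact: h.
Qed.

Lemma ptime_ge0 V w x y : (forall e, 0 <= w e) -> 0 <= ptime V w x y.
Proof.
move=> w0; have [h|h] := pselect (walks V x y !=set0).
  by apply: ptime_ge => // p _; exact: path_time_ge0.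
rewrite /ptime (_ : image _ _ = set0) ?inf0//.
by apply/seteqP; split => // t [p hp _]; apply: h; exists p.
Qed.

Lemma ptime_approx V w x y eps : (forall e, 0 <= w e) -> walks V x y !=set0 -> 0 < eps ->
  exists2 p, walks V x y p & path_time w x p < ptime V w x y + eps.
Proof.
move=> w0 [p0 hp0] e0.
have hi : has_inf [set path_time w x p | p in walks V x y].
  by split; [exists (path_time w x p0), p0|exact: ptime_lbound].
by have [_ [p hp <-] lt] := inf_adherent e0 hi; exists p.
Qed.

Lemma walks_cat V x y z p q : walks V x y p -> walks V y z q -> walks V x z (p ++ q).
Proof.
move=> [p1 p2 p3] [q1 q2 q3]; split.
- by rewrite cat_path p1 p2.
- by rewrite last_cat p2.
- move=> v; rewrite -cat_cons mem_cat => /orP[/p3//|vq].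
  by apply: q3; rewrite inE vq orbT.
Qed.

Lemma walksS V V' x y p : V `<=` V' -> walks V x y p -> walks V' x y p.
Proof. by move=> VV [p1 p2 p3]; split=> // v /p3 /VV. Qed.

Lemma ptime_triangle V w x y z : (forall e, 0 <= w e) ->
  walks V x y !=set0 -> walks V y z !=set0 ->
  ptime V w x z <= ptime V w x y + ptime V w y z.
Proof.
move=> w0 hxy hyz; apply/ler_addgt0Pr => e e0.
have e2 : 0 < e / 2 by rewrite divr_gt0.
have [p hp ltp] := ptime_approx w0 hxy e2.
have [q hq ltq] := ptime_approx w0 hyz e2.
apply: (le_trans (ptime_le w0 (walks_cat hp hq))).
rewrite path_time_cat; case: hp => _ -> _; lra.
Qed.

Lemma ptimeS V V' w x y : (forall e, 0 <= w e) -> V `<=` V' -> walks V x y !=set0 ->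
  ptime V' w x y <= ptime V w x y.
Proof.
move=> w0 VV hxy; apply: ptime_ge => // p hp.
by apply: ptime_le => //; exact: walksS hp.
Qed.

Lemma adjacent_sym x y : adjacent x y = adjacent y x.
Proof.
rewrite /adjacent; congr (_ == _); apply: eq_bigr => j _.
by rewrite -sqrrN opprB.
Qed.

Lemma adjacent_irr x : adjacent x x = false.
Proof.
rewrite /adjacent (_ : \sum_(j < 2) _ = 0) 1?eq_sym ?oner_eq0//.
by apply: big1 => j _; rewrite subrr expr0n.
Qed.

Lemma walks_rev V x y p : walks V x y p -> walks V y x (rev (belast x p)).
Proof.
move=> [p1 p2 p3]; split.
- rewrite -p2 rev_path; move: p1; apply: sub_path => a b.
  by rewrite adjacent_sym.
- by case: p p2 {p1 p3} => [<-//|a p] <- /=; rewrite rev_cons last_rcons.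
- move=> v hv; apply: p3; move: hv; rewrite -p2 -rev_rcons -lastI.
  by rewrite mem_rev.
Qed.

Lemma path_time_rev w x p : path_time w (last x p) (rev (belast x p)) = path_time w x p.
Proof.
elim: p x => [|a p IH] x //=.
rewrite rev_cons -cats1 path_time_cat IH [RHS]path_time_cons addrC.
congr (_ + _); rewrite path_time_cons /path_time big_nil addr0.
congr w; rewrite fsetUC; congr (_ |` _)%fset.
by case: p {IH} => [//|b p] /=; rewrite rev_cons last_rcons.
Qed.

Lemma ptime_rev V w x y : ptime V w x y = ptime V w y x.
Proof.
congr inf; apply/seteqP; split => _ [p hp <-].
  exists (rev (belast x p)); first exact: walks_rev.
  by case: hp => _ <- _; exact: path_time_rev.
exists (rev (belast y p)); first exact: walks_rev.
by case: hp => _ <- _; exact: path_time_rev.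
Qed.

(* Cutting a loop at a repeated vertex removes edges only. *)
Lemma loop_removal V x y p : walks V x y p -> exists q, [/\ walks V x y q,
  uniq (x :: q), {subset path_edges x q <= path_edges x p} &
  forall w, (forall e, 0 <= w e) -> path_time w x q <= path_time w x p].
Proof.
have [n] := ubnP (size p); elim: n p x => // n IH [|a p] x.
  by move=> _ hp; exists [::]; split.
rewrite ltnS => sp [/= /andP[xa p1] p2 p3].
have hp : walks V a y p by split=> // v vp; apply: p3; rewrite inE vp orbT.
have [q [hq uq sub tq]] := IH p a sp hp.
have [xq|xq] := boolP (x \in a :: q); last first.
  exists (a :: q); split => //=.
  - case: hq => q1 q2 q3; split => //=; first by rewrite xa.
    move=> v; rewrite inE => /orP[/eqP ->|/q3//].
    by apply: p3; rewrite mem_head.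
  - by rewrite xq.
  - move=> e; rewrite !inE => /orP[->//|/sub ->]; by rewrite orbT.
  - by move=> w w0; rewrite !path_time_cons lerD2l tq.
move: xq; rewrite inE => /orP[/eqP xa'|xq].
  by move: xa; rewrite -xa' adjacent_irr.
case/splitPr: xq hq uq sub tq => q1 q2 [h1 h2 h3] uq sub tq.
move: h1; rewrite cat_path /= => /and3P[h1 h1' h1''].
exists q2; split.
- split => //; first by rewrite -h2 last_cat.
  by move=> v vq; apply: h3; rewrite inE mem_cat vq !orbT.
- by move: uq => /= /andP[_]; rewrite cat_uniq => /and3P[].
- move=> e eq; rewrite inE; apply/orP; right; apply: sub.
  by rewrite /path_edges pairmap_cat mem_cat /= inE eq !orbT.
- move=> w w0; rewrite path_time_cons; apply: (@le_trans _ _ (path_time w a p)).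
    apply: le_trans (tq w w0); rewrite path_time_cat path_time_cons addrA lerDr.
    by rewrite addr_ge0// path_time_ge0.
  by rewrite lerDr.
Qed.

Lemma path_edges_uniq x p : uniq (x :: p) -> uniq (path_edges x p).
Proof.
elim: p x => // a p IH x /= /andP[xap uap]; rewrite IH// andbT.
apply/negP => /(nthP [fset x; a]%fset)[i]; rewrite size_pairmap => ip.
rewrite (nth_pairmap x)// => E.
have : x \in [fset nth x (a :: p) i; nth x p i]%fset by rewrite E !inE eqxx.
rewrite !inE => /orP[]/eqP E'; move: xap; rewrite E'.
  by rewrite mem_nth//= ltnW.
by rewrite inE mem_nth// orbT.
Qed.

Lemma path_time_fset w x p : uniq (x :: p) ->
  path_time w x p = \sum_(e <- [fset e in path_edges x p]%fset) w e.
Proof.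
move=> up; rewrite /path_time; apply: perm_big; apply: uniq_perm => //.
- exact: path_edges_uniq.
- exact: fset_uniq.
- by move=> e; rewrite inE.
Qed.

Lemma saw_passage_timeE w x y : (forall e, 0 <= w e) -> walks setT x y !=set0 ->
  saw_passage_time w x y = ptime setT w x y.
Proof.
move=> w0 h; apply/eqP; rewrite eq_le; apply/andP; split.
  apply: ptime_ge => // p /loop_removal[q [[q1 q2 _] uq _ le]].
  apply: le_trans (le w w0); apply: ge_inf.
    by exists 0 => _ [p' _ <-]; exact: path_time_ge0.
  by exists q.
case: h => p /loop_removal[q [[q1 q2 _] uq _ _]].
apply: lb_le_inf; first by exists (path_time w x q), q.
by move=> _ [q' [h1 h2 h3] <-]; apply: ptime_le.
Qed.

Lemma imfset_pair (phi : Z2 -> Z2) a b :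
  [fset phi v | v in [fset a; b]%fset]%fset = [fset phi a; phi b]%fset.
Proof.
apply/fsetP => v; rewrite !inE; apply/imfsetP/orP => [[u /=]|].
  by rewrite !inE => /orP[]/eqP -> ->; [left|right].
by move=> []/eqP ->; [exists a|exists b]; rewrite //= !inE eqxx ?orbT.
Qed.

Definition map_weight (phi : Z2 -> Z2) w : {fset Z2} -> R :=
  fun e => w [fset phi v | v in e]%fset.

Lemma path_time_map phi w x p :
  path_time (map_weight phi w) x p = path_time w (phi x) (map phi p).
Proof.
elim: p x => [|a p IH] x; first by rewrite /path_time /= !big_nil.
rewrite /= !path_time_cons IH; congr (w _ + _).
by rewrite imfset_pair.
Qed.

Lemma walks_map phi V V' x y p : (forall a b, adjacent (phi a) (phi b) = adjacent a b) ->
  (forall v, V v -> V' (phi v)) -> walks V x y p -> walks V' (phi x) (phi y) (map phi p).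
Proof.
move=> adj VV [p1 p2 p3]; split.
- by rewrite path_map; move: p1; apply: sub_path => a b; rewrite /= adj.
- by rewrite last_map p2.
- by move=> v; rewrite -map_cons => /mapP[u /p3 /VV + ->].
Qed.

Lemma ptime_map phi psi V V' w x y :
  (forall a b, adjacent (phi a) (phi b) = adjacent a b) -> cancel phi psi -> cancel psi phi ->
  (forall v, V v <-> V' (phi v)) ->
  ptime V (map_weight phi w) x y = ptime V' w (phi x) (phi y).
Proof.
move=> adj c1 c2 VV.
have adj' a b : adjacent (psi a) (psi b) = adjacent a b by rewrite -adj !c2.
congr inf; apply/seteqP; split => _ [p hp <-].
  exists (map phi p); last by rewrite path_time_map.
  by apply: walks_map hp => // v /VV.
exists (map psi p).
  have := walks_map adj' _ hp; rewrite !c1; apply.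
  by move=> v V'v; apply/VV; rewrite c2.
by rewrite path_time_map -map_comp map_id_in// => v _; rewrite /= c2.
Qed.

(** A function that rises by at most 1 per step takes the value [c] exactly when it first reaches
    it. Used for abscissas, for the distance to a centre, and for a maximum of both kinds. *)
Lemma walks_splitf (f : Z2 -> int) (c : int) x p :
  (forall a b, adjacent a b -> f b <= f a + 1) -> path adjacent x p -> f x < c ->
  has (fun v => c <= f v) p ->
  exists p1 v p2, [/\ p = p1 ++ v :: p2, f v = c & forall u, u \in x :: p1 -> f u < c].
Proof.
move=> lip; elim: p x => //= a p IH x /andP[xa pa] fx /orP h.
have [ca|ac] := leP c (f a).
  exists [::], a, p; split => //.
    by have h1 := lip _ _ xa; lia.
  by move=> u; rewrite inE => /eqP ->.
case: h => [|h]; first by rewrite leNgt ac.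
have [p1 [v [p2 [-> fv hu]]]] := IH a pa ac h.
exists (a :: p1), v, p2; split => // u; rewrite inE => /orP[/eqP ->//|].
exact: hu.
Qed.

End walks.

(** * Lattice geometry *)

Section geometry.
Implicit Types (x y z u v : Z2) (a b c : int).

Definition xc (v : Z2) : int := v 0 0.
Definition yc (v : Z2) : int := v 0 1.

Lemma xcD u v : xc (u + v) = xc u + xc v. Proof. by rewrite /xc mxE. Qed.
Lemma ycD u v : yc (u + v) = yc u + yc v. Proof. by rewrite /yc mxE. Qed.
Lemma xcN u : xc (- u) = - xc u. Proof. by rewrite /xc mxE. Qed.
Lemma ycN u : yc (- u) = - yc u. Proof. by rewrite /yc mxE. Qed.
Lemma xc0 : xc 0 = 0. Proof. by rewrite /xc mxE. Qed.
Lemma yc0 : yc 0 = 0. Proof. by rewrite /yc mxE. Qed.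
Definition coordE := (xcD, ycD, xcN, ycN, xc0, yc0).

Definition pt a b : Z2 := \row_(j < 2) (if j == 0 then a else b).

Lemma pt0 a b : xc (pt a b) = a. Proof. by rewrite /xc mxE. Qed.
Lemma pt1 a b : yc (pt a b) = b. Proof. by rewrite /yc mxE. Qed.

Lemma Z2P x y : xc x = xc y -> yc x = yc y -> x = y.
Proof.
move=> h0 h1; rewrite /xc /yc in h0 h1; apply/rowP => j.
have [->|->] : j = 0 \/ j = 1; last by [].
  by case: j => [[|[|//]] hj]; [left|right]; apply: val_inj.
by [].
Qed.

Lemma pt_eta x : x = pt (xc x) (yc x).
Proof. by apply: Z2P; rewrite ?pt0 ?pt1. Qed.

Lemma adjacentE x y :
  adjacent x y = ((xc x - xc y) ^+ 2 + (yc x - yc y) ^+ 2 == 1).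
Proof.
rewrite /adjacent big_ord_recl big_ord1 /xc /yc; congr (_ + (x 0 _ - y 0 _) ^+ 2 == 1);
  exact: val_inj.
Qed.

Lemma adjacentP x y : reflect
  ((yc y = yc x /\ (xc y = xc x + 1 \/ xc y = xc x - 1)) \/
   (xc y = xc x /\ (yc y = yc x + 1 \/ yc y = yc x - 1))) (adjacent x y).
Proof.
rewrite adjacentE; set p := xc x; set q := yc x; set r := xc y; set s := yc y.
apply: (iffP eqP) => [h|]; last first.
  by move=> [[-> [->|->]]|[-> [->|->]]]; rewrite ?subrr; ring.
have h1 : (p - r) ^+ 2 <= 1 by rewrite -h lerDl sqr_ge0.
have h2 : (q - s) ^+ 2 <= 1 by rewrite -h lerDr sqr_ge0.
have [k1 k1'] : p - r <= 1 /\ -1 <= p - r by split; nia.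
have [k2 k2'] : q - s <= 1 /\ -1 <= q - s by split; nia.
have [e|[e|e]] : p - r = 0 \/ p - r = 1 \/ p - r = -1 by lia.
- right; split; first lia.
  have [e'|[e'|e']] : q - s = 0 \/ q - s = 1 \/ q - s = -1 by lia.
  + by move: h; rewrite e e'.
  + by right; lia.
  + by left; lia.
- have e' : q - s = 0.
    have : (q - s) ^+ 2 = 0 by move: h; rewrite e; lia.
    by move/eqP; rewrite expf_eq0 => /andP[_ /eqP].
  by left; split; [lia|right; lia].
- have e' : q - s = 0.
    have : (q - s) ^+ 2 = 0 by move: h; rewrite e; lia.
    by move/eqP; rewrite expf_eq0 => /andP[_ /eqP].
  by left; split; [lia|left; lia].
Qed.

Definition linf x : int := Num.max `|xc x| `|yc x|.

Lemma linf_le x c : (linf x <= c) = (`|xc x| <= c) && (`|yc x| <= c).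
Proof. by rewrite /linf ge_max. Qed.

Lemma linf_ge0 x : 0 <= linf x.
Proof. by rewrite /linf le_max normr_ge0. Qed.

Lemma linf_adjacent x y z : adjacent y z -> linf (z - x) <= linf (y - x) + 1.
Proof.
move=> /adjacentP h; rewrite linf_le !coordE.
have : `|xc y - xc x| <= linf (y - x) by rewrite /linf !coordE le_max lexx.
have : `|yc y - yc x| <= linf (y - x) by rewrite /linf !coordE le_max lexx orbT.
move: h; move: (linf _) (xc y) (yc y) (xc z) (yc z) (xc x) (yc x).
by move=> L a b c d e f h h1 h2; apply/andP; split; lia.
Qed.

Definition ball_box x c : set Z2 := [set v | linf (v - x) <= c].

Definition rect a b c d : set Z2 :=
  [set v | [/\ a <= xc v, xc v <= b, c <= yc v & yc v <= d]].

Lemma ball_boxE x c : ball_box x c = rect (xc x - c) (xc x + c) (yc x - c) (yc x + c).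
Proof.
apply/seteqP; split => v; rewrite /ball_box /rect /= linf_le !coordE.
  by move=> /andP[h1 h2]; split; lia.
by move=> [h1 h2 h3 h4]; apply/andP; split; lia.
Qed.

Lemma hwalk a b c d x (n : nat) (s : int) : s = 1 \/ s = -1 ->
  rect a b c d x -> rect a b c d (pt (xc x + s * n%:Z) (yc x)) ->
  exists2 p, walks (rect a b c d) x (pt (xc x + s * n%:Z) (yc x)) p & size p = n.
Proof.
move=> s1; elim: n x => [|n IH] x hx hy.
  exists [::] => //; split => //; first by apply: Z2P; rewrite ?pt0 ?pt1 ?mulr0 ?addr0.
  by move=> v; rewrite inE => /eqP ->.
pose x' := pt (xc x + s) (yc x).
move: hx hy; rewrite /rect /= !pt0 !pt1 => -[h1 h2 h3 h4] [h5 h6 _ _].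
have hx' : rect a b c d x' by rewrite /rect /= /x' pt0 pt1; split => //; case: s1 => s1; rewrite s1 in h5 h6 *; lia.
have E : pt (xc x + s * n.+1%:Z) (yc x) = pt (xc x' + s * n%:Z) (yc x').
  by apply: Z2P; rewrite /x' ?pt0 ?pt1//; lia.
have [|p [p1 p2 p3] sp] := IH x' hx'.
  by rewrite /rect /= /x' !pt0 !pt1; split=> //; case: s1 => s1; rewrite s1 in h5 h6 *; lia.
exists (x' :: p); last by rewrite /= sp.
rewrite E; split => //=.
  rewrite p1 andbT; apply/adjacentP; left; rewrite /x' pt0 pt1; split => //.
  by case: s1 => ->; [left|right].
by move=> v; rewrite inE => /orP[/eqP -> |/p3//].
Qed.

Lemma vwalk a b c d x (n : nat) (s : int) : s = 1 \/ s = -1 ->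
  rect a b c d x -> rect a b c d (pt (xc x) (yc x + s * n%:Z)) ->
  exists2 p, walks (rect a b c d) x (pt (xc x) (yc x + s * n%:Z)) p & size p = n.
Proof.
move=> s1; elim: n x => [|n IH] x hx hy.
  exists [::] => //; split => //; first by apply: Z2P; rewrite ?pt0 ?pt1 ?mulr0 ?addr0.
  by move=> v; rewrite inE => /eqP ->.
pose x' := pt (xc x) (yc x + s).
move: hx hy; rewrite /rect /= !pt0 !pt1 => -[h1 h2 h3 h4] [_ _ h5 h6].
have hx' : rect a b c d x' by rewrite /rect /= /x' pt0 pt1; split => //; case: s1 => s1; rewrite s1 in h5 h6 *; lia.
have E : pt (xc x) (yc x + s * n.+1%:Z) = pt (xc x') (yc x' + s * n%:Z).
  by apply: Z2P; rewrite /x' ?pt0 ?pt1//; lia.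
have [|p [p1 p2 p3] sp] := IH x' hx'.
  by rewrite /rect /= /x' !pt0 !pt1; split=> //; case: s1 => s1; rewrite s1 in h5 h6 *; lia.
exists (x' :: p); last by rewrite /= sp.
rewrite E; split => //=.
  rewrite p1 andbT; apply/adjacentP; right; rewrite /x' pt0 pt1; split => //.
  by case: s1 => ->; [left|right].
by move=> v; rewrite inE => /orP[/eqP -> |/p3//].
Qed.

Lemma int_sign a : exists s (n : nat), (s = 1 \/ s = -1) /\ a = s * n%:Z.
Proof.
have [a0|a0] := leP 0 a.
  by exists 1, (absz a); split; [left|lia].
by exists (-1), (absz a); split; [right|lia].
Qed.

Lemma rect_walk a b c d x y : rect a b c d x -> rect a b c d y ->
  walks (rect a b c d) x y !=set0.
Proof.
move=> hx hy.
have [s [n [s1 e1]]] := int_sign (xc y - xc x).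
have [s' [n' [s1' e1']]] := int_sign (yc y - yc x).
have E1 : xc x + s * n%:Z = xc y by lia.
have hz : rect a b c d (pt (xc x + s * n%:Z) (yc x)).
  by move: hx hy => [h1 h2 h3 h4] [h5 h6 h7 h8]; rewrite /rect /= pt0 pt1 E1.
have [p hp _] := hwalk s1 hx hz.
have E2 : pt (xc (pt (xc x + s * n%:Z) (yc x)))
    (yc (pt (xc x + s * n%:Z) (yc x)) + s' * n'%:Z) = y.
  by apply: Z2P; rewrite ?pt0 ?pt1//; lia.
have [|q hq _] := vwalk s1' hz (n := n'); first by rewrite E2.
by exists (p ++ q); apply: walks_cat hp _; rewrite -E2.
Qed.

Lemma ball_walk x c y z : ball_box x c y -> ball_box x c z ->
  walks (ball_box x c) y z !=set0.
Proof. rewrite ball_boxE; exact: rect_walk. Qed.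

Lemma setT_walk x y : walks setT x y !=set0.
Proof.
pose c := linf (y - x).
have [p hp] : walks (ball_box x c) x y !=set0.
  by apply: ball_walk; rewrite /ball_box /= ?lexx// subrr linf_le !coordE normr0 linf_ge0.
by exists p; exact: walksS hp.
Qed.

Definition isom (phi : Z2 -> Z2) := (forall u v, adjacent (phi u) (phi v) = adjacent u v) /\
  exists2 psi, cancel phi psi & cancel psi phi.

Lemma isom_shift u : isom (fun v => v + u).
Proof.
split; last by exists (fun v => v - u) => v; rewrite ?addrK ?subrK.
by move=> a b; rewrite !adjacentE !coordE; congr (_ ^+ 2 + _ ^+ 2 == 1); ring.
Qed.

Lemma isom_opp u : isom (fun v => u - v).
Proof.
split; last by exists (fun v => u - v) => v; rewrite subKr.
move=> a b; rewrite !adjacentE !coordE; congr (_ == 1).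
by move: (xc u) (yc u) (xc a) (yc a) (xc b) (yc b) => *; ring.
Qed.

Lemma isom_flip0 (c : int) : isom (fun v => pt (c - xc v) (yc v)).
Proof.
split.
  move=> a b; rewrite !adjacentE !pt0 !pt1; congr (_ == 1).
  by move: (xc a) (yc a) (xc b) (yc b) => *; ring.
exists (fun v => pt (c - xc v) (yc v)) => v;
  by apply: Z2P; rewrite !pt0 ?pt1//; lia.
Qed.

End geometry.

(** * Measurability and law of passage times *)

Section random_ptime.
Variable R : realType.
Notation W := (weights R {fset Z2}).
Implicit Types (V : set Z2) (w : W) (x y z v : Z2) (p : seq Z2).

Definition inner_edges V : set {fset Z2} :=
  [set e | exists a b, [/\ V a, V b, adjacent a b & e = [fset a; b]%fset]].

Definition edge_set x p : {fset {fset Z2}} := [fset e in path_edges x p]%fset.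

Lemma edge_set_inner V x y p : walks V x y p -> [set` edge_set x p] `<=` inner_edges V.
Proof.
move=> [+ _]; elim: p x => [|a p IH] x /=; first by move=> _ _ e; rewrite /= !inE.
move=> /andP[xa pa] hV e; rewrite /= !inE => /orP[/eqP ->|he].
  by exists x, a; split => //; apply: hV; rewrite !inE eqxx ?orbT.
apply: (IH a pa) => [v va|]; first by apply: hV; rewrite inE va orbT.
by rewrite /= !inE.
Qed.

Definition wpos w : W := fun e => Num.max (w e) 0.

Lemma wpos_ge0 w e : 0 <= wpos w e.
Proof. by rewrite /wpos le_max lexx orbT. Qed.

Lemma wpos_id w : (forall e, 0 <= w e) -> wpos w = w.
Proof. by move=> w0; apply/funext => e; exact/max_idPl. Qed.

Lemma measurable_wpos : measurable_fun setT wpos.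
Proof.
by apply: measurable_weights => e; apply: measurable_maxr => //; exact: measurable_coord.
Qed.

(** Loop removal reduces the infimum to self-avoiding walks, whose times are sums over edge sets,
    and finite sequences of lattice points are countable. This is the countable family that
    [lower_tail] and [mgf] take as [Ks]. *)
Lemma saw_enumeration V x y : walks V x y !=set0 ->
  exists Ks : nat -> {fset {fset Z2}}, [/\ forall k, [set` Ks k] `<=` inner_edges V,
    forall w k, (forall e, 0 <= w e) -> ptime V w x y <= \sum_(e <- Ks k) w e &
    forall w eps, (forall e, 0 <= w e) -> 0 < eps ->
      exists k, \sum_(e <- Ks k) w e <= ptime V w x y + eps].
Proof.
move=> ne; have [p0 hp0] := ne.
have [q0 [hq0 uq0 _ _]] := @loop_removal R _ _ _ _ hp0.
pose good p := walks V x y p /\ uniq (x :: p).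
have gq0 : good q0 by [].
have [f [fgood fsurj]] : exists f : nat -> seq Z2,
    (forall k, good (f k)) /\ (forall p, good p -> exists k, f k = p).
  (* Codes that do not decode to an admissible walk are sent to the default [q0]. *)
  exists (fun k => if choice.unpickle k is Some p then if pselect (good p) then p else q0 else q0).
  split=> [k|p gp].
    by case: (choice.unpickle k) => [p|]; [case: pselect|].
  exists (choice.pickle (p : seq 'rV[int]_2)); rewrite choice.pickleK.
  by case: pselect.
exists (fun k => edge_set x (f k)); split.
- by move=> k; have [h _] := fgood k; exact: edge_set_inner h.
- move=> w k w0; have [h u] := fgood k.
  by rewrite -path_time_fset//; exact: ptime_le.
- move=> w eps w0 e0; have [p hp lt] := ptime_approx w0 ne e0.
  have [q [hq uq _ le]] := @loop_removal R _ _ _ _ hp.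
  have [k fk] := fsurj q (conj hq uq).
  exists k; rewrite fk -path_time_fset//; apply: le_trans (le w w0) _.
  exact: ltW.
Qed.

(** Taking positive parts keeps the infimum bounded below at every configuration, which makes it a
    measurable function on the whole weight space. *)
Definition ptimep V x y w : R := ptime V (wpos w) x y.

Lemma ptimep_ge0 V x y w : 0 <= ptimep V x y w.
Proof. exact: ptime_ge0 (wpos_ge0 w). Qed.

Lemma measurable_ptimep V x y : measurable_fun setT (ptimep V x y).
Proof.
have [ne|ne] := pselect (walks V x y !=set0); last first.
  rewrite (_ : ptimep V x y = fun=> 0); first exact: measurable_cst.
  apply/funext => w; rewrite /ptimep /ptime.
  rewrite (_ : [set _ | _ in _] = set0) ?inf0//.
  by apply/seteqP; split => // t [p hp _]; apply: ne; exists p.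
have [Ks [_ h1 h2]] := saw_enumeration ne.
pose h k w : R := \sum_(e <- Ks k) wpos w e.
have mh k : measurable_fun setT (h k).
  apply: measurable_sum => e.
  exact: (measurableT_comp (measurable_coord e) measurable_wpos).
have lb w : setT w -> has_lbound (range (h ^~ w)).
  move=> _; exists 0 => _ [k _ <-]; apply: sumr_ge0 => e _; exact: wpos_ge0.
have := @measurable_fun_infs _ _ _ setT h 0 lb mh.
rewrite (_ : (fun w => infs _ _) = ptimep V x y) //.
apply/funext => w; rewrite /infs; apply/eqP; rewrite eq_le; apply/andP; split.
  apply/ler_addgt0Pr => eps e0; have [k hk] := h2 (wpos w) eps (wpos_ge0 w) e0.
  apply: le_trans hk; apply: ge_inf; last by exists k.
  by have [c hc] := lb w I; exists c => _ [j _ <-]; apply: hc; exists j.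
apply: lb_le_inf; first by exists (h 0 w), 0.
by move=> _ [k _ <-]; apply: h1; exact: wpos_ge0.
Qed.

Lemma path_time_inner V x y p w w' : walks V x y p ->
  (forall e, inner_edges V e -> w e = w' e) -> path_time w x p = path_time w' x p.
Proof.
move=> hp ww'; apply: eq_big_seq => e he; apply: ww'.
by apply: (edge_set_inner hp); rewrite /= !inE.
Qed.

Lemma ptime_inner V x y (w w' : {fset Z2} -> R) :
  (forall e, inner_edges V e -> w e = w' e) -> ptime V w x y = ptime V w' x y.
Proof.
move=> ww'; congr inf; apply/seteqP; split => _ [p hp <-]; exists p => //.
  by rewrite (path_time_inner hp ww').
by rewrite (path_time_inner hp ww').
Qed.

Lemma depends_ptimep V x y : depends_on (inner_edges V) (ptimep V x y).
Proof. by move=> w w' ww'; apply: ptime_inner => e he; rewrite /wpos ww'. Qed.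

Section iid_ptime.
Context d (O : measurableType d) (P : probability O R).
Variables (F : set {fset Z2}) (Y : O -> W).
Hypothesis iY : iid P F Y.

Lemma iid_ge0 o e : 0 <= Y o e. Proof. by case: iY. Qed.

Lemma ptimepE V x y o : ptimep V x y (Y o) = ptime V (Y o) x y.
Proof. by rewrite /ptimep wpos_id//; exact: iid_ge0. Qed.

Lemma measurable_ptime V x y : measurable_fun setT (fun o => ptime V (Y o) x y).
Proof.
rewrite (_ : (fun o => _) = ptimep V x y \o Y).
  by case: iY => mY _ _; exact: (measurableT_comp (measurable_ptimep V x y) mY).
by apply/funext => o; rewrite /= ptimepE.
Qed.

Lemma ptime_lower_tail V x y (th h c : R) : inner_edges V `<=` F ->
  walks V x y !=set0 -> 0 < th -> (h%:E <= Ex P (fun o => ptime V (Y o) x y))%E ->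
  (P [set o | (ptime V (Y o) x y <= c)%R] <= (expR (th * c - th / (1 + th) * h))%:E)%E.
Proof.
move=> VF ne th0 hT; have [Ks [h1 h2 h3]] := saw_enumeration ne.
apply: (@lower_tail _ _ _ _ P F Y (fun o => ptime V (Y o) x y) Ks) => //.
- by move=> k; apply: subset_trans (h1 k) VF.
- exact: measurable_ptime.
- by move=> o; apply: ptime_ge0; exact: iid_ge0.
- by move=> o k; apply: h2; exact: iid_ge0.
- by move=> o e e0; apply: h3 => //; exact: iid_ge0.
Qed.

Lemma ptime_mgf V x y (th h : R) : inner_edges V `<=` F ->
  walks V x y !=set0 -> 0 < th -> (h%:E <= Ex P (fun o => ptime V (Y o) x y))%E ->
  E P (fun o => expR (- th * ptime V (Y o) x y)) <= expR (- (th / (1 + th)) * h).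
Proof.
move=> VF ne th0 hT; have [Ks [h1 h2 h3]] := saw_enumeration ne.
apply: (@mgf _ _ _ _ P F Y (fun o => ptime V (Y o) x y) Ks) => //.
- by move=> k; apply: subset_trans (h1 k) VF.
- exact: measurable_ptime.
- by move=> o; apply: ptime_ge0; exact: iid_ge0.
- by move=> o k; apply: h2; exact: iid_ge0.
- by move=> o e e0; apply: h3 => //; exact: iid_ge0.
Qed.

End iid_ptime.

Lemma iid_law d d' (O1 : measurableType d) (O2 : measurableType d')
    (P1 : probability O1 R) (P2 : probability O2 R) (F : set {fset Z2})
    (Y1 : O1 -> W) (Y2 : O2 -> W) (B : set W) :
  iid P1 F Y1 -> iid P2 F Y2 -> measurable B -> depends_on F (fun w => w \in B) ->
  P1 [set o | B (Y1 o)] = P2 [set o | B (Y2 o)].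
Proof.
move=> i1 i2 mB BF.
have H d0 (O0 : measurableType d0) (P0 : probability O0 R) (Y0 : O0 -> W) :
    iid P0 F Y0 -> P0 [set o | B (Y0 o)] = (\int[P0]_o (\1_B (Y0 o))%:E)%E.
  move=> [mY _ _]; rewrite -Ex_indic//.
  by rewrite -[X in measurable X]setTI; exact: mY.
rewrite !H//; apply: (iid_transfer (f := fun w : W => (\1_B w : R)%:E) i1 i2).
- by apply/measurable_EFinP; exact: measurable_indic.
- by move=> w; rewrite lee_fin.
- by move=> w w' ww'; rewrite !indicE (BF w w').
Qed.

Lemma iid_Ex_ptime d d' (O1 : measurableType d) (O2 : measurableType d')
    (P1 : probability O1 R) (P2 : probability O2 R) (F : set {fset Z2})
    (Y1 : O1 -> W) (Y2 : O2 -> W) V x y :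
  iid P1 F Y1 -> iid P2 F Y2 -> inner_edges V `<=` F ->
  Ex P1 (fun o => ptime V (Y1 o) x y) = Ex P2 (fun o => ptime V (Y2 o) x y).
Proof.
move=> i1 i2 VF.
have m : measurable_fun setT (fun w => (ptimep V x y w)%:E).
  by apply/measurable_EFinP; exact: measurable_ptimep.
have h0 w : (0 <= (ptimep V x y w)%:E)%E by rewrite lee_fin; exact: ptimep_ge0.
have D : depends_on F (fun w => (ptimep V x y w)%:E).
  by move=> w w' ww'; congr EFin; apply: depends_ptimep => e /VF; exact: ww'.
have := iid_transfer i1 i2 m h0 D.
congr (_ = _); apply: eq_integral => o _; congr EFin.
  exact: (ptimepE i1).
exact: (ptimepE i2).
Qed.

Lemma imfset_inj (phi psi : Z2 -> Z2) : cancel phi psi ->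
  injective (fun e : {fset Z2} => [fset phi v | v in e]%fset).
Proof.
move=> c e e' h; apply/fsetP => v.
have H (s : {fset Z2}) : (v \in s) = (phi v \in [fset phi u | u in s]%fset).
  apply/idP/imfsetP => [vs|[u us /(can_inj c) ->]//].
  by exists v.
by rewrite !H h.
Qed.

Lemma edges_map phi e : (forall u v, adjacent (phi u) (phi v) = adjacent u v) ->
  edges e -> edges [fset phi v | v in e]%fset.
Proof.
move=> adj [a [b [ab ->]]]; exists (phi a), (phi b); split; first by rewrite adj.
exact: imfset_pair.
Qed.

Lemma iid_map d (O : measurableType d) (P : probability O R) (Y : O -> W) phi :
  iid P edges Y -> isom phi -> iid P edges (fun o => map_weight phi (Y o) : W).
Proof.
move=> iY [adj [psi c1 c2]].
refine (@iid_comp R _ _ _ _ P edges edges Y (fun e => [fset phi v | v in e]%fset) iY _ _).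
  by move=> e; exact: edges_map.
by move=> e e' _ _; exact: imfset_inj c1 e e'.
Qed.

Lemma inner_edges_sub V : inner_edges V `<=` edges.
Proof. by move=> e [a [b [_ _ ab ->]]]; exists a, b. Qed.

End random_ptime.

(** * Jensen's inequality for unbounded variables *)

Section jensen.
Context d (O : measurableType d) (R : realType) (P : probability O R).

(** The tangent argument of [jensen_expR], for an unbounded [f] of finite mean. *)
Lemma jensen_expN (c m : R) (f : O -> R) : 0 <= c -> measurable_fun setT f ->
  (forall o, 0 <= f o) -> Ex P f = m%:E ->
  ((expR (- c * m))%:E <= Ex P (fun o => expR (- c * f o)%R))%E.
Proof.
move=> c0 mf f0 fm.
have m0 : 0 <= m by rewrite -lee_fin -fm; exact: Ex_ge0.
set e := expR _; have e0 : 0 <= e by exact: expR_ge0.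
have mcf : measurable_fun setT (fun o => c * f o) by exact: measurable_funM.
have mE := measurable_expRM (- c) mf.
have H : (Ex P (fun=> (e * (1 + c * m))%R) <=
    Ex P (fun o => (expR (- c * f o) + e * (c * f o))%R))%E.
  apply: le_Ex => //.
  - by apply: measurable_funD => //; exact: measurable_funM.
  - by move=> o; rewrite mulr_ge0// addr_ge0// mulr_ge0.
  - move=> o; have := expR_ge1Dx (- c * f o + c * m).
    rewrite -(ler_pM2l (expR_gt0 (- c * m))) -expRD.
    rewrite (_ : - c * m + (- c * f o + c * m) = - c * f o); last by ring.
    rewrite -/e => h; rewrite -lerBlDr; apply: le_trans h.
    by rewrite le_eqVlt; apply/orP; left; apply/eqP; ring.
move: H; rewrite Ex_cst (ExD P mE); last 3 first.
- exact: measurable_funM.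
- by move=> o; exact: expR_ge0.
- by move=> o; rewrite !mulr_ge0.
rewrite (ExZl P mcf e0); last by move=> o; rewrite mulr_ge0.
rewrite (ExZl P mf c0 f0) fm => H.
have {}H : ((e * (1 + c * m))%:E <= Ex P (fun o => expR (- c * f o)%R) + (e * (c * m))%:E)%E.
  exact: H.
rewrite -(leeD2rE (x := (e * (c * m))%:E))//; apply: le_trans H.
by rewrite -EFinD lee_fin mulrDr mulr1.
Qed.

End jensen.

Section exp1_mean.
Variable R : realType.

Lemma exp1_mean : (Ex (exp1 R) (fun s => Num.max s 0%R) <= 1)%E.
Proof.
have mmax : @measurable_fun _ _ (measurableTypeR R) (measurableTypeR R) setT
  (fun s => Num.max s 0) by exact: measurable_maxr0.
have mk (k : nat) : measurable_fun setT
    (fun s : measurableTypeR R => (Num.min (Num.max s 0) k%:R : R)%:E).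
  by apply/measurable_EFinP; apply: measurable_minr.
have k0 (k : nat) (s : R) : (0 <= (Num.min (Num.max s 0) k%:R : R)%:E)%E.
  by rewrite lee_fin le_min ler0n le_max lexx orbT.
have nd (s : R) : {homo (fun k => (Num.min (Num.max s 0) k%:R : R)%:E) :
    n m / (n <= m)%N >-> (n <= m)%E}.
  by move=> n m nm; rewrite lee_fin; apply: le_min2 => //; rewrite ler_nat.
have MC := @monotone_convergence _ _ _ (exp1 R) setT measurableT _ mk
  (fun k o _ => k0 k o) (fun o _ => nd o).
have limT (s : R) : limn (fun k => (Num.min (Num.max s 0) k%:R : R)%:E) = (Num.max s 0)%:E.
  apply: cvg_lim => //; apply: cvg_near_cst; near=> k.
  by rewrite (min_idPl _)//; near: k; exact: nbhs_infty_ger.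
rewrite /Ex; under eq_integral do rewrite -limT.
rewrite MC; apply: lime_le.
  apply: ereal_nondecreasing_is_cvgn => n m nm.
  apply: (@ge0_le_integral _ (measurableTypeR R) R (exp1 R) setT measurableT).
  - by move=> s _; exact: k0.
  - exact: mk.
  - exact: mk.
  - by move=> s _; exact: nd.
apply: nearW => k; rewrite exp1_mean_min// lee_fin gerBl; exact: expR_ge0.
Unshelve. all: end_near. Qed.

End exp1_mean.

(** * Mean passage times in the plane *)

Section ground.
Variable R : realType.
Notation W := (weights R {fset Z2}).
Context d (O : measurableType d) (P : probability O R).
Variable Y : O -> W.
Hypothesis iY : iid P edges Y.
Implicit Types (x y z u v : Z2) (V : set Z2).

Let Y0 o e : 0 <= Y o e. Proof. exact: (iid_ge0 iY). Qed.
Let mY : measurable_fun setT Y. Proof. by case: iY. Qed.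

Notation tau x y := (fun o => ptime setT (Y o) x y).

Let mtau x y : measurable_fun setT (tau x y).
Proof. exact: (measurable_ptime iY). Qed.

Let tau0 x y o : 0 <= ptime setT (Y o) x y.
Proof. exact: ptime_ge0. Qed.

Lemma mean_weight e : edges e -> (Ex P (fun o => Y o e) <= 1)%E.
Proof.
move=> he; rewrite /Ex.
have mf : measurable_fun setT (fun w : W => (Num.max (w e) 0)%:E).
  by apply/measurable_EFinP; apply: measurable_maxr => //; exact: measurable_coord.
have f0 (w : W) : (0 <= (Num.max (w e) 0)%:E)%E by rewrite lee_fin le_max lexx orbT.
have fF : depends_on edges (fun w : W => (Num.max (w e) 0)%:E) by move=> w w' ->.
have := iid_resample iY he mf f0 fF.
under eq_integral do rewrite (max_idPl (Y0 _ _)).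
move=> ->; under eq_integral => o _.
  under eq_integral => s _.
    rewrite /upd eqxx (max_idPl (_ : 0 <= Num.max s 0)); last by rewrite le_max lexx orbT.
    over.
  over.
rewrite integral_cst//= [X in (_ * X)%E]probability_setT mule1.
exact: exp1_mean.
Qed.

Lemma mean_path_time V x y p : walks V x y p ->
  (Ex P (fun o => path_time (Y o) x p) <= (size p)%:R%:E)%E.
Proof.
move=> hp; have hE : forall e, e \in path_edges x p -> edges e.
  by move=> e he; apply: (@inner_edges_sub V); apply: (edge_set_inner hp); rewrite /= !inE.
rewrite -(size_pairmap (fun a b => [fset a; b]%fset) x p) /path_time -/(path_edges x p).
elim: (path_edges x p) hE => [|e s IH] hE.
  rewrite (_ : (fun o => _) = fun=> 0) ?Ex_cst//.
  by apply/funext => o; rewrite big_nil.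
rewrite (_ : (fun o => _) = fun o => Y o e + \sum_(i <- s) Y o i); last first.
  by apply/funext => o; rewrite big_cons.
rewrite ExD//=.
- rewrite -natr1 [(_%:R + 1)%R]addrC EFinD; apply: leeD; first by apply: mean_weight; apply: hE; exact: mem_head.
  by apply: IH => e' he'; apply: hE; rewrite inE he' orbT.
- exact: (measurableT_comp (measurable_coord e) mY).
- by apply: measurable_sum => i; exact: (measurableT_comp (measurable_coord i) mY).
- by move=> o; apply: sumr_ge0 => i _.
Qed.

Definition h x := E P (tau 0 x).

Lemma Ex_tau_fin x y : Ex P (tau x y) = (E P (tau x y))%:E.
Proof.
rewrite /E fineK// fin_numE gt_eqF ?(lt_le_trans _ (Ex_ge0 P (tau0 x y)))//.
have [p hp] := setT_walk x y.
rewrite lt_eqF// (@le_lt_trans _ _ (size p)%:R%:E)// ?ltry//.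
apply: le_trans (mean_path_time hp); apply: le_Ex => //.
  by apply: measurable_sum => i; exact: (measurableT_comp (measurable_coord i) mY).
by move=> o; exact: ptime_le.
Qed.

Lemma Ex_tau_isom phi x y : isom phi -> Ex P (tau (phi x) (phi y)) = Ex P (tau x y).
Proof.
move=> iphi; have [adj [psi c1 c2]] := iphi.
have sub : inner_edges setT `<=` edges by exact: inner_edges_sub.
rewrite [RHS](iid_Ex_ptime x y iY (iid_map iY iphi) sub).
congr Ex; apply/funext => o.
by rewrite (@ptime_map _ phi psi setT setT).
Qed.

Lemma Ex_tau x y : Ex P (tau x y) = (h (y - x))%:E.
Proof.
rewrite /h -Ex_tau_fin -(Ex_tau_isom 0 (y - x) (isom_shift x)).
by rewrite add0r subrK.
Qed.

Lemma h_isom phi x : isom phi -> h (phi x - phi 0) = h x.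
Proof.
move=> ip; apply: EFin_inj; rewrite -Ex_tau (Ex_tau_isom 0 x ip) Ex_tau.
by rewrite subr0.
Qed.

Lemma h_ge0 x : 0 <= h x.
Proof.
have B := Ex_tau 0 x; rewrite subr0 in B.
by rewrite -lee_fin -B; apply: Ex_ge0.
Qed.

Lemma h_subadd x y : h (x + y) <= h x + h y.
Proof.
have A := Ex_tau 0 (x + y); have B := Ex_tau 0 x; have C := Ex_tau x (x + y).
rewrite subr0 in A; rewrite subr0 in B; rewrite [x + y - x]addrAC subrr add0r in C.
rewrite -lee_fin EFinD -A -B -C -ExD//.
apply: le_Ex => //; first exact: measurable_funD.
by move=> o; apply: ptime_triangle => //; exact: setT_walk.
Qed.

Lemma h_mulrn x (n : nat) : (0 < n)%N -> h (x *+ n) <= n%:R * h x.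
Proof.
case: n => // n _; elim: n => [|n IH]; first by rewrite mulr1n mul1r.
rewrite mulrSr -natr1 mulrDl mul1r; apply: le_trans (h_subadd _ _) _.
by rewrite lerD2r.
Qed.

Lemma h_adjacent x y : adjacent x y -> h (y - x) <= 1.
Proof.
move=> xy; rewrite -lee_fin -Ex_tau.
have hp : walks setT x y [:: y] by split => //=; rewrite xy.
apply: le_trans (mean_path_time hp); apply: le_Ex => //.
  by apply: measurable_sum => i; exact: (measurableT_comp (measurable_coord i) mY).
by move=> o; exact: ptime_le.
Qed.

End ground.

(** * Mean passage times against the time constant *)

Section time_constant.
Variable R : realType.
Notation W := (weights R {fset Z2}).
Context d (O : measurableType d) (P : probability O R).
Variable Y : O -> W.
Hypothesis iY : iid P edges Y.
Implicit Types (x y z u v : Z2) (V : set Z2).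
Variable G : Z2 -> R.
Hypothesis Glim : forall x, {ae P, forall o,
  (fun m : nat => ptime setT (Y o) 0 (x *+ m) / m%:R) @ \oo --> G x}.

Let Y0 o e : 0 <= Y o e. Proof. exact: (iid_ge0 iY). Qed.

Notation tau x y := (fun o => ptime setT (Y o) x y).
Notation h := (h P Y).

Let mtau x y : measurable_fun setT (tau x y).
Proof. exact: (measurable_ptime iY). Qed.

Let tau0 x y o : 0 <= ptime setT (Y o) x y.
Proof. exact: ptime_ge0. Qed.

(** The Laplace transform at [1 / m] is bounded by 1, so the almost sure limit of [T / m] passes to
    it by dominated convergence. It links [G] to the means [h] through Jensen on one side and
    [ptime_mgf] on the other. *)
Definition lap x (m : nat) : R := E P (fun o => expR (- m%:R^-1 * ptime setT (Y o) 0 (x *+ m))).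

Lemma bounded_lap x (c : R) : 0 <= c -> bounded_mf 1 (fun o => expR (- c * ptime setT (Y o) 0 x)).
Proof.
move=> c0; split; first exact: (measurable_expRM (- c) (mtau 0 x)).
move=> o; rewrite expR_ge0 -expR0 ler_expR mulNr oppr_le0.
by rewrite mulr_ge0.
Qed.

Lemma lap_cvg x : lap x @ \oo --> expR (- G x).
Proof.
have V0 (m : nat) : 0 <= m%:R^-1 :> R by rewrite invr_ge0.
pose f_ (m : nat) o : \bar R := (expR (- m%:R^-1 * ptime setT (Y o) 0 (x *+ m)))%:E.
have mf m : measurable_fun setT (f_ m).
  by apply/measurable_EFinP; case: (bounded_lap (x *+ m) (V0 m)).
have E1 : (\int[P]_(o in setT) (expR (- G x))%:E)%E = (expR (- G x))%:E.
  exact: (Ex_cst P (expR (- G x))).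
have L m : (\int[P]_(o in setT) f_ m o)%E = (lap x m)%:E.
  exact: (EK P (bounded_lap (x *+ m) (V0 m))).
have H1 : {ae P, forall o, setT o -> f_ ^~ o @ \oo --> (expR (- G x))%:E}.
  have := Glim x; apply: filterS => o Ho _.
  apply: cvg_EFin; first by apply: nearW.
  have -> : fine \o f_ ^~ o = fun m : nat => expR (- (ptime setT (Y o) 0 (x *+ m) / m%:R)).
    by apply/funext => m; rewrite /f_ /= mulNr mulrC.
  have HN : (fun m : nat => - (ptime setT (Y o) 0 (x *+ m) / m%:R)) @ \oo --> - G x.
    exact: cvgN.
  exact: (cvg_comp _ _ HN (@continuous_expR R (- G x))).
have H2 : P.-integrable setT (fun=> 1%E : \bar R).
  exact: (finite_measure_integrable_cst P 1).
have H3 : {ae P, forall o (n : nat), setT o -> (`|f_ n o| <= 1)%E}.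
  apply: aeW => o n _; rewrite /f_ abse_EFin lee_fin.
  case: (bounded_lap (x *+ n) (V0 n)) => _ /(_ o) /andP[a b].
  by rewrite ger0_norm.
have [_ _] := @dominated_convergence _ _ _ P setT measurableT f_
  (fun=> (expR (- G x))%:E) (fun=> 1%E) mf (measurable_cst _) H1 H2 H3.
rewrite E1 => H.
have H' : (fun m => (lap x m)%:E) @ \oo --> (expR (- G x))%:E.
  by rewrite (_ : (fun m => _) = (fun m => \int[P]_(o in setT) f_ m o)%E)//; apply/funext => m; rewrite L.
by move/fine_cvgP : H' => [_].
Qed.

(** Jensen and subadditivity bound [lap x m] below by [expR (- h x)], while it tends to
    [expR (- G x)]. *)
Lemma G_le_h x : G x <= h x.
Proof.
have V0 (m : nat) : 0 <= m%:R^-1 :> R by rewrite invr_ge0.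
rewrite -lerN2 -ler_expR; have cL : expR (- G x) = limn (lap x) by apply/esym/cvg_lim => //; exact: lap_cvg.
rewrite cL; apply: limr_ge; first by apply/cvg_ex; exists (expR (- G x)); exact: lap_cvg.
near=> m.
have m0 : (0 < m)%N by near: m; exact: nbhs_infty_gt.
rewrite -lee_fin -(EK P (bounded_lap (x *+ m) (V0 m))).
have B := Ex_tau iY 0 (x *+ m); rewrite subr0 in B.
apply: le_trans (jensen_expN (V0 m) (mtau 0 (x *+ m)) (tau0 0 (x *+ m)) B).
rewrite lee_fin ler_expR mulNr lerN2 ler_pdivrMl ?ltr0n//.
exact: h_mulrn.
Unshelve. all: end_near. Qed.

(** [ptime_mgf] at rate [1 / m] bounds [lap x m] above by [expR (- h (x *+ m) / (m + 1))]; a larger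
    mean would push [lap] below its limit. *)
Lemma h_near x (k : R) : 0 < k -> \forall m \near \oo, h (x *+ m) < m%:R * (G x + k).
Proof.
move=> k0; have V0 (m : nat) : 0 <= m%:R^-1 :> R by rewrite invr_ge0.
have lt : expR (- (G x + k / 2)) < expR (- G x).
  by rewrite ltr_expR ltrN2 ltrDl divr_gt0.
have H := @lap_cvg x.
near=> m.
have m0 : (0 < m)%N by near: m; exact: nbhs_infty_gt.
have m0' : 0 < m%:R :> R by rewrite ltr0n.
have lm : expR (- (G x + k / 2)) < lap x m.
  by near: m; exact: (cvgr_gt _ H).
have B := Ex_tau iY 0 (x *+ m); rewrite subr0 in B.
have sub : inner_edges setT `<=` edges by exact: inner_edges_sub.
have V1 : 0 < m%:R^-1 :> R by rewrite invr_gt0.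
have hB : ((h (x *+ m))%:E <= Ex P (fun o => ptime setT (Y o) 0%R (x *+ m)%R))%E by rewrite B.
have := ptime_mgf iY sub (setT_walk 0 (x *+ m)) V1 hB => h1.
have := lt_le_trans lm h1; rewrite ltr_expR mulNr ltrN2.
rewrite (_ : m%:R^-1 / (1 + m%:R^-1) = (m%:R + 1)^-1 :> R); last first.
  by field; rewrite !gt_eqF ?addr_gt0.
rewrite ltr_pdivrMl ?addr_gt0// => h2; apply: lt_le_trans h2 _.
(* The bound so far is [(m + 1) * (G x + k / 2)]; for large [m] the extra summand [G x + k / 2] is
   at most [m * (k / 2)]. *)
have hm : `|G x + k / 2| * (2 / k) <= m%:R by near: m; exact: nbhs_infty_ger.
have hm' : `|G x + k / 2| <= m%:R * (k / 2).
  by rewrite -ler_pdivrMr ?divr_gt0// invf_div.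
rewrite mulrDl mul1r mulrDr; move: hm'; rewrite ler_norml => /andP[_ h3].
nra.
Unshelve. all: end_near. Qed.

End time_constant.

(** * Reflection invariance of the time constant *)

Section flip.
Variable R : realType.
Notation W := (weights R {fset Z2}).
Context d (O : measurableType d) (P : probability O R).
Variable Y : O -> W.
Hypothesis iY : iid P edges Y.
Variable G : Z2 -> R.
Hypothesis Glim : forall x, {ae P, forall o,
  (fun m : nat => ptime setT (Y o) 0 (x *+ m) / m%:R) @ \oo --> G x}.

Lemma lap_isom phi x m : isom phi -> phi 0 = 0 -> phi (x *+ m) = phi x *+ m ->
  lap P Y (phi x) m = lap P Y x m.
Proof.
move=> ip p0 pm.
pose f (w : W) : \bar R := (expR (- m%:R^-1 * ptimep setT 0 (x *+ m) w))%:E.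
have iY' := iid_map iY ip.
have mf : measurable_fun setT f.
  by apply/measurable_EFinP; apply: measurable_expRM; exact: measurable_ptimep.
have df : depends_on edges f.
  move=> w w' H; rewrite /f; congr (expR (_ * _))%:E; apply: depends_ptimep => e he.
  by apply: H; exact: (@inner_edges_sub setT).
have f0 w : (0 <= f w)%E by rewrite lee_fin expR_ge0.
have T := iid_transfer iY iY' mf f0 df.
case: (ip) => a [psi K1 K2].
have e1 o : f (Y o) = (expR (- m%:R^-1 * ptime setT (Y o) 0 (x *+ m)))%:E.
  by rewrite /f (ptimepE iY).
have e2 o : f (map_weight phi (Y o)) = (expR (- m%:R^-1 * ptime setT (Y o) 0 (phi x *+ m)))%:E.
  rewrite /f (ptimepE iY').
  have -> : ptime setT (map_weight phi (Y o)) 0 (x *+ m) =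
            ptime setT (Y o) (phi 0) (phi (x *+ m)).
    exact: (@ptime_map R phi psi setT setT (Y o) 0 (x *+ m) a K1 K2 (fun=> iff_refl True)).
  by rewrite p0 pm.
have E1 : (\int[P]_o f (Y o))%E = Ex P (fun o => expR (- m%:R^-1 * ptime setT (Y o) 0 (x *+ m))).
  by apply: eq_integral => o _; rewrite e1.
have E2 : (\int[P]_o f (map_weight phi (Y o)))%E = Ex P (fun o => expR (- m%:R^-1 * ptime setT (Y o) 0 (phi x *+ m))).
  by apply: eq_integral => o _; rewrite e2.
exact: (congr1 fine (etrans (esym E2) (etrans (esym T) E1))).
Qed.

Lemma flip_mulrn x m : pt (0 - xc (x *+ m)) (yc (x *+ m)) = pt (0 - xc x) (yc x) *+ m.
Proof.
elim: m => [|m ih]; first by apply: Z2P; rewrite !mulr0n ?pt0 ?pt1 !coordE.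
by rewrite !mulrS -ih; apply: Z2P; rewrite !coordE ?pt0 ?pt1 ?coordE//; ring.
Qed.

(** Reflections preserve the law of the weights, hence the transforms [lap], whose limits determine
    [G]. *)
Lemma G_flip a b : G (pt (- a) b) = G (pt a b).
Proof.
have ip := isom_flip0 0.
have e m : lap P Y (pt (- a) b) m = lap P Y (pt a b) m.
  pose phi (v : Z2) := pt (0 - xc v) (yc v).
  have p0 : phi 0 = 0 by apply: Z2P; rewrite ?pt0 ?pt1 !coordE ?subr0.
  have := @lap_isom phi (pt a b) m ip p0 (flip_mulrn (pt a b) m).
  by rewrite /phi pt0 pt1 sub0r.
have H1 := @lap_cvg _ _ _ _ _ iY _ Glim (pt (- a) b).
have H2 := @lap_cvg _ _ _ _ _ iY _ Glim (pt a b).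
have E : lap P Y (pt (- a) b) = lap P Y (pt a b) by apply/funext.
rewrite E in H1.
have l1 := cvg_lim (@Rhausdorff R) H1; have l2 := cvg_lim (@Rhausdorff R) H2.
by apply: oppr_inj; apply: expR_inj; rewrite -l1 -l2.
Qed.
End flip.

(** The algebraic properties of the norm at lattice points. The limit defining [G] and the curvature
    are separate hypotheses. *)
Record lattice_norm (R : realType) (G : Z2 -> R) : Prop := LatticeNorm {
  g_opp : forall x, G (- x) = G x;
  g_mulrn : forall x n, G (x *+ n) = n%:R * G x;
  g_add : forall x y, G (x + y) <= G x + G y;
  g_e1 : 0 < G (pt 1 0);
  g_e2 : 0 < G (pt 0 1);
  g_flip : forall a b, G (pt (- a) b) = G (pt a b) }.

(** * Consequences of symmetry for the norm *)

Section norm_geometry.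
Variables (R : realType) (G : Z2 -> R).
Hypothesis hG : lattice_norm G.

Lemma ln_flip1 a b : G (pt a (- b)) = G (pt a b).
Proof.
rewrite -(g_opp hG) -(g_flip hG a b); congr G.
by apply: Z2P; rewrite !coordE ?pt0 ?pt1 ?opprK.
Qed.

Lemma ln_axis (e : Z2) (a : int) : G (e *~ a) = `|a|%:~R * G e.
Proof.
case: a => n; first by rewrite -pmulrn (g_mulrn hG).
by rewrite NegzE mulrNz (g_opp hG) -pmulrn (g_mulrn hG) normrN.
Qed.

Lemma pt_mulz (x : Z2) (a : int) : x *~ a = pt (xc x * a) (yc x * a).
Proof.
by apply: Z2P; rewrite ?pt0 ?pt1 /xc /yc -scaler_int mxE mulrC intz.
Qed.

Lemma ln_e1 a : G (pt a 0) = `|a|%:~R * G (pt 1 0).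
Proof. by rewrite -ln_axis pt_mulz pt0 pt1 mul1r mul0r. Qed.

Lemma ln_e2 b : G (pt 0 b) = `|b|%:~R * G (pt 0 1).
Proof. by rewrite -ln_axis pt_mulz pt0 pt1 mul1r mul0r. Qed.

(** The sum of [z] and its mirror image is twice the horizontal part of [z], and both have the same
    norm. *)
Lemma ln_xc z : `|xc z|%:~R * G (pt 1 0) <= G z.
Proof.
rewrite {2}(pt_eta z); set a := xc z; set b := yc z.
have := g_add hG (pt a b) (pt a (- b)); rewrite ln_flip1.
rewrite (_ : _ + _ = pt a 0 *+ 2); last by apply: Z2P; rewrite mulr2n !coordE !(pt0, pt1); ring.
by rewrite (g_mulrn hG) ln_e1; lra.
Qed.

Lemma ln_yc z : `|yc z|%:~R * G (pt 0 1) <= G z.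
Proof.
rewrite {2}(pt_eta z); set a := xc z; set b := yc z.
have := g_add hG (pt a b) (pt (- a) b); rewrite (g_flip hG).
rewrite (_ : _ + _ = pt 0 b *+ 2); last by apply: Z2P; rewrite mulr2n !coordE !(pt0, pt1); ring.
by rewrite (g_mulrn hG) ln_e2; lra.
Qed.

Lemma lnorm_ge0 z : 0 <= G z.
Proof.
by apply: le_trans (ln_xc z); rewrite mulr_ge0 ?ler0z// ltW// (g_e1 hG).
Qed.

Lemma ln_linf : exists2 cg : R, 0 < cg & forall z, cg * (linf z)%:~R <= G z.
Proof.
exists (Num.min (G (pt 1 0)) (G (pt 0 1))); first by rewrite lt_min (g_e1 hG) (g_e2 hG).
move=> z; rewrite /linf.
have h1 := ln_xc z; have h2 := ln_yc z.
case: (leP `|xc z| `|yc z|) => _.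
  by apply: le_trans h2; rewrite mulrC ler_wpM2l ?ler0z// ge_min lexx orbT.
by apply: le_trans h1; rewrite mulrC ler_wpM2l ?ler0z// ge_min lexx.
Qed.

(** Reflecting the second piece of a trip that rises to height [hh] and comes back turns it into a
    trip rising to [2 hh], whose cost the curvature bounds below. *)
Lemma ln_reflect j n hh : G (pt n (hh *+ 2)) <= G (pt j hh) + G (pt (n - j) (- hh)).
Proof.
rewrite ln_flip1; apply: le_trans (g_add hG (pt j hh) (pt (n - j) hh)).
by rewrite (_ : pt j hh + _ = pt n (hh *+ 2))//; apply: Z2P; rewrite !coordE !(pt0,pt1) ?mulr2n//; ring.
Qed.
End norm_geometry.

(** * Laplace transform of a minimum *)

Section minimum.
Context d (O : measurableType d) (R : realType) (P : probability O R).
Variables (I : eqType) (f : I -> O -> R).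
Hypothesis f0 : forall z o, 0 <= f z o.
Hypothesis mf : forall z, measurable_fun setT (f z).

Definition fmin z0 (s : seq I) o := foldr (fun z acc => Num.min (f z o) acc) (f z0 o) s.

Lemma fmin_le z0 s z o : z \in z0 :: s -> fmin z0 s o <= f z o.
Proof.
rewrite inE => /orP[/eqP->|]; first by elim: s => //= y s ih; rewrite ge_min ih orbT.
elim: s => //= y s ih; rewrite inE ge_min => /orP[/eqP->|/ih->]; rewrite ?lexx ?orbT//.
Qed.

Lemma fmin_ge z0 s c o : (forall z, z \in z0 :: s -> c <= f z o) -> c <= fmin z0 s o.
Proof.
elim: s => [|y s ih] H /=; first by apply: H; rewrite inE.
rewrite le_min H ?inE ?eqxx ?orbT//=; apply: ih => z; rewrite inE => hz.
by apply: H; rewrite !inE; case/orP: hz => ->; rewrite ?orbT.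
Qed.

Lemma measurable_fmin z0 s : measurable_fun setT (fmin z0 s).
Proof. by elim: s => [|y s ih] /=; [exact: mf|exact: measurable_minr (mf y) ih]. Qed.

(** The exponential of the minimum is one of the terms of the sum. The number of terms will enter
    mean values through its logarithm only. *)
Lemma Ex_expN_fmin z0 s (th B : R) : 0 <= B ->
  (forall z, z \in z0 :: s -> (Ex P (fun o => expR (- th * f z o)) <= B%:E)%E) ->
  (Ex P (fun o => expR (- th * fmin z0 s o)) <= ((size s).+1%:R * B)%:E)%E.
Proof.
move=> B0; elim: s => [|y s ih] H; first by rewrite mul1r; apply: H; rewrite inE.
have ih' : (Ex P (fun o => expR (- th * fmin z0 s o)) <= ((size s).+1%:R * B)%:E)%E.
  apply: ih => z; rewrite inE => hz; apply: H.
  by rewrite !inE; case/orP: hz => ->; rewrite ?orbT.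
have hy : (Ex P (fun o => expR (- th * f y o)) <= B%:E)%E by apply: H; rewrite !inE eqxx orbT.
rewrite /= (mulrS 1) mulrDl mul1r EFinD.
have m1 := measurable_expRM (- th) (mf y).
have m2 := measurable_expRM (- th) (measurable_fmin z0 s).
apply: le_trans (leeD hy ih').
rewrite -(ExD P m1 m2) => [|x|x]; rewrite ?expR_ge0//.
apply: le_Ex.
- exact: (measurable_expRM (- th) (measurable_fmin z0 (y :: s))).
- exact: measurable_funD.
- by move=> x; exact: expR_ge0.
- move=> x /=; have [a b] := (expR_ge0 (- th * f y x), expR_ge0 (- th * fmin z0 s x)).
  by case: (leP (f y x)) => _; lra.
Qed.
End minimum.

(** * Splitting a passage at its middle column *)

Section doubling.
Variable R : realType.
Notation W := (weights R {fset Z2}).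

Definition lmin z0 s (w : W) : R := fmin (fun z (w : W) => ptime setT w 0 z) z0 s w.

(** Jensen for the minimum against [Ex_expN_fmin] with the Laplace bound for each point: with [N]
    points and mean [m] of the minimum, [- th m <= ln N - th / (1 + th) * ell]. *)
Lemma Ex_lmin_ge d (O : measurableType d) (P : probability O R) (Y : O -> W) z0 s (th ell : R) :
  iid P edges Y -> 0 < th ->
  (forall z, z \in z0 :: s -> (ell%:E <= Ex P (fun o => ptime setT (Y o) 0%R z))%E) ->
  ((ell / (1 + th) - ln (size s).+1%:R / th)%:E <= Ex P (fun o => lmin z0 s (Y o)))%E.
Proof.
move=> iY th0 H.
have Y0 o e : 0 <= Y o e by exact: (iid_ge0 iY).
pose f z o := ptime setT (Y o) 0 z.
have f0 z o : 0 <= f z o by exact: ptime_ge0.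
have mf z : measurable_fun setT (f z) by exact: (measurable_ptime iY).
have Lf o : lmin z0 s (Y o) = fmin f z0 s o by [].
have L0 o : 0 <= fmin f z0 s o by exact: fmin_ge.
have mL := measurable_fmin mf z0 s.
rewrite (_ : (fun o => _) = fmin f z0 s); last exact/funext.
have Lfin : Ex P (fmin f z0 s) \is a fin_num.
  rewrite ge0_fin_numE ?Ex_ge0//.
  have hz := Ex_tau_fin iY 0 z0.
  apply: (@le_lt_trans _ _ (Ex P (f z0))); last by rewrite [Ex P _]hz ltry.
  apply: le_Ex => // o; apply: fmin_le; exact: mem_head.
rewrite -(fineK Lfin); set m := fine _.
have Lm : Ex P (fmin f z0 s) = m%:E by rewrite /m fineK.
rewrite lee_fin.
have sub : inner_edges setT `<=` edges by exact: inner_edges_sub.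
pose B := expR (- (th / (1 + th)) * ell).
have hB z : z \in z0 :: s -> (Ex P (fun o => expR (- th * f z o)%R) <= B%:E)%E.
  move=> hz; have := ptime_mgf iY sub (setT_walk 0 z) th0 (H z hz).
  have bd : bounded_mf 1 (fun o => expR (- th * f z o)).
    split; first exact: (measurable_expRM (- th) (mf z)).
    move=> o; rewrite expR_ge0 -expR0 ler_expR mulNr oppr_le0.
    exact: mulr_ge0 (ltW th0) (f0 z o).
  by rewrite -lee_fin -(EK P bd).
have J := jensen_expN (ltW th0) mL L0 Lm.
have := le_trans J (Ex_expN_fmin mf (expR_ge0 _) hB).
have N0 : 0 < (size s).+1%:R :> R by rewrite ltr0n.
rewrite lee_fin -[X in _ <= X * _](lnK (x := (size s).+1%:R)) ?posrE// -expRD ler_expR.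
rewrite mulNr mulNr => hh.
have th1 : 0 < 1 + th by rewrite addr_gt0.
rewrite -subr_ge0.
have -> : m - (ell / (1 + th) - ln (size s).+1%:R / th) =
  (th * m - th / (1 + th) * ell + ln (size s).+1%:R) / th.
  by field; rewrite !gt_eqF.
by apply: divr_ge0 (ltW th0); lra.
Qed.

(** A finite substitute for the infinite column of abscissa [n]: a walk that reaches the column
    meets it inside the box of radius [r] or first meets the boundary of the box. *)
Definition targets (n r : nat) : seq Z2 :=
  [seq z <- [seq pt (i%:Z - r%:Z) (j%:Z - r%:Z) | i <- iota 0 (r + r).+1, j <- iota 0 (r + r).+1]
   | (linf z == r%:Z) || (xc z == n%:Z)].

Lemma size_targets n r : (size (targets n r) <= (r + r).+1 ^ 2)%N.
Proof.
rewrite size_filter; apply: leq_trans (count_size _ _) _.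
by rewrite size_allpairs !size_iota.
Qed.

Lemma mem_targets n r z : (z \in targets n r) =
  (linf z <= r%:Z) && ((linf z == r%:Z) || (xc z == n%:Z)).
Proof.
rewrite mem_filter andbC; congr andb; apply/idP/idP.
  case/allpairsP => q [hi hj ->]; rewrite linf_le pt0 pt1.
  by move: hi hj; rewrite !mem_iota; lia.
rewrite linf_le => hz; apply/allpairsP.
exists (absz (xc z + r%:Z), absz (yc z + r%:Z)); split; cbn [fst snd]; rewrite ?mem_iota; [lia|lia|].
by rewrite [LHS]pt_eta /=; congr pt; lia.
Qed.

Lemma lmin_ge n r (w : W) u : (forall e, 0 <= w e) -> (0 < n)%N -> (0 < r)%N ->
  n%:Z <= xc u -> lmin (pt n%:Z 0) (targets n r) w <= ptime setT w 0 u.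
Proof.
move=> w0 n0 r0 hu; apply: ptime_ge; first exact: setT_walk.
move=> p hp; have [pp lp _] := hp.
(* [f] is negative strictly inside the box and left of the column, and vanishes at the first target
   met. *)
pose f v : int := Num.max (linf (v - 0) - r%:Z) (xc v - n%:Z).
have f1 a b : adjacent a b -> f b <= f a + 1.
  move=> ab; have := linf_adjacent 0 ab; rewrite /f; move/adjacentP: ab; move: (linf _) (linf _) (xc a) (yc a) (xc b) (yc b) => l1 l2 x1 y1 x2 y2 hd hl;
  case: (leP (l2 - _)) => h1; case: (leP (l1 - _)) => h2; case: hd => -[]; lia.
have f00 : f 0 < 0 by rewrite /f subr0 /linf !coordE gt_max normr0; lia.
have hs : has (fun v => 0 <= f v) p.
  case: p hp pp lp => [_ _ /= e|a p' _ _ e]; first by move: hu; rewrite -e coordE; lia.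
  by apply/hasP; exists (last a p'); [exact: mem_last|rewrite -[last a p']/(last 0 (a :: p')) e /f le_max; apply/orP; right; lia].
have [p1 [v [p2 [pe fv hv]]]] := walks_splitf f1 pp f00 hs.
have vt : v \in targets n r.
  by rewrite mem_targets; move: fv; rewrite /f subr0; case: leP; lia.
have : walks setT 0 v (rcons p1 v).
  split => //; last by rewrite last_rcons.
  by move: pp; rewrite pe -cat_rcons cat_path => /andP[].
move=> /(ptime_le w0) h1.
have h2 : lmin (pt n%:Z 0) (targets n r) w <= ptime setT w 0 v.
  by apply: (@fmin_le _ W R _ (fun z (w : W) => ptime setT w 0 z)); rewrite inE vt orbT.
apply: le_trans h2 (le_trans h1 _).
by rewrite pe -cat_rcons path_time_cat lerDl path_time_ge0.
Qed.

(** The walk is split where it first meets column [n]. The point reflection [v |-> u - v] turns the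
    reversed second half into a walk from 0 to column [n] as well, since [u] lies in column
    [2 n]. *)
Lemma ptime_double n r (w : W) u : (forall e, 0 <= w e) -> (0 < n)%N -> (0 < r)%N ->
  xc u = (n + n)%:Z -> lmin (pt n%:Z 0) (targets n r) w +
    lmin (pt n%:Z 0) (targets n r) (map_weight (fun v => u - v) w) <= ptime setT w 0 u.
Proof.
move=> w0 n0 r0 hu; apply: ptime_ge; first exact: setT_walk.
move=> p hp; have [pp lp _] := hp.
have f1 a b : adjacent a b -> xc b <= xc a + 1 by move/adjacentP; lia.
have f00 : xc 0 < n%:Z by rewrite coordE; lia.
have hs : has (fun v => n%:Z <= xc v) p.
  case: p hp pp lp => [_ _ /= e|a p' _ _ e]; first by move: hu; rewrite -e coordE; lia.
  by apply/hasP; exists (last a p'); [exact: mem_last|rewrite -[last a p']/(last 0 (a :: p')) e; lia].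
have [p1 [v [p2 [pe fv hv]]]] := walks_splitf f1 pp f00 hs.
have w1 : walks setT 0 v (rcons p1 v).
  split => //; last by rewrite last_rcons.
  by move: pp; rewrite pe -cat_rcons cat_path => /andP[].
have w2 : walks setT v u p2.
  split => //; last by move: lp; rewrite pe last_cat.
  by move: pp; rewrite pe cat_path => /andP[_ /=/andP[]].
have [adj [psi c1 c2]] := isom_opp u.
have h2 : ptime setT w v u = ptime setT (map_weight (fun v => u - v) w) 0 (u - v).
  rewrite (@ptime_map R _ psi setT setT w 0 (u - v) adj c1 c2 (fun=> iff_refl True)).
  by rewrite subr0 subKr ptime_rev.
have := lmin_ge (w := map_weight (fun v => u - v) w) (fun e => w0 _) n0 r0 (u := u - v).
rewrite -h2 !coordE hu fv => /(_ ltac:(lia)) l2.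
have l1 := lmin_ge w0 n0 r0 (u := v) ltac:(lia).
have := lerD (le_trans l1 (ptime_le w0 w1)) (le_trans l2 (ptime_le w0 w2)).
by move=> H; apply: le_trans H _; rewrite pe -cat_rcons path_time_cat last_rcons.
Qed.
End doubling.

Lemma ln_le_powR (R : realType) (x a : R) : 0 < x -> 0 < a -> ln x <= x `^ a / a.
Proof.
move=> x0 a0; rewrite ler_pdivlMr// mulrC -ln_powR.
by apply: ltW; apply: ln_sublinear; rewrite powR_gt0.
Qed.

Lemma powR_ge1 (R : realType) (x a : R) : 1 <= x -> 0 <= a -> 1 <= x `^ a.
Proof. by move=> x1 a0; rewrite -(powRr0 x) ler_powR. Qed.

Lemma ltr_powR (R : realType) (x a b : R) : 1 < x -> a < b -> x `^ a < x `^ b.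
Proof.
move=> x1 ab; rewrite /powR gt_eqF ?(lt_trans ltr01)//.
by rewrite ltr_expR ltr_pM2r// ln_gt0.
Qed.

Lemma pt_mulrn (m : nat) : pt 1 0 *+ m = pt m%:Z 0.
Proof. by rewrite pmulrn pt_mulz pt0 pt1 mul1r mul0r. Qed.

Lemma growth_arith (R : realType) (hm h2n ng mg cz cy y e : R) : h2n <= 2 * (ng + cz) ->
  hm <= h2n + e * 1 -> cz <= cy -> 1 <= y -> e <= 1 -> ng + ng <= mg -> hm <= mg + (cy + cy + y).
Proof. by lra. Qed.

(** * Rate of convergence of the means along the axis *)

Section growth.
Variable R : realType.
Notation W := (weights R {fset Z2}).
Context d (O : measurableType d) (P : probability O R).
Variable Y : O -> W.
Hypothesis iY : iid P edges Y.
Variable G : Z2 -> R.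
Hypothesis Glim : forall x, {ae P, forall o,
  (fun m : nat => ptime setT (Y o) 0 (x *+ m) / m%:R) @ \oo --> G x}.
Hypothesis hG : lattice_norm G.
Notation h := (h P Y).
Notation G1 := (G (pt 1 0)).

Let Y0 o e : 0 <= Y o e. Proof. exact: (iid_ge0 iY). Qed.

Definition ell (n : nat) : R := inf [set h (pt n%:Z y) | y in [set: int]].

Lemma ell_le n y : ell n <= h (pt n%:Z y).
Proof.
apply: ge_inf; last by exists y.
by exists 0 => _ [z _ <-]; exact: h_ge0.
Qed.

Lemma ell_ge n c : (forall y, c <= h (pt n%:Z y)) -> c <= ell n.
Proof.
by move=> H; apply: lb_le_inf; [exists (h (pt n%:Z 0)); exists 0|move=> _ [y _ <-]].
Qed.

Lemma h_flip1 a b : h (pt a (- b)) = h (pt a b).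
Proof.
rewrite -(h_isom iY (pt a b) (isom_opp 0)) -(h_isom iY _ (isom_flip0 0)).
by congr h; apply: Z2P; rewrite !(coordE, pt0, pt1); ring.
Qed.

Lemma h_e1_le (m : nat) : (0 < m)%N -> h (pt m%:Z 0) <= m%:R.
Proof.
move=> m0; rewrite -pt_mulrn; apply: le_trans (h_mulrn iY _ m0) _.
rewrite ler_piMr//; have := @h_adjacent _ _ _ _ _ iY 0 (pt 1 0); rewrite subr0; apply.
by apply/adjacentP; rewrite !(coordE, pt0, pt1); left; split => //; left.
Qed.

(** The way from [(n, y)] to [(2 n, 0)] has the mean cost of the mirror image of the way to
    [(n, y)]. *)
Lemma h_col_double n y : h (pt (n + n)%:Z 0) <= h (pt n%:Z y) *+ 2.
Proof.
rewrite mulr2n -{2}(h_flip1 n%:Z y); apply: le_trans (h_subadd iY _ _).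
rewrite (_ : _ + _ = pt (n + n)%N%:Z 0)//.
by apply: Z2P; rewrite !(coordE, pt0, pt1) ?subrr ?PoszD.
Qed.

(** Every target has mean at least [ell n]: in the column by definition, on the boundary of the box
    of radius [C n] because [ell n <= n <= G z <= h z]. So [Ex_lmin_ge] applies to both halves of
    [ptime_double]. *)
Lemma ell_double0 (C n : nat) (th : R) : (0 < n)%N -> (0 < C)%N -> 0 < th ->
  (forall z, (linf z)%:~R <= C%:R * G z) ->
  (ell n / (1 + th) - ln ((4 * (C * n)) ^ 2)%:R / th) *+ 2 <= ell (n + n).
Proof.
move=> n0 C0 th0 hC; set r := (C * n)%N.
have r0 : (0 < r)%N by rewrite muln_gt0 C0.
set s := targets n r.
pose X : R := ell n / (1 + th) - ln (size s).+1%:R / th.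
have hs z : z \in pt n%:Z 0 :: s -> ell n <= h z.
  have col v : xc v = n%:Z -> ell n <= h v by move=> hv; rewrite (pt_eta v) hv; exact: ell_le.
  rewrite inE => /orP[/eqP->|]; first by apply: col; rewrite pt0.
  rewrite mem_targets => /andP[_ /orP[/eqP hz|/eqP hz]]; last exact: col.
  apply: le_trans (ell_le n 0) _; apply: le_trans (h_e1_le n0) _.
  apply: le_trans (G_le_h iY Glim z).
  have := hC z; rewrite hz /r -pmulrn natrM ler_pM2l ?ltr0n//.
have HX d' (O' : measurableType d') (P' : probability O' R) (Y' : O' -> W) : iid P' edges Y' ->
    (X%:E <= Ex P' (fun o => lmin (pt n%:Z 0) s (Y' o)))%E.
  move=> iY'; apply: (Ex_lmin_ge iY' th0) => z hz.
  have sub : inner_edges setT `<=` edges by exact: inner_edges_sub.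
  rewrite -(iid_Ex_ptime 0 z iY iY' sub) (Ex_tau iY 0 z) subr0 lee_fin; exact: hs.
have mL d' (O' : measurableType d') (P' : probability O' R) (Y' : O' -> W) : iid P' edges Y' ->
    measurable_fun setT (fun o => lmin (pt n%:Z 0) s (Y' o)).
  move=> iY'; apply: (@measurable_fmin _ O' R _ (fun z o => ptime setT (Y' o) 0 z)) => z.
  exact: (measurable_ptime iY').
have L0 (w : W) : (forall e, 0 <= w e) -> 0 <= lmin (pt n%:Z 0) s w.
  move=> w0; apply: fmin_ge => z _; exact: ptime_ge0.
have key : X *+ 2 <= ell (n + n).
  apply: ell_ge => y; set u := pt _ y.
  pose Y' o : W := map_weight (fun v => u - v) (Y o).
  have iY' : iid P edges Y' by exact: (iid_map iY (isom_opp u)).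
  have Y0' o e : 0 <= Y' o e by exact: Y0.
  rewrite -lee_fin -[h u]/(h u) -[in leRHS](subr0 u) -(Ex_tau iY 0 u).
  rewrite mulr2n EFinD; apply: le_trans (leeD (HX _ _ _ _ iY) (HX _ _ _ _ iY')) _.
  have m1 := mL _ _ _ _ iY; have m2 := mL _ _ _ _ iY'.
  rewrite -(ExD P m1 m2 (fun o => L0 _ (Y0 o)) (fun o => L0 _ (Y0' o))).
  apply: le_Ex.
  - exact: (measurable_funD m1 m2).
  - exact: (measurable_ptime iY).
  - by move=> o; rewrite addr_ge0// L0.
  - move=> o; apply: ptime_double => //; by rewrite pt0.
apply: le_trans key; rewrite lerMn2r /= lerD2l lerN2 ler_pM2r ?invr_gt0//.
rewrite ler_ln ?posrE ?ltr0n ?ler_nat// ?expn_gt0 ?muln_gt0 ?r0//.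
apply: leq_ltn_trans (size_targets n r) _; nia.
by rewrite C0 n0.
Qed.

Variable a : R.
Hypothesis a0 : 0 < a < 2^-1.
Notation al := (2^-1 + a).

Let al1 : 0 < al < 1. Proof. by move: a0; lra. Qed.

(** [th = n^(-1/2)]: the loss in [ell n / (1 + th)] is at most [ell n * th <= n^(1/2)], and the
    logarithm costs [n^(1/2)] times [ln n], which is at most [n^a / a]. *)
Lemma ell_double : exists2 C : R, 0 <= C &
  forall n : nat, (0 < n)%N -> ell n *+ 2 - C * n%:R `^ al <= ell (n + n).
Proof.
have [cg cg0 hcg] := ln_linf hG.
have [C C0 hC] : exists2 C : nat, (0 < C)%N & 1 <= C%:R * cg.
  exists (Num.truncn cg^-1).+1 => //.
  by rewrite -ler_pdivrMr// mul1r ltW// truncnS_gt.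
have {}hC z : (linf z)%:~R <= C%:R * G z.
  apply: (@le_trans _ _ (C%:R * (cg * (linf z)%:~R))); last exact: ler_wpM2l.
  by rewrite mulrA; apply: ler_peMl => //; rewrite ler0z linf_ge0.
pose K : R := 2 * (ln (4 * C%:R) + a^-1).
have K0 : 0 <= K.
  apply: mulr_ge0 => //; apply: addr_ge0; last by rewrite invr_ge0; case/andP: a0 => /ltW.
  by apply: ln_ge0; rewrite -natrM ler1n muln_gt0.
exists (2 * (1 + K)) => [|n n0]; first by rewrite mulr_ge0// addr_ge0.
have nR : 0 < n%:R :> R by rewrite ltr0n.
pose q : R := n%:R `^ (2^-1).
have q0 : 0 < q by rewrite powR_gt0.
have qq : q * q = n%:R by rewrite -powRD ?gt_eqF ?implybT// (_ : _ + _ = 1) ?powRr1 ?ler0n//; lra.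
have th0 : 0 < q^-1 by rewrite invr_gt0.
apply: le_trans (ell_double0 n0 C0 th0 hC).
rewrite invrK; set X := (X in _ <= X *+ 2).
suff : ell n - (1 + K) * n%:R `^ al <= X by rewrite !mulr2n; lra.
rewrite /X {X}.
have na : 1 <= n%:R `^ a.
  by apply: powR_ge1; [rewrite ler1n|case/andP: a0 => /ltW].
have lnS : ln ((4 * (C * n)) ^ 2)%:R <= K * n%:R `^ a.
  have C0' : 0 < 4 * C%:R :> R by rewrite mulr_gt0 ?ltr0n.
  rewrite natrX lnXn; last by rewrite ltr0n !muln_gt0 C0 n0.
  rewrite mulnA natrM natrM lnM ?posrE// mulr2n /K.
  have h1 : ln (4 * C%:R) <= ln (4 * C%:R) * n%:R `^ a.
    by apply: ler_peMr => //; apply: ln_ge0; rewrite -natrM ler1n muln_gt0.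
  have h2 : ln n%:R <= n%:R `^ a / a by apply: ln_le_powR => //; case/andP: a0.
  by move: h1 h2; set A := ln (4 * _); set B := ln _; set x := _ `^ a; lra.
rewrite powRD ?gt_eqF ?implybT// -/q.
have el : ell n <= q * q by rewrite qq; apply: le_trans (ell_le n 0) (h_e1_le n0).
have el0 : 0 <= ell n by apply: ell_ge => y; exact: h_ge0.
have e1 : ell n - q <= ell n / (1 + q^-1).
  rewrite ler_pdivlMr ?addr_gt0//.
  rewrite (_ : _ * _ = ell n + (ell n / q - q - 1)); last by field; rewrite gt_eqF.
  have : ell n / q <= q by rewrite ler_pdivrMr.
  lra.
have e2 : ln ((4 * (C * n)) ^ 2)%:R * q <= K * n%:R `^ a * q by rewrite ler_pM2r.
have e3 : q <= q * n%:R `^ a by rewrite ler_peMr// ltW.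
apply: le_trans (lerB e1 e2); nra.
by case/andP: al1.
Qed.

(** With [D (2 - 2^al) = C] the error is absorbed: [phi] at least doubles when [n] does. Hence
    [phi n <= ell (2^k n) / 2^k], and by [h_near] the right side is at most [n G1] up to an
    arbitrarily small error. *)
Lemma ell_upper : exists2 C : R, 0 <= C &
  forall n : nat, (0 < n)%N -> ell n <= n%:R * G1 + C * n%:R `^ al.
Proof.
have [C C0 hC] := ell_double.
have t2 : 2 `^ al < 2 :> R.
  by rewrite -[ltRHS]powRr1//; apply: ltr_powR; [rewrite ltr1n|case/andP: al1].
pose D := C / (2 - 2 `^ al).
have D0 : 0 <= D by rewrite divr_ge0// subr_ge0 ltW.
exists D => // n n0.
pose phi (m : nat) := ell m - D * m%:R `^ al.
have phi2 m : (0 < m)%N -> 2 * phi m <= phi (m + m)%N.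
  move=> m0; have := hC m m0; rewrite /phi addnn -mul2n natrM powRM ?ler0n//.
  have : D * (2 - 2 `^ al) = C by rewrite /D divfK// gt_eqF// subr_gt0.
  rewrite mulr2n; clear t2 phi D0; clearbody D; move: (m%:R `^ al) (2 `^ al) (ell m) (ell _) (D : R) => x y l l' D'.
  by move=> <-; lra.
have phik (k : nat) : (2 ^ k)%:R * phi n <= phi (2 ^ k * n)%N.
  elim: k => [|k ih]; first by rewrite expn0 mul1r mul1n.
  have p2 : (0 < 2 ^ k * n)%N by rewrite muln_gt0 expn_gt0.
  have := phi2 _ p2.
  rewrite expnS natrM (_ : (2 * 2 ^ k * n = 2 ^ k * n + 2 ^ k * n)%N); last by rewrite -mulnA mul2n addnn.
  by apply: le_trans; rewrite -mulrA ler_pM2l.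
rewrite -lerBlDr -/(phi n); apply/ler_addgt0Pr => e e0.
have nR : 0 < n%:R :> R by rewrite ltr0n.
have e'0 : 0 < e / n%:R by rewrite divr_gt0.
have [N _ hN] := h_near iY Glim (pt 1 0) e'0.
have NN : (N <= 2 ^ N * n)%N.
  by apply: leq_trans (ltnW (ltn_expl N (ltnSn 1))) _; rewrite leq_pmulr.
have := hN (2 ^ N * n)%N NN; rewrite pt_mulrn natrM => h1.
have h2 := phik N; have h3 := ell_le (2 ^ N * n)%N 0.
have h4 : phi (2 ^ N * n)%N <= ell (2 ^ N * n)%N by rewrite gerBl mulr_ge0// powR_ge0.
have := le_trans h2 (le_trans h4 (le_trans h3 (ltW h1))).
rewrite -mulrA ler_pM2l ?ltr0n ?expn_gt0// => h5; apply: le_trans h5 _.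
by rewrite mulrDr mulrCA divff ?gt_eqF// mulr1.
Qed.

(** [h (2 n, 0) <= 2 ell n] by [h_col_double]; an odd [m] costs one more edge, of mean at most 1. *)
Lemma h_upper : exists2 C : R, 0 <= C &
  forall m : nat, (0 < m)%N -> h (pt m%:Z 0) <= m%:R * G1 + C * m%:R `^ al.
Proof.
have [C C0 hC] := ell_upper.
have [al0 al1'] := andP al1.
exists (2 * C + 1) => [|m m0]; first by rewrite addr_ge0// mulr_ge0.
have mR : 1 <= m%:R `^ al :> R by apply: powR_ge1; [rewrite ler1n|exact: ltW].
have g1 := ltW (g_e1 hG).
have [n hn] : exists n, m = (n + n)%N \/ m = (n + n).+1 by exists m./2; lia.
have [n0|n0] := posnP n.
  have -> : m = 1%N by lia.
  have := h_e1_le (ltnSn 0); rewrite powR1; lra.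
have h2 : h (pt (n + n)%:Z 0) <= 2 * (n%:R * G1 + C * n%:R `^ al).
  have : (h (pt (n + n)%:Z 0)) / 2 <= ell n.
    by apply: ell_ge => y; have := h_col_double n y; rewrite mulr2n; lra.
  have := hC n n0; lra.
have nm : n%:R `^ al <= m%:R `^ al :> R.
  by apply: ge0_ler_powR; rewrite ?nnegrE ?ler0n ?ler_nat ?(ltW al0)//; lia.
have C1 := ler_wpM2l C0 nm.
have h3 : h (pt m%:Z 0) <= h (pt (n + n)%:Z 0) + (m%:R - (n%:R + n%:R)) * 1.
  case: hn => e.
    by rewrite e natrD; lra.
  rewrite (_ : pt m%:Z 0 = pt (n + n)%:Z 0 + pt 1 0); last first.
    by apply: Z2P; rewrite !(coordE, pt0, pt1) ?addr0// e -addn1 PoszD.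
  apply: le_trans (h_subadd iY _ _) _; rewrite lerD2l.
  have := h_e1_le (ltnSn 0); rewrite e -addn1 !natrD; lra.
have m2 : m%:R - (n%:R + n%:R) <= 1 :> R by rewrite lerBlDr -natrD -(natrD _ 1) ler_nat; lia.
have m3 : n%:R + n%:R <= m%:R :> R by rewrite -natrD ler_nat; lia.
have m4 := ler_wpM2r g1 m3.
have -> : (2 * C + 1) * m%:R `^ al = C * m%:R `^ al + C * m%:R `^ al + m%:R `^ al.
  by ring.
rewrite mulrDl in m4.
exact: (growth_arith h2 h3 C1 mR m2 m4).
Qed.
End growth.

Lemma near_powR (R : realType) (b K : R) : 0 < b -> \forall m \near \oo, K <= (m%:R : R) `^ b.
Proof.
move=> b0; near=> m.
have m1 : (`|K| + 1) `^ b^-1 <= m%:R by near: m; exact: nbhs_infty_ger.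
have K1 : 0 <= `|K| + 1 by rewrite addr_ge0.
have : ((`|K| + 1) `^ b^-1) `^ b <= m%:R `^ b.
  by apply: ge0_ler_powR; rewrite ?nnegrE ?powR_ge0 ?ler0n// ltW.
rewrite -powRrM mulVf ?gt_eqF// powRr1//; apply: le_trans.
by rewrite (le_trans (ler_norm K))// lerDl.
Unshelve. all: end_near. Qed.

(** * Union bound over a finite list *)

Section union_bound.
Context d (O : measurableType d) (R : realType) (P : probability O R) (I : eqType).
Variable A : I -> set O.

Lemma exists_cons (i : I) (s : seq I) : [set o | exists2 j, j \in i :: s & A j o] =
  A i `|` [set o | exists2 j, j \in s & A j o].
Proof.
apply/seteqP; split => o /=.
  by case=> j; rewrite inE => /orP[/eqP->|js] Aj; [left|right; exists j].
by case=> [Ai|[j js Aj]]; [exists i; rewrite // mem_head|exists j => //; rewrite inE js orbT].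
Qed.

Lemma exists_nil : [set o | exists2 j, j \in ([::] : seq I) & A j o] = set0.
Proof. by apply/seteqP; split => o //= -[]. Qed.

Hypothesis mA : forall i, measurable (A i).

Lemma measurable_exists (s : seq I) : measurable [set o | exists2 j, j \in s & A j o].
Proof.
elim: s => [|i s ih]; first by rewrite exists_nil.
by rewrite exists_cons; exact: measurableU.
Qed.

Lemma union_bound (s : seq I) (B : R) : (forall i, i \in s -> (P (A i) <= B%:E)%E) ->
  (P [set o | exists2 j, j \in s & A j o] <= ((size s)%:R * B)%:E)%E.
Proof.
elim: s => [|i s ih] H; first by rewrite exists_nil measure0 mul0r.
rewrite exists_cons; apply: (le_trans (measureU2 P (mA i) (measurable_exists s))).
rewrite (mulrS 1) mulrDl mul1r EFinD; apply: leeD; first by apply: H; exact: mem_head.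
by apply: ih => j js; apply: H; rewrite inE js orbT.
Qed.
End union_bound.

(** * Upper tail from the mean and the Laplace transform *)

Section upper.
Variable R : realType.
Notation W := (weights R {fset Z2}).
Context d (O : measurableType d) (P : probability O R).
Variable Y : O -> W.
Hypothesis iY : iid P edges Y.
Variable G : Z2 -> R.
Hypothesis Glim : forall x, {ae P, forall o,
  (fun m : nat => ptime setT (Y o) 0 (x *+ m) / m%:R) @ \oo --> G x}.
Hypothesis hG : lattice_norm G.
Notation h := (h P Y).
Notation G1 := (G (pt 1 0)).
Variable a : R.
Hypothesis a0 : 0 < a < 2^-1.
Notation al := (2^-1 + a).

Let Y0 o e : 0 <= Y o e. Proof. exact: (iid_ge0 iY). Qed.

(** [A + (X - A)^+ <= X + e^{th (A - X)} / th] turns the bound on the Laplace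
    transform of [X] into a bound on the upper tail above [A]. *)
Lemma upper_markov x (th A s : R) : 0 < th -> 0 <= A -> 0 < s -> A <= h x ->
  (P [set o | (A + s < ptime setT (Y o) 0%R x)%R] <=
   ((h x - A + th^-1 * expR (th ^+ 2 * A)) / s)%:E)%E.
Proof.
move=> th0 A0 s0 Ah; set X := fun o => ptime setT (Y o) 0 x.
have mX : measurable_fun setT X by exact: (measurable_ptime iY).
have X0 o : 0 <= X o by exact: ptime_ge0.
set D := [set o | _].
have mD : measurable D.
  rewrite (_ : D = X @^-1` `]A + s, +oo[); last first.
    by apply/seteqP; split => o; rewrite /D /= in_itv /= andbT.
  by rewrite -[X in measurable X]setTI; apply: mX.
have sub : inner_edges setT `<=` edges by exact: inner_edges_sub.
have EX : Ex P X = (h x)%:E by rewrite /X (Ex_tau iY) subr0.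
have hh : (A%:E <= Ex P X)%E by rewrite EX lee_fin.
have := ptime_mgf iY sub (setT_walk 0 x) th0 hh.
have bd : bounded_mf 1 (fun o => expR (- th * X o)).
  split; first exact: (measurable_expRM (- th) mX).
  by move=> o; rewrite expR_ge0 -expR0 ler_expR mulNr oppr_le0 mulr_ge0// ltW.
rewrite -lee_fin -(EK P bd) => L.
pose c := th^-1 * expR (th * A).
have c0 : 0 <= c by rewrite mulr_ge0 ?expR_ge0// invr_ge0 ltW.
have mE := measurable_expRM (- th) mX.
have E2 : (Ex P (fun o => c * expR (- th * X o))%R <= (th^-1 * expR (th ^+ 2 * A))%:E)%E.
  rewrite ExZl//.
  apply: (@le_trans _ _ (c%:E * (expR (- (th / (1 + th)) * A))%:E)%E).
    exact: lee_wpmul2l.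
  rewrite -EFinM lee_fin /c -mulrA ler_pM2l ?invr_gt0// -expRD ler_expR.
  have : th - th / (1 + th) <= th ^+ 2.
    rewrite (_ : _ - _ = th ^+ 2 / (1 + th)); last by field; rewrite gt_eqF// addr_gt0.
    by rewrite ler_pdivrMr ?addr_gt0// ler_peMr ?sqr_ge0// lerDl ltW.
  by move=> /(ler_wpM2r A0); rewrite mulrBl mulNr.
have E1 : Ex P (fun o => A + s * \1_D o) = (A + s * fine (P D))%:E.
  have m1 : measurable_fun setT (fun o => s * (\1_D o : R)).
    by apply: measurable_funM; [exact: measurable_cst|exact: measurable_indic].
  have i0 o : 0 <= s * (\1_D o : R) by rewrite mulr_ge0// ltW.
  have D0 o : 0 <= (\1_D o : R) by [].
  rewrite (ExD P (measurable_cst A) m1 (fun=> A0) i0) Ex_cst.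
  have mi : measurable_fun setT (\1_D : O -> R) by exact: measurable_indic.
  by rewrite (ExZl P mi (ltW s0) D0) (Ex_indic P mD) [in LHS](fineP P mD).
have mcE : measurable_fun setT (fun o => c * expR (- th * X o)).
  by apply: measurable_funM; [exact: measurable_cst|exact: mE].
have cE0 o : 0 <= c * expR (- th * X o) by rewrite mulr_ge0// expR_ge0.
have E3 : (Ex P (fun o => A + s * \1_D o)%R <= Ex P (fun o => (X o + c * expR (- th * X o))%R))%E.
  apply: le_Ex.
  - apply: measurable_funD; first exact: measurable_cst.
    by apply: measurable_funM; [exact: measurable_cst|exact: measurable_indic].
  - by apply: measurable_funD; [exact: mX|exact: mcE].
  - by move=> o; rewrite addr_ge0// mulr_ge0// ltW.
  - move=> o; rewrite /c -mulrA -expRD mulNr -mulrBr.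
    have ex : 0 <= th^-1 * expR (th * (A - X o)) by rewrite mulr_ge0 ?expR_ge0// invr_ge0 ltW.
    rewrite indicE; case: (boolP (o \in D)) => oD.
      by move: oD; rewrite inE /D /= -/(X o) => oD; rewrite mulr1; lra.
    rewrite mulr0 addr0 addrC -lerBlDr ler_pdivlMl//.
    by apply: le_trans (expR_ge1Dx _); rewrite lerDr.
move: E3; rewrite E1 (ExD P mX mcE X0 cE0).
move=> /le_trans -/(_ _ (leeD (le_refl _) E2)); rewrite EX -EFinD lee_fin => fin.
rewrite (fineP P mD) lee_fin ler_pdivlMr// mulrC; lra.
Qed.
End upper.

(** The fourth power of [x / 4 <= expR (x / 4)]; a power 4 suffices against the number of boundary
    points, which is quadratic. *)
Lemma expRN_le4 (R : realType) (x : R) : 0 < x -> expR (- x) <= 4 ^+ 4 / x ^+ 4.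
Proof.
move=> x0; have h : x / 4 <= expR (x / 4).
  by apply: le_trans (expR_ge1Dx _); rewrite lerDr.
have q0 : 0 < x / 4 by rewrite divr_gt0.
have : (x / 4) ^+ 4 <= expR (x / 4) ^+ 4 by rewrite ler_pXn2r// nnegrE ?expR_ge0 ?ltW.
rewrite -expRM_natl (_ : 4%:R * (x / 4) = x); last by field.
rewrite expr_div_n expRN => H.
by rewrite -[leRHS]invf_div lef_pV2 ?posrE ?expR_gt0// divr_gt0// exprn_gt0.
Qed.

Lemma size_box_le r : (0 < r)%N -> ((r + r).+1 ^ 2 <= (3 * r) ^ 2)%N.
Proof. by move=> r0; rewrite leq_exp2r//; lia. Qed.

(** * Upper tails, free and confined to a box *)

Section box_upper.
Variable R : realType.
Notation W := (weights R {fset Z2}).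
Context d (O : measurableType d) (P : probability O R).
Variable Y : O -> W.
Hypothesis iY : iid P edges Y.
Variable G : Z2 -> R.
Hypothesis Glim : forall x, {ae P, forall o,
  (fun m : nat => ptime setT (Y o) 0 (x *+ m) / m%:R) @ \oo --> G x}.
Hypothesis hG : lattice_norm G.
Notation h := (h P Y).
Notation G1 := (G (pt 1 0)).
Variable a : R.
Hypothesis a0 : 0 < a < 2^-1.
Notation al := (2^-1 + a).

Let Y0 o e : 0 <= Y o e. Proof. exact: (iid_ge0 iY). Qed.

(** [upper_markov] with [th = m^(-1/2)] and [A = m G1]: then [th ^ 2 * A = G1], so the exponential
    correction is [expR G1 * m^(1/2)], and [h - A] is bounded by [h_upper]. *)
Lemma upper_tau (eta : R) : 0 < eta -> exists2 C : R, 0 < C &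
  forall m : nat, (0 < m)%N ->
  (P [set o | (m%:R * G1 + C * m%:R `^ al < ptime setT (Y o) 0%R (pt m%:Z 0))%R] <= eta%:E)%E.
Proof.
move=> eta0; have [C C0 hC] := h_upper iY Glim hG a0.
have g1 := g_e1 hG.
pose K := C + expR G1.
have K0 : 0 < K by rewrite ltr_wpDl// expR_gt0.
exists (K / eta) => [|m m0]; first exact: divr_gt0.
have mR : 0 < m%:R :> R by rewrite ltr0n.
pose q : R := m%:R `^ (2^-1).
have q0 : 0 < q by rewrite powR_gt0.
have qq : q * q = m%:R by rewrite -powRD ?gt_eqF ?implybT// (_ : _ + _ = 1) ?powRr1 ?ler0n//; lra.
have th0 : 0 < q^-1 by rewrite invr_gt0.
have ma : 0 < m%:R `^ al :> R by rewrite powR_gt0.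
have s0 : 0 < K / eta * m%:R `^ al by rewrite mulr_gt0// divr_gt0.
have A0 : 0 <= m%:R * G1 by rewrite mulr_ge0// ltW.
have Ah : m%:R * G1 <= h (pt m%:Z 0).
  by rewrite -(g_mulrn hG) pt_mulrn; exact: (G_le_h iY Glim).
apply: (le_trans (upper_markov iY th0 A0 s0 Ah)).
have -> : K / eta * m%:R `^ al = K * m%:R `^ al / eta by rewrite mulrAC.
rewrite lee_fin ler_pdivrMr ?divr_gt0 ?mulr_gt0// [leRHS]mulrC divfK ?gt_eqF// invrK.
have -> : q^-1 ^+ 2 * (m%:R * G1) = G1 by rewrite -qq expr2; field; rewrite gt_eqF.
rewrite /K mulrDl lerD//; first by rewrite lerBlDl hC.
rewrite mulrC ler_pM2l ?expR_gt0//; apply: ler_powR; first by rewrite ler1n.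
by case/andP: a0 => /ltW ? _; rewrite lerDl.
Qed.

(** [targets r r] is the boundary of the box. Each of its points has mean at least [cg * r], and the
    lower tail is used at [th = 1], where [th / (1 + th) = 1 / 2]. *)
Lemma exit_box r (cg c : R) : (forall z, cg * (linf z)%:~R <= G z) ->
  (P [set o | exists2 v, v \in targets r r & (ptime setT (Y o) 0%R v <= c)%R] <=
   (((r + r).+1 ^ 2)%:R * expR (c - cg * r%:R / 2))%:E)%E.
Proof.
move=> hcg; pose A v := [set o | ptime setT (Y o) 0 v <= c].
have mA v : measurable (A v).
  rewrite (_ : A v = (fun o => ptime setT (Y o) 0 v) @^-1` `]-oo, c]); last first.
    by apply/seteqP; split => o; rewrite /A /= in_itv.
  by rewrite -[X in measurable X]setTI; apply: (measurable_ptime iY).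
apply: (le_trans (union_bound (P := P) mA (B := expR (c - cg * r%:R / 2)) _)); last first.
  by rewrite lee_fin ler_wpM2r ?expR_ge0// ler_nat size_targets.
move=> v; rewrite mem_targets => hv.
have lv : linf v = r%:Z.
  apply/eqP; case/andP: hv => h1 /orP[//|/eqP h2].
  by rewrite eq_le h1 /= /linf h2 le_max; apply/orP; left; lia.
have sub : inner_edges setT `<=` edges by exact: inner_edges_sub.
have hE : ((cg * r%:R)%:E <= Ex P (fun o => ptime setT (Y o) 0%R v))%E.
  rewrite (Ex_tau iY) subr0 lee_fin; apply: le_trans (G_le_h iY Glim v).
  by have := hcg v; rewrite lv -pmulrn.
apply: le_trans (ptime_lower_tail iY c sub (setT_walk 0 v) ltr01 hE) _.
by rewrite lee_fin ler_expR mul1r (_ : 1 + 1 = 2)// mul1r (mulrC 2^-1).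
Qed.

(** The slack 1 allows for a near-optimal walk, the infimum not being known to be attained. Such a
    walk stays in the box or reaches its boundary cheaply. *)
Lemma box_or_exit r (c : R) x o : (0 < r)%N ->
  c + 1 < ptime (ball_box 0 r%:Z) (Y o) 0 x ->
  c < ptime setT (Y o) 0 x \/
  exists2 v, v \in targets r r & ptime setT (Y o) 0 v <= c + 1.
Proof.
move=> r0 hb; case: (ltP c (ptime setT (Y o) 0 x)) => hc; [by left|right].
have [p hp tp] := ptime_approx (Y0 o) (setT_walk 0 x) ltr01.
have tc : path_time (Y o) 0 p < c + 1 by apply: lt_le_trans tp _; rewrite lerD2r.
have [pp lp _] := hp.
have f1 u v : adjacent u v -> linf (v - 0) <= linf (u - 0) + 1 by exact: linf_adjacent.
have f0 : linf ((0 : Z2) - 0) < r%:Z by rewrite subrr /linf !coordE normr0 gt_max; lia.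
have [hs|hs] := boolP (has (fun v => r%:Z <= linf (v - 0)) p).
  have [p1 [v [p2 [pe fv _]]]] := walks_splitf f1 pp f0 hs.
  exists v; first by rewrite mem_targets -fv subr0 lexx eqxx.
  have w1 : walks setT 0 v (rcons p1 v).
    split => //; last by rewrite last_rcons.
    by move: pp; rewrite pe -cat_rcons cat_path => /andP[].
  apply: le_trans (ptime_le (Y0 o) w1) _; apply: le_trans (ltW tc).
  by rewrite pe -cat_rcons path_time_cat lerDl path_time_ge0.
suff wb : walks (ball_box 0 r%:Z) 0 x p.
  by have := lt_trans (lt_le_trans hb (ptime_le (Y0 o) wb)) tc; rewrite ltxx.
split => // v; rewrite inE /ball_box /= => /orP[/eqP->|vp]; first exact: ltW.
by move/hasPn: hs => /(_ v vp); rewrite -ltNge => /ltW.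
Qed.

Lemma up_box : exists2 C1 : nat, (0 < C1)%N & forall eta : R, 0 < eta ->
  exists2 C2 : R, 0 < C2 & \forall m \near \oo,
  (P [set o | (m%:R * G1 + C2 * m%:R `^ al <
    ptime (ball_box 0 (C1 * m)%N%:Z) (Y o) 0%R (pt m%:Z 0))%R] <= eta%:E)%E.
Proof.
have [cg cg0 hcg] := ln_linf hG.
have g1 := g_e1 hG.
(* Chosen so that [c + 1 - cg * C1 * m / 2 <= m (G1 + 2) - m (G1 + 3) = - m] in the exponent of
   [exit_box]. *)
pose C1 := (Num.truncn ((G1 + 3) * 2 / cg)).+1.
have hC1 : (G1 + 3) * 2 <= cg * C1%:R.
  by rewrite -ler_pdivrMl// mulrC ltW// truncnS_gt.
exists C1 => // eta eta0.
have eta2 : 0 < eta / 2 by rewrite divr_gt0.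
have [C C0 hC] := upper_tau eta2.
exists (C + 1); first by rewrite addr_gt0.
have b0 : 0 < 1 - al by case/andP: a0; lra.
have al0 : 0 <= al by case/andP: a0; lra.
near=> m.
have m0 : (0 < m)%N by near: m; exact: nbhs_infty_gt.
have hm : C <= m%:R `^ (1 - al) by near: m; exact: near_powR.
(* [4608 = 2 * 3 ^ 2 * 4 ^ 4]: the squares come from the count [(3 C1 m) ^ 2], the fourth power from
   [expRN_le4], the factor 2 from [eta / 2]. *)
have hm2 : 4608 * C1%:R ^+ 2 / eta <= m%:R by near: m; exact: nbhs_infty_ger.
have mR : 0 < m%:R :> R by rewrite ltr0n.
have m1 : 1 <= m%:R :> R by rewrite ler1n.
set r := (C1 * m)%N; have r0 : (0 < r)%N by rewrite muln_gt0.
set c := m%:R * G1 + C * m%:R `^ al.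
have cm : c + 1 <= m%:R * (G1 + 2).
  have : C * m%:R `^ al <= m%:R.
    apply: (@le_trans _ _ (m%:R `^ (1 - al) * m%:R `^ al)); first by rewrite ler_wpM2r ?powR_ge0.
    by rewrite -powRD ?gt_eqF ?implybT// (_ : 1 - al + al = 1) ?powRr1 ?ler0n//; lra.
  rewrite /c mulrDr; lra.
pose A1 := [set o | c < ptime setT (Y o) 0 (pt m%:Z 0)].
pose B v := [set o | ptime setT (Y o) 0 v <= c + 1].
pose A2 := [set o | exists2 v, v \in targets r r & ptime setT (Y o) 0 v <= c + 1].
have mt v := measurable_ptime iY setT 0 v.
have mA1 : measurable A1.
  rewrite (_ : A1 = (fun o => ptime setT (Y o) 0 (pt m%:Z 0)) @^-1` `]c, +oo[); last first.
    by apply/seteqP; split => o; rewrite /A1 /= in_itv /= andbT.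
  by rewrite -[X in measurable X]setTI; apply: mt.
have mB v : measurable (B v).
  rewrite (_ : B v = (fun o => ptime setT (Y o) 0 v) @^-1` `]-oo, c + 1]); last first.
    by apply/seteqP; split => o; rewrite /B /= in_itv.
  by rewrite -[X in measurable X]setTI; apply: mt.
have mA2 : measurable A2 by exact: (measurable_exists mB).
have mD : measurable [set o | m%:R * G1 + (C + 1) * m%:R `^ al <
    ptime (ball_box 0 r%:Z) (Y o) 0%R (pt m%:Z 0)].
  rewrite (_ : mkset _ = (fun o => ptime (ball_box 0 r%:Z) (Y o) 0 (pt m%:Z 0)) @^-1`
     `]m%:R * G1 + (C + 1) * m%:R `^ al, +oo[); last first.
    by apply/seteqP; split => o; rewrite /= in_itv /= andbT.
  by rewrite -[X in measurable X]setTI; apply: (measurable_ptime iY).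
apply: (@le_trans _ _ (P (A1 `|` A2))).
  apply: le_measure; rewrite ?inE//; first exact: measurableU.
  move=> o /= ho; have [|h1|h2] := @box_or_exit r c (pt m%:Z 0) o r0; [|by left|by right].
  apply: le_lt_trans ho; rewrite /c mulrDl mul1r addrA lerD2l.
  exact: powR_ge1.
apply: (le_trans (measureU2 P mA1 mA2)).
rewrite (_ : eta = eta / 2 + eta / 2); last by field.
rewrite EFinD; apply: leeD; first exact: hC.
apply: (le_trans (exit_box r (c + 1) hcg)); rewrite lee_fin.
have ex : expR (c + 1 - cg * r%:R / 2) <= 4 ^+ 4 / m%:R ^+ 4.
  apply: le_trans (expRN_le4 mR); rewrite ler_expR /r natrM.
  have := ler_wpM2r (ltW mR) hC1; nra.
have sz : ((r + r).+1 ^ 2)%:R <= (3 * (C1%:R * m%:R)) ^+ 2 :> R.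
  rewrite -(natrM R C1 m) -(natrM R 3) -natrX ler_nat; exact: size_box_le.
apply: le_trans (ler_pM _ _ sz ex) _; rewrite ?ler0n ?expR_ge0//.
have -> : (3 * (C1%:R * m%:R)) ^+ 2 * (4 ^+ 4 / m%:R ^+ 4) = 2304 * C1%:R ^+ 2 / m%:R ^+ 2 :> R.
  by field; rewrite gt_eqF.
rewrite ler_pdivrMr ?exprn_gt0//.
have : 4608 * C1%:R ^+ 2 / eta <= m%:R ^+ 2.
  by apply: le_trans hm2 _; rewrite expr2 ler_pMr.
rewrite ler_pdivrMr//; lra.
Unshelve. all: end_near. Qed.
End box_upper.

(** * Representatives of edges modulo the period *)

Section torus_edges.
Variable n : nat.
Hypothesis n0 : (0 < n)%N.
Implicit Types (e : {fset Z2}) (x y z u v : Z2).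

Lemma shift_edgeD z z' e : shift_edge z' (shift_edge z e) = shift_edge (z + z') e.
Proof.
apply/fsetP => v; apply/imfsetP/imfsetP => -[/= u hu ->].
  by case/imfsetP: hu => /= u' hu' ->; exists u' => //; rewrite addrA.
by exists (u + z); rewrite ?addrA//; apply/imfsetP; exists u.
Qed.

Lemma shift_edge0 e : shift_edge 0 e = e.
Proof.
apply/fsetP => v; apply/imfsetP/idP => [[/= u hu ->]|hv]; first by rewrite addr0.
by exists v; rewrite ?addr0.
Qed.

Lemma shift_pair z u v : shift_edge z [fset u; v]%fset = [fset (u + z)%R; (v + z)%R]%fset.
Proof. exact: (imfset_pair (fun v => v + z)). Qed.

Lemma adjacent_shift z u v : adjacent (u + z) (v + z) = adjacent u v.
Proof. by have [h _] := isom_shift z; rewrite h. Qed.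

Lemma edges_shift z e : edges e -> edges (shift_edge z e).
Proof. by move=> he; apply: (edges_map _ he) => u v; rewrite adjacent_shift. Qed.

(** The representative of an edge modulo [n Z^2]; sets that are not edges are
    left unchanged. *)
Definition rho e : {fset Z2} :=
  xget e [set e' | torus_edges n e' /\ exists z, e' = shift_edge (z *+ n) e].

(** Normal form of an edge: [x] is its left or lower end, and [j] tells whether it is vertical. *)
Definition corner_edge x (j : bool) : {fset Z2} := [fset x; (x + pt (~~ j)%:Z j%:Z)%R]%fset.

Lemma corner_adjacent x j : adjacent x (x + pt (~~ j)%:Z j%:Z).
Proof.
apply/adjacentP; rewrite !coordE pt0 pt1; case: j; [right|left];
  by rewrite /= ?addr0; split => //; left.
Qed.

Lemma edge_corner e : edges e -> exists x j, e = corner_edge x j /\ x \in e.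
Proof.
case=> u [v [/adjacentP uv ->]].
have K x y j : xc y = xc x + (~~ j)%:Z -> yc y = yc x + j%:Z -> y = x + pt (~~ j)%:Z j%:Z.
  by move=> h1 h2; apply: Z2P; rewrite !coordE ?pt0 ?pt1.
case: uv => -[h1 [h2|h2]].
- by exists u, false; rewrite /corner_edge -(K u v false) ?h1 ?h2 ?addr0//; rewrite !inE eqxx.
- exists v, false; rewrite /corner_edge -(K v u false) /= ?h1 ?h2 ?addr0 ?subrK// !inE eqxx orbT; split => //.
  by apply/fsetP => q; rewrite !inE orbC.
- by exists u, true; rewrite /corner_edge -(K u v true) ?h1 ?h2 ?addr0//; rewrite !inE eqxx.
- exists v, true; rewrite /corner_edge -(K v u true) /= ?h1 ?h2 ?addr0 ?subrK// !inE eqxx orbT; split => //.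
  by apply/fsetP => q; rewrite !inE orbC.
Qed.

Lemma xc_mulrn z m : xc (z *+ m) = xc z * m%:Z.
Proof. by rewrite pmulrn pt_mulz pt0. Qed.

Lemma yc_mulrn z m : yc (z *+ m) = yc z * m%:Z.
Proof. by rewrite pmulrn pt_mulz pt1. Qed.

Lemma shift_to_box x : exists z, [/\ 0 <= xc (x + z *+ n) < n%:Z & 0 <= yc (x + z *+ n) < n%:Z].
Proof.
have nz : n%:Z != 0 by lia.
exists (pt (- (xc x %/ n%:Z)%Z) (- (yc x %/ n%:Z)%Z)).
rewrite !coordE xc_mulrn yc_mulrn pt0 pt1.
have h1 := divz_eq (xc x) n%:Z; have h2 := modz_ge0 (xc x) nz; have h3 := ltz_pmod (xc x) (d := n%:Z) ltac:(lia).
have h1' := divz_eq (yc x) n%:Z; have h2' := modz_ge0 (yc x) nz; have h3' := ltz_pmod (yc x) (d := n%:Z) ltac:(lia).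
move: h1 h2 h3 h1' h2' h3'; rewrite !mulNr.
move: (_ * _) (_ * _) (modz _ _) (modz _ _) => *; lia.
Qed.

Lemma torus_corner x j : 0 <= xc x < n%:Z -> 0 <= yc x < n%:Z -> torus_edges n (corner_edge x j).
Proof.
move=> hx hy; pose y := x + pt (~~ j)%:Z j%:Z.
have bE m v : box m v <-> 0 <= xc v <= m /\ 0 <= yc v <= m.
  split=> [h|[h1 h2] k]; first by split; [exact: (h 0)|exact: (h 1)].
  have [->|->] : k = 0 \/ k = 1 by case: k => -[|[|//]] i; [left|right]; exact: val_inj.
    exact: h1.
  exact: h2.
exists x, y; split => //; last by left; apply/bE; lia.
exists x, y; split => //; last exact: corner_adjacent.
  by apply/bE; lia.
by apply/bE; rewrite /y !coordE pt0 pt1; case: j {y}; rewrite /=; lia.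
Qed.

Lemma torus_edges_sub : torus_edges n `<=` edges.
Proof. by move=> e [x [y [[x' [y' [_ _ adj ->]]] _ _]]]; exists x', y'. Qed.

Lemma rho_spec e : edges e -> torus_edges n (rho e) /\ exists z, rho e = shift_edge (z *+ n) e.
Proof.
move=> he; have [x [j [-> _]]] := edge_corner he.
have [z [hx hy]] := shift_to_box x.
have := @xgetI _ (corner_edge x j) [set e' | torus_edges n e' /\
  exists z, e' = shift_edge (z *+ n) (corner_edge x j)] (corner_edge (x + z *+ n) j).
apply; split.
  exact: torus_corner.
by exists z; rewrite shift_pair /corner_edge addrAC.
Qed.

(** The set from which [xget] chooses depends on the orbit of [e] only and is nonempty, so the
    differing default values do not matter. *)
Lemma rho_shift z e : edges e -> rho (shift_edge (z *+ n) e) = rho e.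
Proof.
move=> he; rewrite /rho; set S := mkset _; set S' := mkset _.
have -> : S = S'.
  apply/seteqP; split => e' [h [z' E]]; split => //.
    by exists (z + z'); rewrite E shift_edgeD mulrnDl.
  by exists (z' - z); rewrite E shift_edgeD -mulrnDl addrC subrK.
have [h hz] := rho_spec he.
have ex : exists e', `[< S' e' >] by exists (rho e); apply/asboolP; split.
by rewrite /xget; case: pselect => // -[].
Qed.

(** Two distinct congruent edges would give two vertices of the window that differ by a nonzero
    multiple of [n], more than its width. *)
Lemma rho_inj x (r : nat) e e' : (r + r < n)%N ->
  inner_edges (ball_box x r%:Z) e -> inner_edges (ball_box x r%:Z) e' -> rho e = rho e' -> e = e'.
Proof.
move=> rn he he'.
have [_ [z hz]] := rho_spec (inner_edges_sub he); have [_ [z' hz']] := rho_spec (inner_edges_sub he').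
rewrite hz hz' => E.
have [u ue bu] : exists2 u, u \in e & ball_box x r%:Z u.
  by case: he => a [b [Va Vb _ ->]]; exists a; rewrite // !inE eqxx.
have : u + z *+ n \in shift_edge (z' *+ n) e' by rewrite -E; apply/imfsetP; exists u.
case/imfsetP => /= u' u'e' eu.
have bu' : ball_box x r%:Z u'.
  by case: he' => a [b [Va Vb _ E']]; move: u'e'; rewrite E' !inE => /orP[]/eqP->.
have zz : z = z'.
  have K (p q c s s' : int) : `|s - c| <= r%:Z -> `|s' - c| <= r%:Z ->
      s + p * n%:Z = s' + q * n%:Z -> p = q.
    move=> h1 h2 h3; have : `|(p - q) * n%:Z| < n%:Z by rewrite mulrBl; lia.
    rewrite normrM [X in _ * X]ger0_norm ?lez0_nat// => h4.
    have : `|p - q| < 1 by rewrite -(ltr_pM2r (x := n%:Z)) ?mul1r//; lia.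
    lia.
  move: bu bu'; rewrite /ball_box /= !linf_le !coordE => /andP[b1 b2] /andP[b3 b4].
  apply: Z2P.
    by apply: (K _ _ _ _ _ b1 b3); have := congr1 xc eu; rewrite !coordE !xc_mulrn.
  by apply: (K _ _ _ _ _ b2 b4); have := congr1 yc eu; rewrite !coordE !yc_mulrn.
have := congr1 (shift_edge (- (z' *+ n))) E; rewrite zz !shift_edgeD subrr !shift_edge0.
exact.
Qed.

Definition strip_edges (lo : int) (hgt : nat) : seq {fset Z2} :=
  undup [seq rho (corner_edge (pt p.1%:Z (lo + p.2.1%:Z)) p.2.2)
    | p <- [seq (i, q) | i <- iota 0 n, q <- [seq (k, b) | k <- iota 0 hgt, b <- [:: true; false]]]].

Lemma size_strip_edges lo hgt : (size (strip_edges lo hgt) <= n * (hgt * 2))%N.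
Proof.
by apply: leq_trans (size_undup _) _; rewrite size_map !size_allpairs !size_iota.
Qed.

Lemma strip_edges_sub lo hgt e : e \in strip_edges lo hgt -> torus_edges n e.
Proof.
rewrite mem_undup => /mapP[p _ ->].
have ce : edges (corner_edge (pt p.1%:Z (lo + p.2.1%:Z)) p.2.2).
  eexists; eexists; split; last reflexivity.
  exact: corner_adjacent.
by case: (rho_spec ce).
Qed.

Lemma mem_strip_edges lo (hgt : nat) e :
  inner_edges [set v | lo <= yc v < lo + hgt%:Z] e -> rho e \in strip_edges lo hgt.
Proof.
move=> he; have ed := inner_edges_sub he.
have [x [j [ee xe]]] := edge_corner ed.
have hx : lo <= yc x < lo + hgt%:Z.
  by case: he => u [v [Vu Vv _ E]]; move: xe; rewrite E !inE => /orP[]/eqP->.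
have [z [h1 _]] := shift_to_box x.
(* Only the horizontal part of the translation is used, since the row must stay in the strip. *)
pose z' := pt (xc z) 0.
have xz : x + z' *+ n = pt (absz (xc (x + z *+ n)))%:Z (lo + (absz (yc x - lo))%:Z).
  apply: Z2P; rewrite !coordE ?pt0 ?pt1 ?xc_mulrn ?yc_mulrn ?pt0 ?pt1.
    by move: h1; rewrite !coordE xc_mulrn; lia.
  by lia.
rewrite -(rho_shift z' ed) ee mem_undup; apply/mapP.
exists (absz (xc (x + z *+ n)), (absz (yc x - lo), j)); last first.
  by rewrite /= -xz /corner_edge shift_pair addrAC.
apply/allpairsP; exists (absz (xc (x + z *+ n)), (absz (yc x - lo), j)); split => //.
  by rewrite mem_iota; cbn [fst]; lia.
apply/allpairsP; exists (absz (yc x - lo), j); split => //; first by rewrite mem_iota; cbn [fst]; lia.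
by case: (j).
Qed.

End torus_edges.

Lemma iid_exp1_ae_ge0 (R : realType) (I : countType) d (O : measurableType d)
    (P : probability O R) (D : set I) (X : I -> {RV P >-> R}) :
  iid_exp1 D X -> {ae P, forall o, forall i, D i -> 0 <= X i o}.
Proof.
case=> _ hX.
have H (k : nat) : {ae P, forall o, forall i, choice.unpickle k = Some i -> D i -> 0 <= X i o}.
  case E : (choice.unpickle k) => [i|]; last by apply: aeW => o j.
  have [Di|nDi] := pselect (D i); last by apply: aeW => o j [<-] /nDi.
  exists (X i @^-1` `]-oo, 0[); split.
  - by rewrite -[X in measurable X]setTI; apply: measurable_funP.
  - have := hX i Di `]-oo, 0[%classic (measurable_itv _).
    rewrite /distribution /pushforward => ->.
    have := @exp1_max0 R `]-oo, 0[%classic (measurable_itv _).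
    rewrite (_ : mkset _ = set0) ?measure0 => [<-//|].
    by apply/seteqP; split => s //=; rewrite in_itv /= gt_max ltxx andbF.
  - move=> o /= ho; rewrite in_itv /= ltNge; apply/negP => h; apply: ho => j [<-] _; exact: h.
have := ae_foralln H; apply: filterS => o h i Di.
by apply: (h (choice.pickle i) i) => //; rewrite choice.pickleK.
Qed.

(** * The torus time as an infimum over walks *)

Section torus_walks.
Variables (R : realType) (n : nat).
Notation W := (weights R {fset Z2}).
Implicit Types (w : {fset Z2} -> R) (x z v : Z2) (p : seq Z2).

Definition torus_walk x p := xc x = 0 /\ walks setT x (x + e1 *+ n) p.

Lemma e1E : e1 *+ n = pt n%:Z 0 :> Z2.
Proof.
by rewrite -pt_mulrn; congr (_ *+ _); apply: Z2P; rewrite ?pt0 ?pt1 /xc /yc /e1 mxE.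
Qed.

Let lbt w : (forall e, 0 <= w e) ->
  has_lbound [set passage_time w x (x + e1 *+ n) | x in [set x : Z2 | x 0 0 = 0]].
Proof. by move=> w0; exists 0 => _ [x _ <-]; rewrite passage_timeE ptime_ge0. Qed.

Lemma torus_time_le w x p : (forall e, 0 <= w e) -> torus_walk x p ->
  torus_time n w <= path_time w x p.
Proof.
move=> w0 [hx hp]; apply: (@le_trans _ _ (passage_time w x (x + e1 *+ n))).
  by apply: ge_inf; [exact: lbt|exists x].
by rewrite passage_timeE; exact: ptime_le.
Qed.

Lemma torus_time_approx w eps : (forall e, 0 <= w e) -> 0 < eps ->
  exists x p, torus_walk x p /\ path_time w x p < torus_time n w + eps.
Proof.
move=> w0 e0; have e2 : 0 < eps / 2 by rewrite divr_gt0.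
have hi : has_inf [set passage_time w x (x + e1 *+ n) | x in [set x : Z2 | x 0 0 = 0]].
  split; last exact: lbt.
  by exists (passage_time w 0 (0 + e1 *+ n)); exists 0 => //=; rewrite mxE.
have [_ [x hx <-] h1] := inf_adherent e2 hi.
have [p hp h2] := ptime_approx w0 (setT_walk x (x + e1 *+ n)) e2.
exists x, p; split => //; move: h1; rewrite passage_timeE -/(torus_time n w); lra.
Qed.

Lemma torus_time_ge w c : (forall x p, torus_walk x p -> c <= path_time w x p) ->
  c <= torus_time n w.
Proof.
move=> H; apply: lb_le_inf.
  by exists (passage_time w 0 (0 + e1 *+ n)); exists 0 => //=; rewrite mxE.
move=> _ [x hx <-]; rewrite passage_timeE; apply: ptime_ge; first exact: setT_walk.
by move=> p hp; apply: H.
Qed.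

Lemma torus_time_lt w c : (forall e, 0 <= w e) ->
  torus_time n w < c <-> exists x p, torus_walk x p /\ path_time w x p < c.
Proof.
move=> w0; split=> [h|[x [p [h1 h2]]]]; last exact: le_lt_trans (torus_time_le w0 h1) h2.
have c0 : 0 < c - torus_time n w by rewrite subr_gt0.
have [x [p [h1 h2]]] := torus_time_approx w0 c0.
by exists x, p; split => //; move: h2; rewrite addrC subrK.
Qed.
End torus_walks.

(** * Random weights on the torus *)

Section torus_weights.
Variables (R : realType) (n : nat).
Hypothesis n0 : (0 < n)%N.
Notation W := (weights R {fset Z2}).
Context d (O : measurableType d) (P : probability O R) (t : {fset Z2} -> {RV P >-> R}).
Hypothesis ht : torus_weights n t.
Implicit Types (x z v : Z2) (p : seq Z2).

Definition tw : O -> W := fun o e => Num.max (t e o) 0.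

Lemma iid_tw : iid P (torus_edges n) tw.
Proof. by case: ht => h _; exact: iid_base. Qed.

Lemma tw_ge0 o e : 0 <= tw o e.
Proof. by rewrite /tw le_max lexx orbT. Qed.

Lemma measurable_tw e : measurable_fun setT (fun o => tw o e).
Proof.
have [m _ _] := iid_tw.
exact: (measurableT_comp (@measurable_coord R _ e) m).
Qed.

Lemma tw_shift o z e : edges e -> tw o (shift_edge (z *+ n) e) = tw o e.
Proof. by move=> he; rewrite /tw; case: ht => _ per; rewrite per. Qed.

Lemma tw_rho o e : tw o (rho n e) = tw o e.
Proof.
have [he|he] := pselect (edges e).
  by have [_ [z ->]] := rho_spec n0 he; exact: tw_shift.
(* For a set that is not an edge there is no candidate, a translate of a torus edge being an edge,
   so [rho e = e]. *)
rewrite /rho /xget; case: pselect => [H|//]; exfalso.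
case: H => e' /asboolP [te [z E]]; apply: he.
have -> : e = shift_edge (- (z *+ n)) e' by rewrite E shift_edgeD subrr shift_edge0.
by apply: edges_shift; exact: torus_edges_sub te.
Qed.

(** By [rho_inj] distinct edges of the window read distinct torus weights. *)
Lemma iid_window x (r : nat) : (r + r < n)%N -> iid P (inner_edges (ball_box x r%:Z)) tw.
Proof.
move=> rn.
have := @iid_comp R _ _ _ _ P (torus_edges n) (inner_edges (ball_box x r%:Z)) tw (rho n) iid_tw.
rewrite (_ : (fun o i => _) = tw); last by apply/funext => o; apply/funext => e; rewrite tw_rho.
apply=> [e he|e e' he he']; first by case: (rho_spec n0 (inner_edges_sub he)).
exact: (rho_inj n0 rn he he').
Qed.

Lemma path_time_shift o z x y p : walks setT x y p ->
  path_time (tw o) (x + z *+ n) [seq v + z *+ n | v <- p] = path_time (tw o) x p.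
Proof.
move=> hp; rewrite -(path_time_map (fun v => v + z *+ n) (tw o)).
by apply: (path_time_inner hp) => e he; exact: (tw_shift o z (inner_edges_sub he)).
Qed.

Lemma walks_shift V z x y p : walks V x y p ->
  walks [set v | V (v - z)] (x + z) (y + z) [seq v + z | v <- p].
Proof.
by apply: (walks_map (phi := fun v => v + z)) => [a b|v Vv]; rewrite ?adjacent_shift//= addrK.
Qed.

Lemma ptime_shift o z x y (r : int) :
  ptime (ball_box (x + z *+ n) r) (tw o) (x + z *+ n) (y + z *+ n) =
  ptime (ball_box x r) (tw o) x y.
Proof.
have [adj [psi c1 c2]] := isom_shift (z *+ n).
rewrite -(@ptime_map R _ psi (ball_box x r) (ball_box (x + z *+ n) r) (tw o) x y adj c1 c2).
  by apply: ptime_inner => e he; exact: (tw_shift o z (inner_edges_sub he)).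
by move=> v; rewrite /ball_box /= opprD addrACA subrr addr0.
Qed.

Definition ttime (o : O) : R := torus_time n (tw o).

Lemma measurable_path_time x p : measurable_fun setT (fun o => path_time (tw o) x p).
Proof. by apply: measurable_sum => e; exact: measurable_tw. Qed.

(** Pairs of a starting point and a finite sequence are countable, so the event is a countable
    union. *)
Lemma measurable_exists_walk (Q : Z2 -> seq Z2 -> Prop) d' (O' : measurableType d')
    (f : Z2 -> seq Z2 -> O' -> R) (g : O' -> R) :
  (forall x p, measurable_fun setT (f x p)) -> measurable_fun setT g ->
  measurable [set o | exists x p, Q x p /\ f x p o < g o].
Proof.
move=> mf mg.
pose A (k : nat) : set O' := if choice.unpickle k is Some (x, p) then
  if `[< Q x p >] then [set o | f x p o < g o] else set0 else set0.
rewrite (_ : mkset _ = \bigcup_k A k).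
  apply: bigcupT_measurable => k; rewrite /A; case: (choice.unpickle k) => [[x p]|//].
  case: ifP => // _.
  rewrite (_ : mkset _ = (f x p \- g) @^-1` `]-oo, 0[); last first.
    by apply/seteqP; split => o; rewrite /= in_itv /= subr_lt0.
  by rewrite -[X in measurable X]setTI; apply: (measurable_funB (mf x p) mg).
apply/seteqP; split => o /=.
  case=> x [p [q h]]; exists (choice.pickle (x, p)) => //; rewrite /A choice.pickleK.
  by rewrite (asboolT q).
case=> k _; rewrite /A; case: (choice.unpickle k) => [[x p]|//]; case: asboolP => // q h.
by exists x, p.
Qed.

Lemma measurable_ttime : measurable_fun setT ttime.
Proof.
apply: (measurability _ (RGenInftyO.measurableE R)) => _ [_ [c ->] <-].
rewrite setTI (_ : _ @^-1` _ = [set o | exists x p, torus_walk n x p /\ path_time (tw o) x p < c]).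
  apply: (@measurable_exists_walk (torus_walk n) _ O (fun x p o => path_time (tw o) x p)
    (fun=> c)); [exact: measurable_path_time|exact: measurable_cst].
apply/seteqP; split => o /=; rewrite in_itv /=.
  by move/(torus_time_lt _ _ (tw_ge0 o)).
by move=> h; apply/(torus_time_lt _ _ (tw_ge0 o)).
Qed.

(** Almost surely the weights of all representatives are nonnegative, and periodicity spreads this
    to all edges. *)
Lemma T_tor_ae : {ae P, forall o, T_tor n t o = ttime o}.
Proof.
case: ht => /iid_exp1_ae_ge0 h per; apply: filterS h => o h.
rewrite /T_tor /ttime /torus_time; congr inf; apply/eq_imagel => x hx.
rewrite !passage_timeE /ptime; congr inf; apply/eq_imagel => p hp.
apply: (path_time_inner hp) => e /inner_edges_sub he.
rewrite /tw max_l//; have [te [z hz]] := rho_spec n0 he.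
by have := h _ te; rewrite hz per.
Qed.
End torus_weights.

(** * Chaining local lower bounds along a walk *)

Section walk_lower.
Variables (R : realType) (G : Z2 -> R).
Hypothesis hG : lattice_norm G.

(** The walk is cut where it first reaches distance [r] from the last cut point. Such a piece is
    charged without additive error, by the second branch of the hypothesis; only the final piece may
    be short and costs [u]. *)
Lemma walk_lower (w : {fset Z2} -> R) (k u : R) (r : nat) : (0 < r)%N -> 0 <= k -> 0 <= u ->
  (forall e, 0 <= w e) ->
  (forall a b, linf (b - a) <= r%:Z ->
     k * G (b - a) - (if linf (b - a) < r%:Z then u else 0) <= ptime (ball_box a r%:Z) w a b) ->
  forall p a b, walks setT a b p -> k * G (b - a) - u <= path_time w a p.
Proof.
move=> r0 k0 u0 w0 H p; have [m] := ubnP (size p); elim: m p => // m ih p pm a b hp.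
have [pp lp _] := hp.
have f1 y v : adjacent y v -> linf (v - a) <= linf (y - a) + 1 by exact: linf_adjacent.
have f0 : linf (a - a) < r%:Z by rewrite subrr /linf !coordE normr0 gt_max; lia.
have [hs|hs] := boolP (has (fun v => r%:Z <= linf (v - a)) p).
  have [p1 [v [p2 [pe fv hv]]]] := walks_splitf f1 pp f0 hs.
  have w1 : walks (ball_box a r%:Z) a v (rcons p1 v).
    split; last by move=> y; rewrite -rcons_cons mem_rcons inE => /orP[/eqP->|/hv/ltW//];
      rewrite /ball_box /= fv.
      by move: pp; rewrite pe -cat_rcons cat_path => /andP[].
    by rewrite last_rcons.
  have w2 : walks setT v b p2.
    split => //; last by move: lp; rewrite pe last_cat.
    by move: pp; rewrite pe cat_path => /andP[_ /=/andP[]].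
  have s2 : (size p2 < m)%N.
    move: pm; rewrite pe size_cat /=; lia.
  have h2 := ih _ s2 _ _ w2.
  have fv' : linf (v - a) <= r%:Z by rewrite fv.
  have h1 := le_trans (H a v fv') (ptime_le w0 w1).
  rewrite fv ltxx subr0 in h1.
  rewrite pe -cat_rcons path_time_cat last_rcons.
  have tri : G (b - a) <= G (v - a) + G (b - v).
    by apply: le_trans (g_add hG _ _); rewrite [v - a + _]addrC addrA subrK.
  have := ler_wpM2l k0 tri; rewrite mulrDr; lra.
have wb : walks (ball_box a r%:Z) a b p.
  split => // v; rewrite inE /ball_box /= => /orP[/eqP->|vp]; first exact: ltW.
  by move/hasPn: hs => /(_ v vp); rewrite -ltNge => /ltW.
have lb : linf (b - a) <= r%:Z.
  by case: wb => _ <- hb; apply: hb; exact: mem_last.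
apply: le_trans (le_trans (H a b lb) (ptime_le w0 wb)).
by rewrite lerD2l lerN2; case: ifP.
Qed.
End walk_lower.

(** * Comparison of windows with the plane and upper bound for the torus time *)

Section torus_bounds.
Variable R : realType.
Notation W := (weights R {fset Z2}).
Context d0 (O0 : measurableType d0) (P0 : probability O0 R).
Variable Y : O0 -> W.
Hypothesis iY : iid P0 edges Y.
Variable G : Z2 -> R.
Hypothesis Glim : forall x, {ae P0, forall o,
  (fun m : nat => ptime setT (Y o) 0 (x *+ m) / m%:R) @ \oo --> G x}.
Hypothesis hG : lattice_norm G.
Notation G1 := (G (pt 1 0)).
Variable a : R.
Hypothesis a0 : 0 < a < 2^-1.
Notation al := (2^-1 + a).

Lemma window_law n d (O : measurableType d) (P : probability O R) (t : {fset Z2} -> {RV P >-> R})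
    x y (r : nat) (c : R) : (0 < n)%N -> torus_weights n t -> (r + r < n)%N ->
  P [set o | c < ptime (ball_box x r%:Z) (tw t o) x y] =
  P0 [set o | c < ptime (ball_box 0 r%:Z) (Y o) 0 (y - x)].
Proof.
move=> n0 ht rn; set V := ball_box x r%:Z.
have i1 := iid_window n0 ht x rn.
pose Y' o : W := map_weight (fun v => v - x) (Y o).
have i2 : iid P0 edges Y' by exact: (iid_map iY (isom_shift (- x))).
have i3 : iid P0 (inner_edges V) Y' by apply: (iid_sub i2); exact: (@inner_edges_sub V).
pose B : set W := [set w | c < ptimep V x y w].
have mB : measurable B.
  rewrite (_ : B = ptimep V x y @^-1` `]c, +oo[); last first.
    by apply/seteqP; split => w; rewrite /B /= in_itv /= andbT.
  by rewrite -[X in measurable X]setTI; apply: measurable_ptimep.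
have dB : depends_on (inner_edges V) (fun w => w \in B).
  move=> w w' h; have e := depends_ptimep (V := V) x y h.
  by apply/idP/idP; rewrite !inE /B /= e.
have := iid_law i1 i3 mB dB.
have [adj [psi c1 c2]] := isom_shift (- x).
rewrite (_ : [set o | B (tw t o)] = [set o | c < ptime V (tw t o) x y]); last first.
  by apply/seteqP; split => o; rewrite /B /= (ptimepE i1).
rewrite (_ : [set o | B (Y' o)] = [set o | c < ptime (ball_box 0 r%:Z) (Y o) 0 (y - x)])//.
have e o : ptimep V x y (Y' o) = ptime (ball_box 0 r%:Z) (Y o) 0 (y - x).
  rewrite (ptimepE i3) (@ptime_map R _ psi V (ball_box 0 r%:Z) (Y o) x y adj c1 c2) ?subrr//.
  by move=> v; rewrite /V /ball_box /= subr0.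
by apply/seteqP; split => o; rewrite /B /= e.
Qed.

(** In the window the weights have the law of the plane, where confinement only raises the passage
    time and [G_le_h] bounds its mean. *)
Lemma window_mean n d (O : measurableType d) (P : probability O R) (t : {fset Z2} -> {RV P >-> R})
    x y (r : nat) : (0 < n)%N -> torus_weights n t -> (r + r < n)%N -> linf (y - x) <= r%:Z ->
  ((G (y - x))%:E <= Ex P (fun o => ptime (ball_box x r%:Z) (tw t o) x y))%E.
Proof.
move=> n0 ht rn hy; set V := ball_box x r%:Z.
have i1 := iid_window n0 ht x rn.
have i3 : iid P0 (inner_edges V) Y by apply: (iid_sub iY); exact: (@inner_edges_sub V).
rewrite (iid_Ex_ptime x y i1 i3 (@subset_refl _ _)).
apply: (@le_trans _ _ (Ex P0 (fun o => ptime setT (Y o) x y))).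
  by rewrite (Ex_tau iY) lee_fin; exact: (G_le_h iY Glim).
have Y0 o e : 0 <= Y o e by exact: (iid_ge0 iY).
have ne : walks V x y !=set0.
  by apply: ball_walk; rewrite /ball_box /= ?subrr// /linf !coordE normr0 maxxx.
apply: le_Ex; [exact: (measurable_ptime iY)|exact: (measurable_ptime iY)| |] => o.
  exact: ptime_ge0.
exact: ptimeS.
Qed.

(** The axis from 0 to [(n, 0)] is cut into a fixed number [K = 4 C1] of pieces, short enough for
    the boxes of [up_box] to fit into windows. Each piece fails with probability at most
    [1 / (4 K)]. *)
Lemma torus_upper : exists2 C : R, 0 < C & \forall n \near \oo,
  forall d (O : measurableType d) (P : probability O R) (t : {fset Z2} -> {RV P >-> R}),
  torus_weights n t ->
  (P [set o | (n%:R * G1 + C * n%:R `^ al < ttime n t o)%R] <= (4^-1)%:E)%E.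
Proof.
have [C1 C10 H] := up_box iY Glim hG a0.
pose K := (4 * C1)%N; have K0 : (0 < K)%N by rewrite muln_gt0.
have KR : 0 < K%:R :> R by rewrite ltr0n.
have eta0 : 0 < (4 * K%:R)^-1 :> R by rewrite invr_gt0 mulr_gt0.
have [C2 C20 [N _ hN]] := H _ eta0.
have al0 : 0 <= al by case/andP: a0; lra.
exists (K%:R * C2); first by rewrite mulr_gt0.
near=> n => d O P t ht.
have n1 : (K * (N + 1) < n)%N by near: n; exact: nbhs_infty_gt.
have n0 : (0 < n)%N by apply: leq_ltn_trans n1.
(* Consecutive cut points differ by [n / K] up to 1, so a box of radius [C1 * m i] has width about
   [n / 2]. *)
pose x i := ((i * n) %/ K)%N.
pose m i := (x i.+1 - x i)%N.
have NK : (N < n %/ K)%N by rewrite -addn1 leq_divRL// mulnC ltnW.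
have xS i : (x i + n %/ K <= x i.+1 <= x i + n %/ K + 1)%N.
  rewrite /x mulSn (divnD n (i * n) K0).
  by move: (nat_of_bool _) (leq_b1 (K <= n %% K + (i * n) %% K)%N) => b hb; apply/andP; split; lia.
have mi i : x i.+1 = (x i + m i)%N by rewrite /m; have := xS i; lia.
have mN i : (N <= m i)%N by rewrite /m; have := xS i; lia.
have mn i : (m i <= n %/ K + 1)%N by rewrite /m; have := xS i; lia.
have nK : (4 * C1 * (n %/ K) <= n)%N by rewrite mulnC leq_divM.
have ri i : (C1 * m i + C1 * m i < n)%N.
  have : (K < n)%N by apply: leq_ltn_trans n1; rewrite leq_pmulr// addn1.
  have : (C1 * m i <= C1 * (n %/ K) + C1)%N by rewrite -mulnSr leq_mul2l -addn1 mn orbT.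
  rewrite /K; lia.
have mn' i : (m i <= n)%N.
  have := ri i; have : (m i <= C1 * m i)%N by rewrite leq_pmull.
  lia.
pose q i : Z2 := pt (x i)%:Z 0.
have qS i : q i.+1 - q i = pt (m i)%:Z 0.
  by apply: Z2P; rewrite !coordE !(pt0, pt1) ?subrr// mi; lia.
pose A i := [set o | (m i)%:R * G1 + C2 * (m i)%:R `^ al <
  ptime (ball_box (q i) (C1 * m i)%N%:Z) (tw t o) (q i) (q i.+1)].
have w0 o e : 0 <= tw t o e by exact: tw_ge0.
have mA i : measurable (A i).
  rewrite (_ : A i = (fun o => ptime (ball_box (q i) (C1 * m i)%N%:Z) (tw t o) (q i) (q i.+1))
     @^-1` `](m i)%:R * G1 + C2 * (m i)%:R `^ al, +oo[); last first.
    by apply/seteqP; split => o; rewrite /A /= in_itv /= andbT.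
  by rewrite -[X in measurable X]setTI; apply: (measurable_ptime (iid_tw ht)).
have PA i : i \in iota 0 K -> (P (A i) <= ((4 * K%:R)^-1)%:E)%E.
  move=> _; rewrite /A (window_law _ _ _ n0 ht (ri i)) qS.
  exact: (hN (m i) (mN i)).
have -> : 4^-1 = (size (iota 0 K))%:R * (4 * K%:R)^-1 :> R.
  by rewrite size_iota invfM mulrCA divff ?mulr1// gt_eqF.
apply: le_trans (union_bound (P := P) mA PA).
apply: le_measure; rewrite ?inE.
- rewrite (_ : mkset _ = ttime n t @^-1` `]n%:R * G1 + K%:R * C2 * n%:R `^ al, +oo[); last first.
    by apply/seteqP; split => o; rewrite /= in_itv /= andbT.
  by rewrite -[X in measurable X]setTI; apply: (measurable_ttime ht).
- exact: measurable_exists.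
move=> o /= ho; apply: contrapT => nA.
have step k : (k <= K)%N ->
    ptime setT (tw t o) 0 (q k) <= (x k)%:R * G1 + k%:R * (C2 * n%:R `^ al).
  elim: k => [_|k ih kK].
    rewrite /q /x mul0n div0n !mul0r addr0.
    have -> : pt 0 0 = 0 by apply: Z2P; rewrite !(coordE, pt0, pt1).
    have wn : walks setT 0 0 [::] by split.
    by apply: le_trans (ptime_le (w0 o) wn) _; rewrite /path_time big_nil.
  have {}ih := ih (ltnW kK).
  have hk : ptime (ball_box (q k) (C1 * m k)%N%:Z) (tw t o) (q k) (q k.+1) <=
      (m k)%:R * G1 + C2 * (m k)%:R `^ al.
    rewrite leNgt; apply/negP => hA; apply: nA; exists k => //.
    by rewrite mem_iota add0n.
  have ne : walks (ball_box (q k) (C1 * m k)%N%:Z) (q k) (q k.+1) !=set0.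
    apply: ball_walk; rewrite /ball_box /=; first by rewrite subrr /linf !coordE normr0 maxxx.
    rewrite qS linf_le pt0 pt1 normr0; have : (m k <= C1 * m k)%N by rewrite leq_pmull.
    lia.
  have t1 := ptime_triangle (w0 o) (setT_walk 0 (q k)) (setT_walk (q k) (q k.+1)).
  have t2 := ptimeS (w0 o) (@subsetT _ _) ne.
  have pw : (m k)%:R `^ al <= n%:R `^ al :> R.
    by apply: ge0_ler_powR; rewrite ?nnegrE ?ler0n// ler_nat.
  have pw' := ler_wpM2l (ltW C20) pw.
  rewrite mi natrD (mulrS 1) !mulrDl mul1r.
  apply: le_trans t1 _; apply: le_trans (lerD ih (le_trans t2 hk)) _.
  rewrite addrACA lerD2l addrC lerD2r//.
move: ho; rewrite ltNge => /negP; apply.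
have := step K (leqnn K); rewrite /x mulnC mulnK// mulrA; apply: le_trans.
apply: ptime_ge; first exact: setT_walk.
move=> p hp; apply: (torus_time_le (w0 o)); split; first by rewrite xc0.
by rewrite add0r e1E; move: hp; rewrite /q /x mulnC mulnK.
Unshelve. all: end_near. Qed.
End torus_bounds.

Lemma absz_lt (v : int) (n : nat) : 0 <= v -> v < n%:Z -> (absz v < n)%N.
Proof. by lia. Qed.

Definition box_list (r : nat) : seq Z2 :=
  [seq pt (i%:Z - r%:Z) (j%:Z - r%:Z) | i <- iota 0 (r + r).+1, j <- iota 0 (r + r).+1].

Lemma mem_box_list r z : (z \in box_list r) = (linf z <= r%:Z).
Proof.
apply/idP/idP.
  case/allpairsP => q [hi hj ->]; rewrite linf_le pt0 pt1.
  by move: hi hj; rewrite !mem_iota; lia.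
rewrite linf_le => hz; apply/allpairsP.
exists (absz (xc z + r%:Z), absz (yc z + r%:Z)); split; cbn [fst snd]; rewrite ?mem_iota; [lia|lia|].
by rewrite [LHS]pt_eta /=; congr pt; lia.
Qed.

Lemma size_box_list r : size (box_list r) = ((r + r).+1 ^ 2)%N.
Proof. by rewrite size_allpairs !size_iota. Qed.

Section powers.
Variables (R : realType) (n : nat).
Hypothesis n0 : (0 < n)%N.
Implicit Types x y : R.

Lemma natr_powRD x y : (n%:R : R) `^ (x + y) = n%:R `^ x * n%:R `^ y.
Proof. by rewrite powRD// pnatr_eq0 -lt0n n0 implybT. Qed.

Lemma natr_powR_gt0 x : 0 < (n%:R : R) `^ x.
Proof. by rewrite powR_gt0// ltr0n. Qed.

Lemma natr_powR1 : (n%:R : R) `^ 1 = n%:R.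
Proof. by rewrite powRr1. Qed.

Lemma natr_powR_le x y : x <= y -> (n%:R : R) `^ x <= n%:R `^ y.
Proof. by move=> xy; apply: ler_powR; rewrite ?ler1n. Qed.
End powers.

(** * Lower bound for all walks at once, and the height of near-optimal walks *)

Section torus_lower.
Variable R : realType.
Context d0 (O0 : measurableType d0) (P0 : probability O0 R).
Variable Y : O0 -> weights R {fset Z2}.
Hypothesis iY : iid P0 edges Y.
Variable G : Z2 -> R.
Hypothesis Glim : forall x, {ae P0, forall o,
  (fun m : nat => ptime setT (Y o) 0 (x *+ m) / m%:R) @ \oo --> G x}.
Hypothesis hG : lattice_norm G.
Notation G1 := (G (pt 1 0)).
Variable a : R.
Hypothesis a0 : 0 < a < 2^-1.
Notation al := (2^-1 + a).
Notation theta n := (n%:R `^ (a - 2^-1)).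

(** [1 / (1 + th)] exceeds [1 - th], so a relative loss of [2 th] leaves a Chernoff exponent of at
    least [th ^ 2 * g]. *)
Lemma tail_exponent (th g : R) : 0 < th -> 0 <= g ->
  th * ((1 - 2 * th) * g) - th / (1 + th) * g <= - (th ^+ 2 * g).
Proof.
move=> th0 g0; have t1 : 0 < 1 + th by rewrite addr_gt0.
rewrite -subr_ge0.
have -> : - (th ^+ 2 * g) - (th * ((1 - 2 * th) * g) - th / (1 + th) * g) =
  th ^+ 3 * g / (1 + th) by field; rewrite gt_eqF.
by rewrite divr_ge0 ?(ltW t1)// mulr_ge0// exprn_ge0// ltW.
Qed.

Lemma near_theta : \forall n \near \oo, theta n <= 4^-1 :> R.
Proof.
have b0 : 0 < 2^-1 - a by case/andP: a0; lra.
near=> n.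
have h : 4 <= n%:R `^ (2^-1 - a) :> R by near: n; exact: near_powR.
have p : 0 < n%:R `^ (2^-1 - a) :> R by apply: lt_le_trans h.
by rewrite -opprB powRN lef_pV2 ?posrE.
Unshelve. all: end_near. Qed.

Lemma near_count (c : R) : 0 < c ->
  \forall n \near \oo, (n%:R : R) ^+ 4 * expR (- (c * (n%:R `^ a * n%:R `^ a))) <= 4^-1.
Proof.
move=> c0; have [ap _] := andP a0.
near=> n.
have n0 : (0 < n)%N by near: n; exact: nbhs_infty_gt.
have nR : 0 < n%:R :> R by rewrite ltr0n.
have h : (4 / a + 4) / c <= n%:R `^ a by near: n; exact: near_powR.
have q1 : 1 <= n%:R `^ a :> R by apply: powR_ge1; [rewrite ler1n|exact: ltW].
have l1 := ln_le_powR nR ap.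
have e4 : n%:R ^+ 4 = expR (4%:R * ln n%:R) :> R by rewrite expRM_natl lnK ?posrE.
rewrite e4 -expRD.
have l4 : expR (- 4) <= 4^-1 :> R.
  rewrite expRN lef_pV2 ?posrE ?expR_gt0//.
  by apply: le_trans (expR_ge1Dx _); lra.
apply: le_trans l4; rewrite ler_expR.
move: h l1 q1; set q := _ `^ a; set L := ln _ => h l1 q1.
have h' : 4 / a + 4 <= c * q by rewrite [leRHS]mulrC -ler_pdivrMr.
have := ler_wpM2r (le_trans ler01 q1) h'.
rewrite mulrDl -mulrA (mulrC a^-1); nra.
Unshelve. all: end_near. Qed.

(** A union bound over at most [n ^ 4] pairs of a base point modulo [n] and a displacement [z]. With
    [theta = n^(a - 1/2)] both errors yield an exponent of order [n^(2 a)]: for [z] inside the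
    window the additive error gives [theta * n^(1/2 + a)], and for [z] on its boundary the relative
    error gives [theta ^ 2 * G z] with [G z] at least of order [n]. *)
Lemma torus_lower : \forall n \near \oo,
  forall d (O : measurableType d) (P : probability O R) (t : {fset Z2} -> {RV P >-> R}),
  torus_weights n t -> exists Bad : set O, [/\ measurable Bad, (P Bad <= (4^-1)%:E)%E &
   forall o, ~ Bad o -> forall p x y, walks setT x y p ->
     (1 - 2 * theta n) * G (y - x) - n%:R `^ al <= path_time (tw t o) x p].
Proof.
have [cg cg0 hcg] := ln_linf hG.
pose c := Num.min 1 (cg / 8); have c0 : 0 < c by rewrite lt_min ltr01 divr_gt0.
near=> n => d O P t ht.
have n8 : (8 < n)%N by near: n; exact: nbhs_infty_gt.
have n0 : (0 < n)%N by apply: leq_trans n8.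
have th4 : theta n <= 4^-1 :> R by near: n; exact: near_theta.
have cnt : (n%:R : R) ^+ 4 * expR (- (c * (n%:R `^ a * n%:R `^ a))) <= 4^-1.
  by near: n; exact: near_count.
have th0 : 0 < theta n :> R by exact: natr_powR_gt0.
have u0 : 0 < n%:R `^ al :> R by exact: natr_powR_gt0.
set th := theta n in th4 th0 *; set u := n%:R `^ al in u0 *.
set q := n%:R `^ a in cnt.
have thu : th * u = q * q.
  by rewrite /th /u /q -!natr_powRD//; congr (_ `^ _); lra.
have thn : th ^+ 2 * n%:R = q * q.
  rewrite -{1}(natr_powR1 R n) expr2 /th /q -!natr_powRD//; congr (_ `^ _); lra.
have q0 : 0 <= q by exact: powR_ge0.
pose r := (n %/ 4)%N.
have r0 : (0 < r)%N by rewrite /r; lia.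
have rn : (r + r < n)%N by rewrite /r; lia.
have r8 : n%:R / 8 <= r%:R :> R.
  by rewrite ler_pdivrMr// -natrM ler_nat /r; lia.
pose thr z := (1 - 2 * th) * G z - (if linf z < r%:Z then u else 0).
pose A (s : (nat * nat) * Z2) := [set o |
   ptime (ball_box (pt s.1.1%:Z s.1.2%:Z) r%:Z) (tw t o) (pt s.1.1%:Z s.1.2%:Z)
     (pt s.1.1%:Z s.1.2%:Z + s.2) <= thr s.2].
have mA s : measurable (A s).
  rewrite (_ : A s = (fun o => ptime (ball_box (pt s.1.1%:Z s.1.2%:Z) r%:Z) (tw t o)
     (pt s.1.1%:Z s.1.2%:Z) (pt s.1.1%:Z s.1.2%:Z + s.2)) @^-1` `]-oo, thr s.2]); last first.
    by apply/seteqP; split => o; rewrite /A /= in_itv.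
  by rewrite -[X in measurable X]setTI; apply: (measurable_ptime (iid_tw ht)).
pose L := [seq (s, z) | s <- [seq (i, j) | i <- iota 0 n, j <- iota 0 n], z <- box_list r].
have LP i j z : (i < n)%N -> (j < n)%N -> linf z <= r%:Z -> ((i, j), z) \in L.
  move=> hi hj hz; apply/allpairsP; exists ((i, j), z); split => //.
    by apply/allpairsP; exists (i, j); split; rewrite ?mem_iota.
  by cbn [snd]; rewrite mem_box_list.
have Lz s : s \in L -> linf s.2 <= r%:Z.
  by case/allpairsP => s' [_ hz ->]; rewrite -mem_box_list.
pose B := expR (- (c * (q * q))).
have cq : c * (q * q) <= q * q /\ c * (q * q) <= cg / 8 * (q * q).
  have l1 : c <= 1 by rewrite /c ge_min lexx.
  have l2 : c <= cg / 8 by rewrite /c ge_min lexx orbT.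
  have qq : 0 <= q * q by exact: mulr_ge0.
  by split; [have := ler_wpM2r qq l1; rewrite mul1r|exact: ler_wpM2r qq _ _ l2].
have PA s : s \in L -> (P (A s) <= B%:E)%E.
  move=> /Lz; case: s => -[i j] z /= hz; set x := pt i%:Z j%:Z.
  have hE : ((G z)%:E <= Ex P (fun o => ptime (ball_box x r%:Z) (tw t o) x (x + z)%R))%E.
    have zE : z = x + z - x by rewrite addrAC subrr add0r.
    by have := window_mean (x := x) (y := x + z) iY Glim n0 ht rn; rewrite -zE; apply.
  have ne : walks (ball_box x r%:Z) x (x + z) !=set0.
    apply: ball_walk; rewrite /ball_box /= ?subrr; first by rewrite /linf !coordE normr0 maxxx.
    by rewrite addrAC subrr add0r.
  have := ptime_lower_tail (iid_window n0 ht x rn) (thr z) (@subset_refl _ _) ne th0 hE.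
  move=> /le_trans; apply; rewrite lee_fin /B ler_expR /thr.
  have te := tail_exponent th0 (lnorm_ge0 hG z).
  have g0 := lnorm_ge0 hG z.
  case: ifP => zr.
    have := mulr_ge0 (sqr_ge0 th) g0; rewrite mulrBr thu.
    case: cq => c1 _; lra.
  rewrite subr0; apply: le_trans te _; rewrite lerN2.
  case: cq => _ /le_trans; apply; rewrite -thn mulrCA ler_pM2l ?exprn_gt0//.
  have lz : linf z = r%:Z by apply/eqP; rewrite eq_le hz leNgt zr.
  apply: le_trans (hcg z); rewrite lz -pmulrn -mulrA ler_pM2l// mulrC//.
exists [set o | exists2 s, s \in L & A s o]; split; first exact: measurable_exists.
  apply: (le_trans (union_bound (P := P) mA PA)); rewrite lee_fin.
  apply: le_trans cnt; rewrite ler_wpM2r ?expR_ge0// -natrX ler_nat.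
  rewrite size_allpairs size_allpairs !size_iota size_box_list.
  rewrite (_ : n ^ 4 = n * n * n ^ 2)%N; last by rewrite !expnS expn0 !muln1 !mulnA.
  by rewrite leq_mul2l leq_exp2r//; apply/orP; right; exact: rn.
move=> o nb; have w0 e : 0 <= tw t o e by exact: tw_ge0.
have k0 : 0 <= 1 - 2 * th by lra.
apply: (walk_lower hG r0 k0 (ltW u0) w0) => x y hxy.
(* A failure at an arbitrary [x] is translated by a multiple of [n] to one of the listed base
   points. *)
have [z [/andP[h1 h2] /andP[h3 h4]]] := shift_to_box n0 x.
rewrite leNgt; apply/negP => hlt; apply: nb.
exists ((absz (xc (x + z *+ n)), absz (yc (x + z *+ n))), y - x).
  by apply: LP => //; exact: absz_lt.
have xE : pt (absz (xc (x + z *+ n)))%:Z (absz (yc (x + z *+ n)))%:Z = x + z *+ n.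
  by apply: Z2P; rewrite ?pt0 ?pt1 gez0_abs.
rewrite /A /= xE (_ : x + z *+ n + (y - x) = y + z *+ n); last first.
  by rewrite addrC -addrA (addrC (- x)) (addrC x) addrK.
by rewrite (ptime_shift ht); exact: ltW.
Unshelve. all: end_near. Qed.

Variable c1 : R.
Hypothesis c10 : 0 < c1.
Hypothesis hcurv : forall (n : nat) (k : int), (0 < n)%N ->
  c1 * Num.min ((k%:~R / n%:R) ^+ 2) 1 * n%:R <= G (pt n%:Z k) - n%:R * G1.
Notation ga := (3 / 4 + a / 2).

(** [(1 + 4 th) (1 - 2 th) >= 1] for [0 < th <= 1 / 4]: the relative loss is divided out at the
    price of an error of order [th * nn = u]. *)
Lemma inv_theta (th g M nn u C : R) : 0 < th -> th <= 4^-1 -> 0 <= g -> 0 <= C ->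
  th * nn = u -> (1 - 2 * th) * M <= nn * g + C * u -> 0 <= u -> 0 <= nn ->
  M - nn * g <= (2 * C + 4 * g) * u.
Proof.
move=> th0 th4 g0 C0 thn hM u0 nn0.
have k : 1 <= (1 + 4 * th) * (1 - 2 * th) by nra.
have t1 : 0 <= 1 + 4 * th by rewrite addr_ge0// mulr_ge0// ltW.
have [M0|M0] := leP M 0.
  have := mulr_ge0 nn0 g0; have := mulr_ge0 C0 u0; have := mulr_ge0 g0 u0; lra.
have h1 := ler_wpM2l t1 hM; rewrite mulrA in h1.
have h2 := ler_wpM2r (ltW M0) k; rewrite mul1r in h2.
have h3 : th * (C * u) <= C * u / 4.
  by rewrite [leRHS]mulrC; apply: ler_wpM2r => //; exact: mulr_ge0.
have h4 : th * (nn * g) = g * u by rewrite mulrA thn mulrC.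
have := le_trans h2 h1; have := mulr_ge0 C0 u0; rewrite !mulrDl mul1r; lra.
Qed.

(** Curvature gives [c1 (2 hh / n) ^ 2 n <= C' n^al], so [hh] is of order [n^((1 + al) / 2)], and
    [(1 + al) / 2 = 3 / 4 + a / 2]. *)
Lemma height_bound (C : R) : 0 <= C -> exists2 D : R, 0 < D & \forall n \near \oo,
  forall hh : int, (1 - 2 * theta n) * G (pt n%:Z (hh *+ 2)) <= n%:R * G1 + C * n%:R `^ al ->
  `|hh|%:~R <= D * n%:R `^ ga.
Proof.
move=> C0; have g1 := g_e1 hG.
pose C' := 2 * C + 4 * G1; have C'0 : 0 < C' by rewrite ltr_wpDl ?mulr_ge0// mulr_gt0.
pose D := C' / c1 + 1; have D0 : 0 < D by rewrite addr_gt0// divr_gt0.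
have b0 : 0 < 1 - al by case/andP: a0; lra.
exists D => //; near=> n => hh hle.
have n0 : (0 < n)%N by near: n; exact: nbhs_infty_gt.
have th4 : theta n <= 4^-1 :> R by near: n; exact: near_theta.
have h1 : C' / c1 + 1 <= n%:R `^ (1 - al) by near: n; exact: near_powR.
have nR : 0 < n%:R :> R by rewrite ltr0n.
have th0 : 0 < theta n :> R by exact: natr_powR_gt0.
have u0 : 0 < n%:R `^ al :> R by exact: natr_powR_gt0.
have thn : theta n * n%:R = n%:R `^ al :> R.
  by rewrite -{2}(natr_powR1 R n) -natr_powRD//; congr (_ `^ _); lra.
have K := inv_theta th0 th4 (ltW g1) C0 thn hle (ltW u0) (ltW nR).
have := le_trans (hcurv (hh *+ 2) n0) K; rewrite -/C'.
have hD : C' < c1 * D by rewrite /D mulrDr mulr1 mulrCA divff ?gt_eqF// mulr1 ltrDl.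
(* Where the curvature bound is capped at 1 the cost would be [c1 * n], which exceeds [C' n^al] for
   large [n]. *)
case: (leP (((hh *+ 2)%:~R / n%:R) ^+ 2) 1) => _; last first.
  rewrite mulr1 leNgt => /negP[].
  have nn : n%:R = n%:R `^ (1 - al) * n%:R `^ al :> R.
    by rewrite -natr_powRD// subrK natr_powR1.
  rewrite [X in _ < _ * X]nn mulrA ltr_pM2r//; apply: lt_le_trans hD _.
  by rewrite ler_pM2l.
move=> h2; rewrite leNgt; apply/negP => h3.
have h4 : (D * n%:R `^ ga) ^+ 2 < (hh%:~R) ^+ 2.
  rewrite -(real_normK (num_real hh%:~R)) -intr_norm.
  by rewrite ltr_pXn2r// nnegrE ?ler0z// mulr_ge0 ?powR_ge0// ltW.
have h5 : (D * n%:R `^ ga) ^+ 2 = D ^+ 2 * (n%:R `^ al * n%:R).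
  rewrite exprMn; congr (_ * _); rewrite expr2 -natr_powRD// -{3}(natr_powR1 R n) -natr_powRD//.
  congr (_ `^ _); lra.
have h6 : c1 * ((hh *+ 2)%:~R / n%:R) ^+ 2 * n%:R = 4 * c1 * hh%:~R ^+ 2 / n%:R.
  by rewrite rmorphMn /=; field; rewrite gt_eqF.
move: h2; rewrite h6 ler_pdivrMr// leNgt => /negP; apply.
rewrite -[ltLHS]mulrA; have c4 : 0 < 4 * c1 by rewrite mulr_gt0.
apply: (@lt_trans _ _ (4 * c1 * (D * n%:R `^ ga) ^+ 2)); last first.
  by rewrite -subr_gt0 -mulrBr mulr_gt0// subr_gt0.
rewrite h5 [ltRHS]mulrA ltr_pM2r ?mulr_gt0//.
have D1 : 1 <= D by rewrite /D lerDr divr_ge0 ?ltW.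
have : c1 * D <= c1 * D ^+ 2 by rewrite ler_pM2l// expr2 ler_peMl// ltW.
have : 0 < c1 * D by rewrite mulr_gt0.
lra.
Unshelve. all: end_near. Qed.
End torus_lower.

Lemma bernoulli_ineq (R : realType) (y : R) k : 0 <= y <= 1 -> 1 - y * k%:R <= (1 - y) ^+ k.
Proof.
move=> /andP[y0 y1]; elim: k => [|k ih]; first by rewrite mulr0 subr0 expr0.
rewrite exprS; have z0 : 0 <= 1 - y by rewrite subr_ge0.
apply: le_trans (ler_wpM2l z0 ih).
rewrite -subr_ge0 -natr1.
have -> : (1 - y) * (1 - y * k%:R) - (1 - y * (k%:R + 1)) = y * y * k%:R by ring.
by apply: mulr_ge0 => //; exact: mulr_ge0.
Qed.

Lemma scaled_time_lt (R : realType) (tau del c T b b' : R) : tau < T + 1 -> T < b ->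
  del * c <= del * tau -> b + 1 - del * c <= b' -> (1 - del) * tau < b'.
Proof. by rewrite mulrBl mul1r; lra. Qed.

(** * Scaling the weights of a strip *)

Section strip_tilt.
Variables (R : realType) (n : nat).
Hypothesis n0 : (0 < n)%N.
Notation W := (weights R {fset Z2}).
Context d (O : measurableType d) (P : probability O R) (t : {fset Z2} -> {RV P >-> R}).
Hypothesis ht : torus_weights n t.

Definition strip (lo : int) (hgt : nat) : set Z2 := [set v | lo <= yc v < lo + hgt%:Z].

Definition strip_event lo hgt : set O := [set o | exists x p,
  (torus_walk n x p /\ walks (strip lo hgt) x (x + e1 *+ n) p) /\
  path_time (tw t o) x p < ttime n t o + 1].

Lemma measurable_strip_event lo hgt : measurable (strip_event lo hgt).
Proof.
refine (@measurable_exists_walk R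
  (fun x p => torus_walk n x p /\ walks (strip lo hgt) x (x + e1 *+ n) p)
  _ O (fun x p o => path_time (tw t o) x p) (fun o => ttime n t o + 1) _ _).
  by move=> x p; exact: (measurable_path_time ht).
by apply: measurable_funD; [exact: (measurable_ttime ht)|exact: measurable_cst].
Qed.

(** Scaling the weights of a strip by [1 - del] lowers the passage time of a
    near-optimal walk in this strip, hence the torus time, by [del c - 1]. *)
Lemma strip_lower lo hgt (del c b b' : R) : 0 < del < 1 ->
  del ^+ 2 * (n * (hgt * 2))%:R <= 2^-1 -> b + 1 - del * c <= b' ->
  fine (P [set o | [/\ strip_event lo hgt o, c <= ttime n t o & ttime n t o < b]]) ^+ 2 / 2
  <= fine (P [set o | ttime n t o < b']).
Proof.
move=> d01 dN hb; set A := [set o | [/\ _, _ & _]].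
have w0 o e : 0 <= tw t o e by exact: tw_ge0.
pose l := strip_edges n lo hgt.
(* Each weight is read at its representative. So [B] depends on [torus_edges] only, and scaling the
   representatives acts on all their translates. *)
pose f x p (w : W) : R := path_time (fun e => w (rho n e)) x p.
pose B : set W := [set w | exists x p, torus_walk n x p /\ f x p w < b'].
have mT := measurable_ttime ht.
have mlt c' : measurable [set o | ttime n t o < c'].
  rewrite (_ : mkset _ = ttime n t @^-1` `]-oo, c'[); last first.
    by apply/seteqP; split => o; rewrite /= in_itv.
  by rewrite -[X in measurable X]setTI; apply: mT.
have mA : measurable A.
  rewrite (_ : A = strip_event lo hgt `&` (~` [set o | ttime n t o < c] `&` [set o | ttime n t o < b])).
    apply: measurableI; first exact: measurable_strip_event.
    by apply: measurableI; [exact: measurableC|].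
  apply/seteqP; split => o /=; rewrite -/A.
    by case=> h1 h2 h3; split => //; split => //; apply/negP; rewrite -leNgt.
  by case=> h1 [/negP h2 h3]; split => //; rewrite leNgt.
have mB : measurable B.
  apply: (@measurable_exists_walk R (torus_walk n) _ W f (fun=> b')).
    by move=> x p; apply: measurable_sum => e; exact: measurable_coord.
  exact: measurable_cst.
have fE (w w' : W) x p : torus_walk n x p -> (forall e, torus_edges n e -> w e = w' e) -> f x p w = f x p w'.
  move=> [_ hp] h; apply: (path_time_inner hp) => e /inner_edges_sub he; apply: h.
  by case: (rho_spec n0 he).
have dB : depends_on (torus_edges n) (fun w => w \in B).
  move=> w w' h; apply/idP/idP; rewrite !inE => -[x [p [h1 h2]]]; exists x, p; split => //.
    by rewrite -(fE _ _ _ _ h1 h).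
  by rewrite (fE _ _ _ _ h1 h).
have lF : {subset l <= torus_edges n}.
  by move=> e he; rewrite inE; exact: (strip_edges_sub n0 he).
(* Bernoulli's inequality, with at most [n * (hgt * 2)] edges in the strip. *)
have dl : 2^-1 <= (1 - del ^+ 2) ^+ size l.
  have d2 : 0 <= del ^+ 2 <= 1.
    by case/andP: d01 => h1 h2; rewrite sqr_ge0/= expr_le1// ltW.
  have bern (k : nat) : 1 - del ^+ 2 * k%:R <= (1 - del ^+ 2) ^+ k.
    exact: bernoulli_ineq.
  apply: le_trans (bern (size l)).
  have : del ^+ 2 * (size l)%:R <= del ^+ 2 * (n * (hgt * 2))%:R.
    by apply: ler_wpM2l; [exact: sqr_ge0|rewrite ler_nat size_strip_edges].
  lra.
have AB o : A o -> B (scale l (1 - del) (tw t o)).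
  case=> -[x [p [[h1 h2] h3]]] h4 h5; exists x, p; split => //.
  have -> : f x p (scale l (1 - del) (tw t o)) = (1 - del) * path_time (tw t o) x p.
    transitivity (path_time (fun e => (1 - del) * tw t o e) x p).
      apply: (path_time_inner h2) => e he; rewrite /scale.
      by rewrite (mem_strip_edges n0 he) (tw_rho n0 ht).
    by rewrite /path_time mulr_sumr.
  have h6 := torus_time_le (w0 o) h1; rewrite -/(ttime n t o) in h6.
  have h7 := ler_wpM2l (ltW (andP d01).1) (le_trans h4 h6).
  exact: scaled_time_lt h3 h5 h7 hb.
have := tilt (iid_tw ht) d01 (undup_uniq _ : uniq l) lF dl mA mB dB AB.
move=> /le_trans; apply; rewrite fine_le ?fin_num_measure//.
  rewrite (_ : [set o | B (tw t o)] = [set o | exists x p, torus_walk n x p /\ path_time (tw t o) x p < b']).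
    apply: (@measurable_exists_walk R (torus_walk n) _ O
      (fun x p o => path_time (tw t o) x p) (fun=> b')); last exact: measurable_cst.
    by move=> x p; exact: (measurable_path_time ht).
  have e o x p : f x p (tw t o) = path_time (tw t o) x p.
    by rewrite /f; congr path_time; apply/funext => e; rewrite (tw_rho n0 ht).
  by apply/seteqP; split => o /= [x [p [h1 h2]]]; exists x, p; move: h2; rewrite e.
apply: le_measure; rewrite ?inE//.
  rewrite (_ : [set o | B (tw t o)] = tw t @^-1` B)//.
  have [m _ _] := iid_tw ht; rewrite -[X in measurable X]setTI; exact: m.
move=> o /= [x [p [h1 h2]]]; apply: le_lt_trans (torus_time_le (w0 o) h1) _.
move: h2; rewrite /f (_ : (fun e => _) = tw t o)//.
by apply/funext => e; rewrite (tw_rho n0 ht).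
Qed.

(** Some strip carries a near-optimal walk with probability at least
    [1 / (4 M)]; whichever side of [m] the torus time then lies on, it
    fluctuates by [s]. *)
Lemma strip_fluctuation (M hgt : nat) (lo : nat -> int) (E : set O) (del c m s : R) :
  (0 < M)%N -> measurable E -> ((2^-1)%:E <= P E)%E ->
  (forall o, E o -> c <= ttime n t o /\ exists i, (i < M)%N /\ strip_event (lo i) hgt o) ->
  0 < del < 1 -> del ^+ 2 * (n * (hgt * 2))%:R <= 2^-1 -> 2 * s + 1 <= del * c ->
  exists D : set O, [/\ measurable D, (((4 * M%:R) ^- 2 / 8)%:E <= P D)%E &
    forall o, D o -> s <= `|ttime n t o - m|].
Proof.
move=> M0 mE PE hE d01 dN hs.
have MR : 0 < M%:R :> R by rewrite ltr0n.
(* If every strip had probability at most [q = 1 / (4 M)], their union would have at most [1 / 4],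
   less than [P E]. *)
pose q : R := (4 * M%:R)^-1; have q0 : 0 < q by rewrite invr_gt0 mulr_gt0.
have q1 : q <= 1.
  by rewrite invf_le1 ?mulr_gt0// -natrM ler1n muln_gt0.
have mT := measurable_ttime ht.
have mlt c' : measurable [set o | ttime n t o < c'].
  rewrite (_ : mkset _ = ttime n t @^-1` `]-oo, c'[); last first.
    by apply/seteqP; split => o; rewrite /= in_itv.
  by rewrite -[X in measurable X]setTI; apply: mT.
have mge c' : measurable [set o | c' <= ttime n t o].
  rewrite (_ : mkset _ = ~` [set o | ttime n t o < c']); first exact: measurableC.
  by apply/seteqP; split => o /=; rewrite leNgt => /negP.
pose A i := strip_event (lo i) hgt `&` [set o | c <= ttime n t o].
have mA i : measurable (A i) by apply: measurableI; [exact: measurable_strip_event|].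
have [i hi] : exists i, (q%:E < P (A i))%E.
  apply: contrapT => hn.
  have PA i : i \in iota 0 M -> (P (A i) <= q%:E)%E.
    by move=> _; rewrite leNgt; apply/negP => h; apply: hn; exists i.
  have := union_bound (P := P) mA PA; rewrite size_iota.
  have -> : M%:R * q = 4^-1 :> R by rewrite /q invfM mulrCA divff ?mulr1// gt_eqF.
  have : (P E <= P [set o | exists2 j, j \in iota 0 M & A j o])%E.
    apply: le_measure; rewrite ?inE//; first exact: measurable_exists.
    move=> o /hE [h1 [i [iM h2]]]; exists i; first by rewrite mem_iota.
    by split.
  move=> h1 /(le_trans h1) /(le_trans PE); rewrite lee_fin; lra.
(* Either torus times at least [m + s] account for [q / 2], or times below [m + s] do; in the second
   case scaling carries them below [m - s], by [2 * s + 1 <= del * c]. *)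
pose A1 := [set o | [/\ strip_event (lo i) hgt o, c <= ttime n t o & ttime n t o < m + s]].
pose A2 := A i `&` [set o | m + s <= ttime n t o].
have A1E : A1 = A i `&` [set o | ttime n t o < m + s].
  by apply/seteqP; split => o; [case=> h1 h2 h3; split|case=> -[h1 h2] h3; split].
have mA1 : measurable A1 by rewrite A1E; exact: measurableI.
have mA2 : measurable A2 by exact: measurableI.
have sum : (P (A i) <= P A1 + P A2)%E.
  apply: le_trans (measureU2 P mA1 mA2); apply: le_measure; rewrite ?inE//; first exact: measurableU.
  by move=> o Ao; case: (ltP (ttime n t o) (m + s)) => h; [left; rewrite A1E|right].
have fA1 := fineP P mA1; have fA2 := fineP P mA2.
have sum' : q < fine (P A1) + fine (P A2).
  by rewrite -lte_fin EFinD -fA1 -fA2; exact: lt_le_trans sum.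
have q8 : (4 * M%:R) ^- 2 / 8 = (q / 2) ^+ 2 / 2 by rewrite /q; field; rewrite gt_eqF.
case: (leP (q / 2) (fine (P A2))) => h2.
  exists [set o | m + s <= ttime n t o]; split => //.
    apply: (@le_trans _ _ (P A2)); last by apply: le_measure; rewrite ?inE// => o [].
    rewrite fA2 lee_fin q8; apply: le_trans h2.
    rewrite expr2; nra.
  by move=> o /= h; apply: le_trans (ler_norm _); lra.
have h1 : q / 2 <= fine (P A1) by lra.
have hb : m + s + 1 - del * c <= m - s by lra.
have := strip_lower (lo i) d01 dN hb; rewrite -/A1 => st.
exists [set o | ttime n t o < m - s]; split => //.
  rewrite (fineP P (mlt _)) lee_fin q8; apply: le_trans st.
  rewrite ler_pM2r ?invr_gt0// ler_pXn2r// nnegrE ?divr_ge0 ?ltW//.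
  by apply: lt_le_trans h1; rewrite divr_gt0.
by move=> o /= h; rewrite distrC; apply: le_trans (ler_norm _); lra.
Qed.
End strip_tilt.

(** The block of [H] rows containing the start is enlarged by about [H] on both sides, so that
    finitely many strips cover all starting heights. *)
Lemma row_in_strip (yv yx : int) (H : nat) : (0 < H)%N -> 0 <= yx -> `|yv - yx| <= H%:Z ->
  let lo := ((absz yx %/ H) * H)%N%:Z - H%:Z in lo <= yv < lo + (3 * H + 1)%N%:Z.
Proof.
move=> H0 y0 h /=; have := divn_eq (absz yx) H; have := ltn_pmod (absz yx) H0.
move: (_ %/ _)%N (_ %% _)%N => q r; lia.
Qed.

Lemma near_time_arith (R : realType) (q1 q2 q3 q4 u : R) :
  q1 < q2 + 1 -> q2 <= q3 + q4 -> 1 <= u -> q1 + 2 * u <= q3 + (q4 + 3 * u).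
Proof. by lra. Qed.

(** * Fluctuation of the torus time for large periods *)

Section torus_fluctuation.
Variable R : realType.
Context d0 (O0 : measurableType d0) (P0 : probability O0 R).
Variable Y : O0 -> weights R {fset Z2}.
Hypothesis iY : iid P0 edges Y.
Variable G : Z2 -> R.
Hypothesis Glim : forall x, {ae P0, forall o,
  (fun m : nat => ptime setT (Y o) 0 (x *+ m) / m%:R) @ \oo --> G x}.
Hypothesis hG : lattice_norm G.
Notation G1 := (G (pt 1 0)).
Variables c1 a : R.
Hypothesis a8 : 0 < a <= 8^-1.
Hypothesis c10 : 0 < c1.
Hypothesis hcurv : forall (n : nat) (k : int), (0 < n)%N ->
  c1 * Num.min ((k%:~R / n%:R) ^+ 2) 1 * n%:R <= G (pt n%:Z k) - n%:R * G1.
Notation al := (2^-1 + a).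
Notation ga := (3 / 4 + a / 2).
Notation theta n := (n%:R `^ (a - 2^-1)).

Let a0 : 0 < a < 2^-1. Proof. by case/andP: a8 => h1 h2; lra. Qed.

(** Cutting the walk at [v] and bounding both pieces below costs [2 u]; by [ln_reflect] the two
    norms dominate the norm of [(n, 2 (yc v - yc x))], to which the height bound applies. *)
Lemma near_optimal_height n d (O : measurableType d) (P : probability O R)
    (t : {fset Z2} -> {RV P >-> R}) (o : O) (u C B : R) (k : R) :
  (0 < n)%N -> torus_weights n t -> 0 <= k ->
  (forall p x y, walks setT x y p -> k * G (y - x) - u <= path_time (tw t o) x p) ->
  (forall hh : int, k * G (pt n%:Z (hh *+ 2)) <= C -> `|hh|%:~R <= B) ->
  forall x p v, torus_walk n x p -> path_time (tw t o) x p + 2 * u <= C ->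
  v \in x :: p -> `|yc v - yc x|%:~R <= B.
Proof.
move=> n0 ht k0 LE HB x p v [x0 hp] hC hv; apply: HB.
apply: le_trans hC; case/splitPl: hv hp => p1 p2 lv hp.
have [pp lp _] := hp; move: pp; rewrite cat_path lv => /andP[q1 q2].
have w1 : walks setT x v p1 by split.
have w2 : walks setT v (x + e1 *+ n) p2 by split => //; rewrite -lp last_cat lv.
have h1 := LE _ _ _ w1; have h2 := LE _ _ _ w2.
rewrite path_time_cat lv.
have := ler_wpM2l k0 (ln_reflect hG (xc v) n%:Z (yc v - yc x)).
rewrite (_ : pt (xc v) (yc v - yc x) = v - x); last first.
  by apply: Z2P; rewrite !(coordE, pt0, pt1)// x0 subr0.
rewrite (_ : pt (n%:Z - xc v) _ = x + e1 *+ n - v); last first.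
  by apply: Z2P; rewrite e1E !(coordE, pt0, pt1) ?x0 ?add0r ?addr0// opprB.
rewrite mulrDr => h3; apply: le_trans h3 _.
move: h1 h2; move: (k * _) (k * _) (path_time _ _ _) (path_time _ _ _) => ? ? ? ?; lra.
Qed.

Lemma torus_fluct : exists2 c : R, 0 < c & \forall n \near \oo,
  forall d (O : measurableType d) (P : probability O R) (t : {fset Z2} -> {RV P >-> R}),
  torus_weights n t -> forall m : R, exists D : set O,
  [/\ measurable D, ((c * n%:R `^ (- (3 / 2)))%:E <= P D)%E &
    forall o, D o -> n%:R `^ (8^-1 - a) <= `|ttime n t o - m|].
Proof.
have [ap ap8] := andP a8; have g1 := g_e1 hG.
have [Cu Cu0 hU] := torus_upper iY Glim hG a0.
have hL := torus_lower iY Glim hG a0.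
(* In [Cu + 3], two units pay for the cut in [near_optimal_height] and one for the slack 1 of a
   near-optimal walk, as [1 <= u]. *)
have C0 : 0 <= Cu + 3 by rewrite addr_ge0// ltW.
have [D D0 hD] := height_bound hG a0 c10 hcurv C0.
have D1 : 0 < D + 1 by rewrite addr_gt0.
exists ((D / 8) ^+ 2 / 8); first by rewrite divr_gt0// exprn_gt0// divr_gt0.
have b1 : 0 < 1 - ga by lra.
have b2 : 0 < 1 - al by lra.
have b3 : 0 < 3 / 4 * a by lra.
have [N1 _ {}hU] := hU; have [N2 _ {}hL] := hL; have [N3 _ {}hD] := hD.
have al0 : 0 <= al by lra.
near=> n => d O P t ht m.
have n0 : (0 < n)%N by near: n; exact: nbhs_infty_gt.
have nR : 0 < n%:R :> R by rewrite ltr0n.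
have hUn : (N1 <= n)%N by near: n; exact: nbhs_infty_ge.
have hLn : (N2 <= n)%N by near: n; exact: nbhs_infty_ge.
have hDn : (N3 <= n)%N by near: n; exact: nbhs_infty_ge.
have th4 : theta n <= 4^-1 :> R by near: n; exact: near_theta.
have z1 : D + 1 <= n%:R `^ (1 - ga) by near: n; exact: near_powR.
have z2 : 4 / G1 <= n%:R `^ (1 - al) by near: n; exact: near_powR.
have z3 : 48 * (D + 1) / G1 <= n%:R `^ (3 / 4 * a) by near: n; exact: near_powR.
have {}hU := hU n hUn _ _ _ _ ht.
have {hL} [Bad [mBad PBad LE]] := hL n hLn _ _ _ _ ht.
have {}hD := hD n hDn.
have th0 : 0 < theta n :> R by exact: natr_powR_gt0.
set k := 1 - 2 * theta n in LE hD; set u := n%:R `^ al in LE hD hU.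
have k2 : 2^-1 <= k by rewrite /k; lra.
have u1 : 1 <= u by apply: powR_ge1; rewrite ?ler1n.
have uG : u <= n%:R * G1 / 4.
  have -> : n%:R = n%:R `^ (1 - al) * u :> R by rewrite -natr_powRD// subrK natr_powR1.
  move: z2; rewrite ler_pdivrMr// => z2.
  have := ler_wpM2r (le_trans ler01 u1) z2.
  have -> : n%:R `^ (1 - al) * u * G1 / 4 = n%:R `^ (1 - al) * G1 * u / 4 :> R by ring.
  by rewrite ler_pdivlMr// [u * 4]mulrC.
set g := n%:R `^ ga in hD.
have gp : 1 <= g by apply: powR_ge1; [rewrite ler1n|lra].
pose H := (Num.truncn (D * g)).+1.
have H0 : (0 < H)%N by [].
have Dg0 : 0 <= D * g by rewrite mulr_ge0 ?(ltW D0)// (le_trans _ gp).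
have H1 : D * g <= H%:R by rewrite ltW// truncnS_gt.
have H2 : H%:R <= (D + 1) * g.
  have : (Num.truncn (D * g))%:R <= D * g by rewrite truncn_le.
  rewrite /H -natr1 mulrDl mul1r; lra.
have gn : n%:R = n%:R `^ (1 - ga) * g :> R by rewrite -natr_powRD// subrK natr_powR1.
have Hn : (H <= n)%N.
  by rewrite -(ler_nat R) gn; apply: le_trans H2 _; rewrite ler_wpM2r// (le_trans _ gp).
pose M := (n %/ H).+1.
have MH : (M * H <= n + n)%N.
  by rewrite /M mulSn addnC leq_add// leq_divM.
have HR : 0 < H%:R :> R by rewrite ltr0n.
have MR : 0 < M%:R :> R by rewrite ltr0n.
(* [M] is of order [n^(1/4 - a/2)]; the cruder power [3 / 4] already gives the exponent [- 3 / 2]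
   after squaring. *)
have M1 : 4 * M%:R <= 8 / D * n%:R `^ (3 / 4).
  have h1 : M%:R * (D * g) <= 2 * n%:R.
    apply: (@le_trans _ _ (M%:R * H%:R)); first by rewrite ler_pM2l.
    by rewrite -natrM -(natrM _ 2) ler_nat mul2n -addnn.
  have h2 : n%:R <= n%:R `^ (3 / 4) * g :> R.
    rewrite {1}gn ler_pM2r ?(lt_le_trans ltr01)//; apply: natr_powR_le => //; lra.
  have g0 : 0 < g by apply: lt_le_trans gp.
  rewrite mulrAC ler_pdivlMr// -(ler_pM2r g0).
  have -> : 4 * M%:R * D * g = 4 * (M%:R * (D * g)) by ring.
  rewrite -[8 * _ * g]mulrA.
  move: (M%:R * (D * g)) (n%:R `^ (3 / 4) * g) h1 h2 => A B h1 h2; lra.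
(* [z ^ 2 = n * g] is the order of the number of edges of a strip, at most [8 (D + 1) z ^ 2]; the
   factor [4 (D + 1)] in [del] brings [del ^ 2] times this number below [1 / 2]. *)
pose z := n%:R `^ (7 / 8 + a / 4) : R.
have zz : z * z = n%:R * g.
  by rewrite -{1}(natr_powR1 R n) -!natr_powRD//; congr (_ `^ _); lra.
have zp : 1 <= z by apply: powR_ge1; [rewrite ler1n|lra].
pose del := (4 * (D + 1) * z)^-1.
have dp : 1 < 4 * (D + 1) * z.
  apply: (@lt_le_trans _ _ (4 * (D + 1))); first by lra.
  by rewrite ler_peMr// mulr_ge0// ltW.
have d01 : 0 < del < 1 by rewrite invr_gt0 invf_lt1 ?dp ?(lt_trans ltr01 dp).
have dN : del ^+ 2 * (n * ((3 * H + 1) * 2))%:R <= 2^-1.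
  have : (n * ((3 * H + 1) * 2))%:R <= 8 * (D + 1) * (z * z) :> R.
    rewrite zz; apply: (@le_trans _ _ (n%:R * (8 * H%:R))).
      by rewrite -(natrM _ 8) -natrM ler_nat leq_mul2l; apply/orP; right; clear -H0; lia.
    rewrite mulrCA -mulrA ler_pM2l// [leRHS]mulrCA ler_pM2l//.
  rewrite /del exprVn ler_pdivrMl ?exprn_gt0 ?(lt_trans ltr01 dp)// => /le_trans; apply.
  have zq : 0 <= z * z by rewrite mulr_ge0 ?(le_trans ler01 zp).
  have -> : (4 * (D + 1) * z) ^+ 2 * 2^-1 = 8 * (D + 1) * (z * z) * (D + 1) by field.
  have A0 : 0 <= 8 * (D + 1) * (z * z) by apply: mulr_ge0 => //; rewrite mulr_ge0// ltW.
  by apply: ler_peMr => //; rewrite lerDr ltW.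
pose s := n%:R `^ (8^-1 - a) : R.
have s1 : 1 <= s by apply: powR_ge1; [rewrite ler1n|lra].
have hs : 2 * s + 1 <= del * (n%:R * G1 / 4).
  (* The exponents [1/8 - a], [3 a / 4] and [7/8 + a/4] add up to 1. The spare power [n^(3 a / 4)]
     absorbs the constants, by [z3]. *)
  have nz : n%:R = s * n%:R `^ (3 / 4 * a) * z.
    by rewrite /s /z -!natr_powRD// -{1}(natr_powR1 R n); congr (_ `^ _); lra.
  have z0 : 0 < z by apply: lt_le_trans zp.
  have -> : del * (n%:R * G1 / 4) = s * (n%:R `^ (3 / 4 * a) * (G1 / (16 * (D + 1)))).
    by rewrite /del {1}nz; field; rewrite !gt_eqF.
  have h3 : 3 <= n%:R `^ (3 / 4 * a) * (G1 / (16 * (D + 1))).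
    move: z3; rewrite ler_pdivrMr// => z3.
    rewrite mulrA ler_pdivlMr ?mulr_gt0//; lra.
  apply: (@le_trans _ _ (s * 3)); first by lra.
  by rewrite ler_wpM2l// (le_trans ler01).
pose U := [set o | n%:R * G1 + Cu * u < ttime n t o].
have mU : measurable U.
  rewrite (_ : U = ttime n t @^-1` `]n%:R * G1 + Cu * u, +oo[); last first.
    by apply/seteqP; split => o; rewrite /U /= in_itv /= andbT.
  by rewrite -[X in measurable X]setTI; apply: (measurable_ttime ht).
have mUB : measurable (U `|` Bad) by exact: measurableU.
pose E := ~` (U `|` Bad).
have mE : measurable E by exact: measurableC.
have PE : ((2^-1)%:E <= P E)%E.
  rewrite /E (probability_setC P mUB).
  have : (P (U `|` Bad) <= (2^-1)%:E)%E.
    apply: (le_trans (measureU2 P mU mBad)).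
    rewrite (_ : 2^-1 = 4^-1 + 4^-1 :> R); last by field.
    by rewrite EFinD; apply: leeD.
  by rewrite (fineP P mUB) lee_fin -EFinB lee_fin; move: (fine _) => q; lra.
have w0 o e : 0 <= tw t o e by exact: tw_ge0.
pose lo (i : nat) : int := (i * H)%N%:Z - H%:Z.
have hE o : E o -> n%:R * G1 / 4 <= ttime n t o /\
    exists i, (i < M)%N /\ strip_event n t (lo i) (3 * H + 1) o.
  move=> ho; have Ub : ttime n t o <= n%:R * G1 + Cu * u.
    by rewrite leNgt; apply/negP => h; apply: ho; left.
  have {}LE := LE o (fun h => ho (or_intror h)).
  have k0 : 0 <= k by apply: le_trans k2; rewrite invr_ge0.
  split.
    apply: torus_time_ge => x p [_ hp]; have := LE _ _ _ hp.
    rewrite [x + _]addrC addrK e1E -pt_mulrn (g_mulrn hG); apply: le_trans.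
    have := ler_wpM2r (mulr_ge0 (ltW nR) (ltW g1)) k2; move: uG.
    by move: (n%:R * G1) (k * _) => q1 q2; lra.
  have [x [p [[x0 hp] hx]]] := torus_time_approx n (w0 o) ltr01.
  have [zz' [_ /andP[y1 y2]]] := shift_to_box n0 x.
  (* A vertical translation by a multiple of [n] keeps the start on the line [x = 0], keeps the
     passage time, and brings the starting height into [[0, n[]. *)
  pose z' := pt 0 (yc zz'); set x' := x + z' *+ n.
  have yx' : yc x' = yc (x + zz' *+ n) by rewrite /x' !coordE !yc_mulrn pt1.
  rewrite -yx' in y1 y2.
  pose p' := [seq v + z' *+ n | v <- p].
  have hp' : torus_walk n x' p'.
    split; first by rewrite /x' coordE xc_mulrn pt0 mul0r addr0.
    have -> : x' + e1 *+ n = x + e1 *+ n + z' *+ n by rewrite /x' addrAC.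
    exact: (walksS (fun _ _ => Logic.I) (walks_shift (z' *+ n) hp)).
  have tp' : path_time (tw t o) x' p' = path_time (tw t o) x p by exact: (path_time_shift ht o z' hp).
  have tC : path_time (tw t o) x' p' + 2 * u <= n%:R * G1 + (Cu + 3) * u.
    have hx' : path_time (tw t o) x p < ttime n t o + 1 by exact: hx.
    have -> : (Cu + 3) * u = Cu * u + 3 * u by ring.
    rewrite tp'; move: hx' Ub u1.
    by move: (path_time _ _ _) (ttime n t o) (n%:R * G1) (Cu * u) => q1 q2 q3 q4 k1 k2' k3; apply: (near_time_arith k1 k2' k3).
  have HH := near_optimal_height n0 ht k0 LE hD hp' tC.
  have hH v : v \in x' :: p' -> `|yc v - yc x'| <= H%:Z.
    move=> /HH h; have := le_trans h H1.
    by rewrite -[H%:R]/(H%:~R) ler_int.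
  exists (absz (yc x') %/ H)%N; split.
    by rewrite /M ltnS leq_div2r// ltnW// absz_lt.
  exists x', p'; split; last by rewrite tp'.
  split => //; have [_ [q1 q2 _]] := hp'; split => // v hv.
  exact: (row_in_strip H0 y1 (hH v hv)).
have [D' [mD' PD' hD']] := strip_fluctuation n0 ht m (ltn0Sn _ : (0 < M)%N) mE PE hE d01 dN hs.
exists D'; split => //; apply: le_trans PD'; rewrite lee_fin mulrAC ler_pM2r ?invr_gt0//.
have p0 : 0 < n%:R `^ (3 / 4) :> R by exact: natr_powR_gt0.
have -> : n%:R `^ (- (3 / 2)) = (n%:R `^ (3 / 4)) ^- 2 :> R.
  by rewrite powRN expr2 -natr_powRD//; congr (_ `^ _)^-1; lra.
have -> : (D / 8) ^+ 2 * n%:R `^ (3 / 4) ^- 2 = (8 / D * n%:R `^ (3 / 4)) ^- 2.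
  by field; rewrite !gt_eqF.
have X0 : 0 < 4 * M%:R :> R by rewrite mulr_gt0.
have Y0 : 0 < 8 / D * n%:R `^ (3 / 4) by rewrite mulr_gt0// divr_gt0.
by rewrite lef_pV2 ?posrE ?exprn_gt0// ler_pXn2r// nnegrE ltW.
Unshelve. all: end_near. Qed.
End torus_fluctuation.

(** * Small periods *)

Section large_torus_time.
Variables (R : realType) (n : nat).
Hypothesis n0 : (0 < n)%N.
Notation W := (weights R {fset Z2}).
Context d (O : measurableType d) (P : probability O R) (t : {fset Z2} -> {RV P >-> R}).
Hypothesis ht : torus_weights n t.

(** Height [n + 1], because a vertical edge with lower end in row [n - 1] reaches row [n]. *)
Lemma rho_in_strip e : edges e -> rho n e \in strip_edges n 0 n.+1.
Proof.
move=> he; have [x [j [ee _]]] := edge_corner he.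
have [z [hx hy]] := shift_to_box n0 x.
rewrite -(rho_shift n0 z he) ee; apply: (mem_strip_edges n0).
exists (x + z *+ n), (x + pt (~~ j)%:Z j%:Z + z *+ n); split.
- by rewrite /=; lia.
- by move: hy; rewrite /= addrAC !(coordE, pt1); case: j {ee}; rewrite /=; lia.
- by rewrite adjacent_shift; exact: corner_adjacent.
- exact: shift_pair.
Qed.

(** With positive probability all the finitely many torus weights are at least [m + s], and a walk
    between distinct columns crosses at least one edge. *)
Lemma torus_time_unbounded (m s : R) : exists D : set O,
  [/\ measurable D, (0 < P D)%E & forall o, D o -> s <= `|ttime n t o - m|].
Proof.
pose J := [fset e in strip_edges n 0 n.+1]%fset.
pose A : {fset Z2} -> set R := fun=> `[m + s, +oo[%classic.
have [mY _ hP] := iid_tw ht.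
have JF : [set` J] `<=` torus_edges n.
  by move=> e /=; rewrite inE; exact: (strip_edges_sub n0).
have mA i : measurable (A i) by exact: measurable_itv.
pose C : set W := [set w | forall i, i \in J -> A i (w i)].
have mC : measurable C by apply: sub_sigma_algebra; exists J, A.
exists [set o | forall i, i \in J -> A i (tw t o i)]; split.
- by rewrite -[X in measurable X]setTI; apply: (mY measurableT _ mC).
- rewrite (hP J A JF mA); apply: (big_ind (fun x => 0 < x)%E); first exact: lte01.
    by move=> x y; exact: mule_gt0.
  move=> i _; rewrite [exp1 R _](_ : _ = exponential_prob 1 `[m + s, +oo[%classic)//.
  by rewrite exponential_prob_itvcy// lte_fin expR_gt0.
- move=> o hD; have w0 e : 0 <= tw t o e by exact: tw_ge0.
  suff : m + s <= ttime n t o by move=> h; apply: le_trans (ler_norm _); lra.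
  apply: torus_time_ge => x [|v p] [x0 [/= pp lp _]].
    by have := congr1 xc lp; rewrite e1E coordE pt0; lia.
  have {pp} [xv _] := andP pp.
  have ed : edges [fset x; v]%fset by exists x, v.
  rewrite path_time_cons -(tw_rho n0 ht).
  have := hD (rho n [fset x; v]%fset); rewrite inE => /(_ (rho_in_strip ed)).
  rewrite /A /= in_itv /= andbT => /le_trans; apply.
  by rewrite lerDl path_time_ge0.
Qed.
End large_torus_time.

(** * From an event to a moment *)

Section moment.
Context d (O : measurableType d) (R : realType) (P : probability O R).

(** [T_tor] is built from the raw weights and is tied to the measurable [ttime] only almost surely.
    The integral of a nonnegative function is a supremum over simple functions below it, which is
    monotone without measurability. *)
Lemma ge0_le_integral_nonmeasurable (g f : O -> \bar R) : (forall x, 0 <= g x)%E ->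
  (forall x, g x <= f x)%E -> (\int[P]_x g x <= \int[P]_x f x)%E.
Proof.
move=> g0 gf; have f0 x : (0 <= f x)%E by apply: le_trans (gf x).
rewrite (ge0_integralTE _ g0) (ge0_integralTE _ f0).
by apply: le_ereal_sup => _ [h hg <-]; exists h => // x; exact: le_trans (gf x).
Qed.

Lemma moment_lower (X T : O -> R) (D : set O) (s m k : R) : measurable D ->
  {ae P, forall o, X o = T o} -> (forall o, D o -> s <= `|T o - m|) -> 0 <= s -> 0 < k ->
  ((s `^ k)%:E * P D <= 'E_P[fun o => (`|X o - m| `^ k)%R])%E.
Proof.
move=> mD [N [mN PN hN]] hD s0 k0; rewrite unlock.
have mDN : measurable (D `\` N) by exact: measurableD.
have PDN : P (D `\` N) = P D.
  have PI : P (D `&` N) = 0%E.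
    by apply: (subset_measure0 (measurableI _ _ mD mN) mN _ PN); exact: subIsetr.
  transitivity (P (D `\` N) + P (D `&` N))%E; first by rewrite [X in (_ + X)%E]PI adde0.
  by symmetry; exact: (measureDI P mD mN).
have sk : 0 <= s `^ k by exact: powR_ge0.
have mi : measurable_fun setT (\1_(D `\` N) : O -> R) by exact: measurable_indic.
have i0 o : 0 <= (\1_(D `\` N) o : R) by [].
rewrite -PDN -(Ex_indic P mDN) -(ExZl P mi sk i0).
apply: ge0_le_integral_nonmeasurable => o; first by rewrite lee_fin mulr_ge0.
rewrite lee_fin indicE; case: (boolP (o \in D `\` N)) => [|_]; last by rewrite mulr0 powR_ge0.
rewrite inE => -[Do No]; rewrite mulr1.
have -> : X o = T o by apply: contrapT => h; apply: No; exact: hN.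
by apply: ge0_ler_powR; rewrite ?nnegrE ?(ltW k0)// hD.
Qed.
End moment.

(** * From the norm on the plane to lattice points *)

Section norm.
Variables (R : realType) (g : 'rV[R]_2 -> R).
Hypothesis hg : is_norm g.

Lemma toR2D x y : toR2 R (x + y) = toR2 R x + toR2 R y.
Proof. exact: map_mxD. Qed.

Lemma toR2M x n : toR2 R (x *+ n) = n%:R *: toR2 R x.
Proof. by apply/rowP => j; rewrite !mxE mulmxnE rmorphMn /= mulr_natl. Qed.

Lemma toR2_pt a b : toR2 R (pt a b) = a%:~R *: e1 + b%:~R *: e2.
Proof.
have E0 : (1 == 0 :> 'I_2) = false by [].
have E1 : (0 == 1 :> 'I_2) = false by [].
apply/rowP => j; rewrite !mxE; have [->|->] : j = 0 \/ j = 1.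
- by case: j => -[|[|//]] i; [left|right]; exact: val_inj.
- by rewrite ?E1 ?eqxx /= mulr1 mulr0 addr0.
- by rewrite ?E0 ?eqxx /= mulr1 mulr0 add0r.
Qed.

(** The quadratic bound near 0 extends to all slopes by convexity: [e1 + (l b) e2] lies between [e1]
    and [e1 + b e2], so the gain at slope [l b] is at most [l] times the gain at [b]. Beyond the
    curvature range this leaves a constant gain, whence the cap at 1. *)
Lemma curvature_lattice : curvature_e1 g -> exists2 c1 : R, 0 < c1 &
  forall (n : nat) (k : int), (0 < n)%N ->
  c1 * Num.min ((k%:~R / n%:R) ^+ 2) 1 * n%:R <=
    g (toR2 R (pt n%:Z k)) - n%:R * g (toR2 R (pt 1 0)).
Proof.
case: hg => _ _ gZ gD [eps0 [c0 [eps00 c00 hc]]].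
(* Strictly below [eps0], so that the slope [e'] itself is admissible, and at most 1, so that one
   constant serves both ranges. *)
pose e' := Num.min (eps0 / 2) 1.
have e'0 : 0 < e' by rewrite lt_min ltr01 andbT divr_gt0.
have e'1 : e' <= 1 by rewrite ge_min lexx orbT.
have e'e : e' < eps0.
  by apply: (@le_lt_trans _ _ (eps0 / 2)); [rewrite ge_min lexx|lra].
have c10 : 0 < c0 * e' ^+ 2 by rewrite mulr_gt0// exprn_gt0.
exists (c0 * e' ^+ 2) => // n k n0; have nR : 0 < n%:R :> R by rewrite ltr0n.
set b := k%:~R / n%:R.
have -> : toR2 R (pt n%:Z k) = n%:R *: (e1 + b *: e2).
  by rewrite toR2_pt scalerDr scalerA /b mulrCA divff ?gt_eqF// mulr1.
have -> : toR2 R (pt 1 0) = e1 by rewrite toR2_pt scale1r scale0r addr0.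
rewrite gZ gtr0_norm// -mulrBr [leRHS]mulrC ler_pM2r//.
have [hb|hb] := leP `|b| e'.
  have hb' : - eps0 < b < eps0 by rewrite -ltr_norml (le_lt_trans hb).
  apply: le_trans (hc b hb').
  have b2 : Num.min (b ^+ 2) 1 <= b ^+ 2 by rewrite ge_min lexx.
  apply: (@le_trans _ _ (c0 * e' ^+ 2 * b ^+ 2)); first by rewrite ler_pM2l.
  rewrite -mulrA ler_pM2l// ler_piMl ?sqr_ge0// expr_le1// ltW//.
have b0 : 0 < `|b| by apply: lt_trans hb.
pose l := e' / `|b|.
have l0 : 0 < l by rewrite divr_gt0.
have l1 : l < 1 by rewrite ltr_pdivrMr// mul1r.
have nb : `|l * b| = e' by rewrite normrM gtr0_norm// /l divfK// gt_eqF.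
have hb' : - eps0 < l * b < eps0 by rewrite -ltr_norml nb.
have := hc _ hb'; rewrite -(real_normK (num_real (l * b))) nb.
have -> : e1 + (l * b) *: e2 = (1 - l) *: e1 + l *: (e1 + b *: e2) :> 'rV[R]_2.
  by rewrite scalerDr scalerA addrA -scalerDl subrK scale1r.
move=> h1; have := gD ((1 - l) *: e1) (l *: (e1 + b *: e2)).
rewrite !gZ !gtr0_norm ?subr_gt0// => h2.
have h3 : c0 * e' ^+ 2 <= l * (g (e1 + b *: e2) - g e1).
  by move: h1 h2; rewrite mulrBl mul1r mulrBr; lra.
have d0 : 0 <= g (e1 + b *: e2) - g e1.
  by rewrite -(pmulr_rge0 _ l0); apply: le_trans h3; exact: ltW.
apply: (@le_trans _ _ (c0 * e' ^+ 2)); first by rewrite ger_pMr// ge_min lexx orbT.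
by apply: le_trans h3 _; apply: ler_piMl => //; exact: ltW.
Qed.
End norm.

(** Almost surely positive parts leave the edge weights unchanged, and loop removal identifies the
    self-avoiding infimum with the one over all walks. *)
Lemma limit_norm_lattice (R : realType) (d : measure_display) (Omega : measurableType d)
    (P : probability Omega R) (t : {fset Z2} -> {RV P >-> R}) (g : 'rV[R]_2 -> R) :
  iid_exp1 edges t -> limit_norm t g ->
  forall x, {ae P, forall o, (fun m : nat => ptime setT (fun e => Num.max (t e o) 0) 0 (x *+ m) / m%:R)
    @ \oo --> g (toR2 R x)}.
Proof.
move=> ht [_ hl] x; have h0 := iid_exp1_ae_ge0 ht.
move: hl h0; apply: filterS2 => o hl h0.
have := hl x; rewrite (_ : (fun m : nat => _) = (fun m : nat =>
  ptime setT (fun e => Num.max (t e o) 0) 0 (x *+ m) / m%:R))//.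
apply/funext => m; congr (_ / _).
have w0 e : 0 <= Num.max (t e o) 0 by rewrite le_max lexx orbT.
rewrite -(saw_passage_timeE w0 (setT_walk 0 (x *+ m))) /saw_passage_time.
congr inf; apply/eq_imagel => p [hp lp _].
have wp : walks setT 0 (x *+ m) p by split.
by apply: (path_time_inner wp) => e /inner_edges_sub /h0 he; rewrite max_l.
Qed.

Lemma limit_norm_lattice_norm (R : realType) (d : measure_display) (Omega : measurableType d)
    (P : probability Omega R) (t : {fset Z2} -> {RV P >-> R}) (g : 'rV[R]_2 -> R) :
  iid_exp1 edges t -> limit_norm t g -> lattice_norm (fun x => g (toR2 R x)).
Proof.
move=> ht hg; have [[g0 g00 gZ gD] _] := hg.
have pos x : toR2 R x != 0 -> 0 < g (toR2 R x).
  move=> x0; rewrite lt_neqAle g0 andbT eq_sym; apply/eqP => /g00 h.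
  by rewrite h eqxx in x0.
split.
- move=> x; rewrite (_ : toR2 R (- x) = (-1) *: toR2 R x); first by rewrite gZ normrN1 mul1r.
  by rewrite scaleN1r /toR2 map_mxN.
- by move=> x n; rewrite toR2M gZ ger0_norm.
- by move=> x y; rewrite toR2D.
- apply: pos; rewrite toR2_pt scale1r scale0r addr0; apply/eqP => /rowP /(_ 0).
  by rewrite !mxE /= => /eqP; rewrite oner_eq0.
- apply: pos; rewrite toR2_pt scale1r scale0r add0r; apply/eqP => /rowP /(_ 1).
  by rewrite !mxE /= => /eqP; rewrite oner_eq0.
- exact: (G_flip (iid_base ht) (limit_norm_lattice ht hg)).
Qed.

Theorem corollary1p1 (R : realType)
    (d : measure_display) (Omega : measurableType d) (P : probability Omega R)
    (t : {fset Z2} -> {RV P >-> R}) (ht : iid_exp1 edges t)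
    (g : 'rV[R]_2 -> R) (hg : limit_norm t g)
    (dn : nat -> measure_display) (Omegan : forall n : nat, measurableType (dn n))
    (Pn : forall n : nat, probability (Omegan n) R)
    (tn : forall n : nat, {fset Z2} -> {RV (Pn n) >-> R})
    (htn : forall n : nat, (1 <= n)%N -> torus_weights n (tn n))
    (eps : R) (heps : 0 < eps) (hcurv : curvature_e1 g) :
  exists c : R, 0 < c /\
    forall (n : nat) (k : R), (1 <= n)%N -> 0 < k ->
      ((c * (n%:R : R) `^ ((1 / 8 - eps) * k - 3 / 2))%:E
        <= central_moment (Pn n) (T_tor n (tn n)) k)%E.
Proof.
(* [a <= eps] makes [n^(1/8 - a)] large enough, and [a <= 1 / 8] keeps this exponent nonnegative. *)
pose a := Num.min eps 8^-1.
have a8 : 0 < a <= 8^-1.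
  by apply/andP; split; [rewrite lt_min heps invr_gt0 ltr0n|rewrite ge_min lexx orbT].
have ae : a <= eps by rewrite ge_min lexx.
have [c1 c10 hc1] := curvature_lattice hg.1 hcurv.
have [c c0 [N _ hN]] := torus_fluct (iid_base ht) (limit_norm_lattice ht hg)
  (limit_norm_lattice_norm ht hg) a8 c10 hc1.
pose s (n : nat) : R := n%:R `^ (8^-1 - a).
pose m n := fine 'E_(Pn n)[T_tor n (tn n)].
(* Below the threshold [N] the least of finitely many positive probabilities serves as the
   constant. *)
have small N' : exists2 c' : R, 0 < c' & forall n, (0 < n)%N -> (n < N')%N ->
    exists D : set (Omegan n), [/\ measurable D, (c'%:E <= Pn n D)%E &
      forall o, D o -> s n <= `|ttime n (tn n) o - m n|].
  elim: N' => [|N' [c' c'0 ih]]; first by exists 1.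
  have [N0|N0] := posnP N'.
    by exists c' => // n n0; rewrite N0 ltnS leqNgt n0.
  have [D [mD PD hD]] := torus_time_unbounded N0 (htn N' N0) (m N') (s N').
  have PD' : 0 < fine (Pn N' D) by rewrite -lte_fin -(fineP _ mD).
  exists (Num.min c' (fine (Pn N' D))) => [|n n0]; first by rewrite lt_min c'0.
  rewrite ltnS leq_eqVlt => /orP[/eqP ->|nN].
    exists D; split => //; rewrite (fineP (Pn N') mD) lee_fin.
    by rewrite ge_min lexx orbT.
  have [D' [mD' PD1 hD']] := ih n n0 nN; exists D'; split => //.
  by apply: le_trans PD1; rewrite lee_fin ge_min lexx.
have [c' c'0 hc'] := small N.
exists (Num.min c c'); split => [|n k n1 k0]; first by rewrite lt_min c0.
have nR : 1 <= n%:R :> R by rewrite ler1n.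
have [D [mD PD hD]] : exists D : set (Omegan n), [/\ measurable D,
    ((Num.min c c' * n%:R `^ (- (3 / 2)))%:E <= Pn n D)%E &
    forall o, D o -> s n <= `|ttime n (tn n) o - m n|].
  have [nN|nN] := leqP N n.
    have [D [mD PD hD]] := hN n nN _ _ _ _ (htn n n1) (m n).
    exists D; split => //; apply: le_trans PD.
    by rewrite lee_fin ler_wpM2r ?powR_ge0// ge_min lexx.
  have [D [mD PD hD]] := hc' n n1 nN; exists D; split => //; apply: le_trans PD.
  (* For small [n] the factor [n^(- 3/2)] is merely bounded by 1. *)
  rewrite lee_fin; apply: (@le_trans _ _ (c' * 1)); last by rewrite mulr1.
  apply: ler_pM; rewrite ?powR_ge0 ?le_min ?(ltW c0) ?(ltW c'0)//; first by rewrite ge_min lexx orbT.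
  by rewrite -[leRHS](powRr0 n%:R) ler_powR// oppr_le0 divr_ge0.
have s0 : 0 <= s n by exact: powR_ge0.
apply: le_trans (moment_lower mD (T_tor_ae n1 (htn n n1)) hD s0 k0).
apply: (@le_trans _ _ ((s n `^ k)%:E * (Num.min c c' * n%:R `^ (- (3 / 2)))%:E)%E); last first.
  by apply: lee_wpmul2l PD; rewrite lee_fin powR_ge0.
rewrite -EFinM lee_fin mulrCA natr_powRD// ler_wpM2l ?le_min ?(ltW c0) ?(ltW c'0)//.
rewrite ler_wpM2r ?powR_ge0// /s -powRrM; apply: natr_powR_le => //.
by rewrite ler_wpM2r ?(ltW k0)//; lra.
Qed.
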